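(* Let $d=2$, $\Gamma=[0,1]^2$, $\eta\in(0,1]$, $\alpha\in(0,\infty)$. Suppose $\phi_n \in\Phi_{2,\eta} \cap\Psi_2$ for $n \in\mathbb{N}$. Set $r_n:= \rho_\eta(\phi_n)$ and $p_n:= \mu(\phi_n)$. Then $$n \int_{\Gamma} \exp \Bigl(- n \int_\Gamma \phi_n(y-x) \,dy \Bigr) \,dx \to\alpha\qquad (n\to\infty)$$ holds under any of the following conditions as $n \to\infty$: (1) $p_n = \omega(1/\log n)$ and $n I(\phi_n) - \log n \to- \log\alpha$; (2) $p_n = o(1/\log n)$ and $p_n = \omega( n^{-1/3} (\log n)^{-1})$ and $$n I(\phi_n) = \log \Bigl( \frac{4 J_2(\phi_n)}{\alpha^2J_1(\phi_n)^2} \Bigr) + \log \Bigl(\frac{n}{p_n} \Bigr) - \log\log \Bigl( \frac{n}{p_n} \Bigr) + o(1);$$ (3) $p_n = o(n^{-1/3} (\log n)^{-1})$ and $r_n = n^{-\Omega(1)}$ and $$n I(\phi_n) = 4 \Bigl( \log(1/p_n) - \log\log(1/p_n) + \log\bigl(J_2(\phi_n)/ (\alpha J_1(\phi_n)^2) \bigr) \Bigr) +o(1).$$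
   Context: $|\cdot|$ is the Euclidean norm on $\mathbb{R}^2$. A connection function on $\mathbb{R}^2$ is a measurable $\phi:\mathbb{R}^2\to[0,1]$ with $\phi(x)=\phi(-x)$ for all $x$. Put $\mu(\phi)=\sup_{x}\phi(x)$ and $\rho_\eta(\phi)=\inf\{|x|: x\in\mathbb{R}^2,\ \phi(x)<\eta\mu(\phi)\}$. $\Psi_2$ is the class of connection functions on $\mathbb{R}^2$ with $\phi(x)\ge\phi(y)$ whenever $|x|\le|y|$. $\Phi_{2,\eta}$ is the class of connection functions $\phi$ on $\mathbb{R}^2$ with $\rho_\eta(\phi)\in(0,\infty)$ and $\phi(x)\le 3\eta^{-1}\mu(\phi)\exp(-\eta(|x|/\rho_\eta(\phi))^\eta)$ for all $x$. Define $$I(\phi)=\int_{\mathbb{R}^2}\phi(x)\,dx,$$ $$J_1(\phi)=\mu(\phi)^{-1}\int_0^\infty\phi\bigl((\rho_\eta(\phi)t,0)\bigr)\,dt,\qquad J_2(\phi)=\mu(\phi)^{-1}\int_0^\infty\phi\bigl((\rho_\eta(\phi)t,0)\bigr)\,2\pi t\,dt .$$ Asymptotic notation: $f(n)=\omega(g(n))$ means $g(n)=o(f(n))$; $r_n=n^{-\Omega(1)}$ means that there is a constant $c>0$ with $r_n\le n^{-c}$ for all large $n$. *)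

(* Defs.v *)
From mathcomp Require Import all_boot all_order all_algebra.
From mathcomp Require Import all_classical all_reals all_analysis.
Set Implicit Arguments.
Unset Strict Implicit.
Unset Printing Implicit Defensive.
Import Order.TTheory GRing.Theory Num.Theory.
Import numFieldNormedType.Exports.
Local Open Scope classical_set_scope.
Local Open Scope ring_scope.

(* The norm instance on R * R is the sup norm. *)
Definition enorm {R : realType} (x : R * R) : R :=
  Num.sqrt (x.1 ^+ 2 + x.2 ^+ 2).

Definition lebesgue2 {R : realType} :
    {measure set (measurableTypeR R * measurableTypeR R)%type -> \bar R} :=
  (lebesgue_measure \x lebesgue_measure)%E.

Definition unit_square {R : realType} : set (R * R) :=
  `[0, 1] `*` `[0, 1].

Definition connection_function {R : realType} (phi : R * R -> R) : Prop :=
  [/\ measurable_fun setT phi,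
      forall x, 0 <= phi x <= 1 &
      forall x, phi x = phi (- x)].

Definition mu {R : realType} (phi : R * R -> R) : R := sup (range phi).

(* Extended-real valued, so that the infimum of the empty set is +oo. *)
Definition rhoE {R : realType} (eta : R) (phi : R * R -> R) : \bar R :=
  ereal_inf [set (enorm x)%:E | x in [set x | phi x < eta * mu phi]].

Definition rho {R : realType} (eta : R) (phi : R * R -> R) : R :=
  fine (rhoE eta phi).

Definition Psi2 {R : realType} : set (R * R -> R) :=
  [set phi | connection_function phi /\
             forall x y, enorm x <= enorm y -> phi y <= phi x].

Definition Phi2 {R : realType} (eta : R) : set (R * R -> R) :=
  [set phi | [/\ connection_function phi,
      (0 < rhoE eta phi < +oo)%E &
      forall x, phi x <=
        3 * eta^-1 * mu phi *
          expR (- (eta * (enorm x / rho eta phi) `^ eta))]].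

(* These real-valued integrals are finite on Phi2. *)
Definition Iint {R : realType} (phi : R * R -> R) : R :=
  \int[lebesgue2]_x phi x.

Definition J1 {R : realType} (eta : R) (phi : R * R -> R) : R :=
  (mu phi)^-1 *
  \int[lebesgue_measure]_(t in `[0, +oo[) phi (rho eta phi * t, 0).

Definition J2 {R : realType} (eta : R) (phi : R * R -> R) : R :=
  (mu phi)^-1 *
  \int[lebesgue_measure]_(t in `[0, +oo[)
    (phi (rho eta phi * t, 0) * (2 * pi * t)).

(* [is_omega f g] reads f(n) = omega(g(n)). *)
Definition is_omega {R : realType} (f g : nat -> R) : Prop := g =o_\oo f.

Definition is_polynomially_small {R : realType} (r : nat -> R) : Prop :=
  exists2 c : R, 0 < c & \forall n \near \oo, r n <= n%:R `^ (- c).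

(* Main.v *)
(* Write [p = mu phi], [r = rho phi], [lam = n I(phi)] and [N = n p r^2], so that
   [lam = N J2].  Splitting the unit square into four rectangles at [x], the mass of
   [phi (y - x)] is a sum of four masses [k] of rectangles with a corner at the
   origin; with [h a] the mass of the strip [0, a] x [0, oo[ of the quadrant and
   [H = I(phi) / 4], one has for [x, y <= 1/2], up to an error [O(p r^3)],
   max (2 h x + 2 h y, H + h x + h y) <= mass <= min (4 H, 2 h x + 2 H,
   2 h y + 2 H, H + h x + h y + p x y).  Near 0 the function [h] is linear with slope
   [p r J1], so the interior, the four edges and the four corners contribute
   [n e^(- lam)], [sqrt (n e^(- lam) / q)] and [e^(- lam / 4) / q] respectively, where
   [q = p lam J1^2 / (4 J2)], provided that [N -> oo] and [r <= e^(- c N)].  In each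
   of the three regimes exactly one of these terms tends to [alpha] and the other
   two vanish. *)

Require Import Defs.
From mathcomp Require Import all_boot all_order all_algebra.
From mathcomp Require Import all_classical all_reals all_analysis.
From mathcomp Require Import measurable_realfun.
From mathcomp Require Import ring lra.
Import Order.TTheory GRing.Theory Num.Theory.
Import numFieldNormedType.Exports.
Local Open Scope classical_set_scope.
Local Open Scope ring_scope.
Set Implicit Arguments.
Unset Strict Implicit.
Unset Printing Implicit Defensive.

(** * Change of variables on the line *)

(** The three regimes reflect two identities. If t1, t2, t3 are the interior, edge and corner
    contributions, then t1 = q t2^2 and t3^4 = t2^2 / (q n^(1/3))^3. Since [J1] and [J2] stay
    between positive constants and lam is of order log n, q is of order p log n, so the conditions
    on p say exactly whether q and q n^(1/3) tend to 0 or to infinity. The iterated logarithms in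
    the hypotheses cancel the factor lam inside q. The order of lam also gives N -> oo. The
    smallness of r is assumed in (3); in (1) and (2) it is extracted from lam = n p r^2 J2 and the
    lower bound on p. The obstacle is uniformity: the kernel varies with n, so every estimate has
    constants depending on eta only, and the tail enters only through Markov's inequality, n (H - h
    a) = O(N r / a). This calls for three cutoffs: r / N^(2/3), where h is linearised; K r with K
    large, the width of the edge strips; and sqrt r, beyond which the tail is negligible. *)

Section change_of_variables.
Context {R : realType}.
Notation leb := (@lebesgue_measure R).
Implicit Types (D : set R) (f : R -> \bar R) (a b : R).

Lemma measurable_affine a b :
  measurable_fun setT (fun x : measurableTypeR R => a * x + b : measurableTypeR R).
Proof. by apply: measurable_funD => //; exact: measurable_funM. Qed.

(** Lebesgue measure is determined by its values on the intervals ]c, d], and on these the scaled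
    pushforward under x |-> a x + b is computed directly. *)
Lemma lebesgue_measure_affine a b (A : set R) : 0 < a -> measurable A ->
  leb A = (a%:E * leb ((fun x => a * x + b)%R @^-1` A))%E.
Proof.
move=> a0 mA.
pose m := mscale (NngNum (ltW a0))
  (pushforward leb (fun x : measurableTypeR R => a * x + b : measurableTypeR R)).
rewrite (@lebesgue_measure_unique R (m (measurable_affine a b))) //.
move=> _ [[c d]] _ <- /=; rewrite /m /mscale /= /pushforward.
rewrite (_ : _ @^-1` _ = `](c - b) / a, (d - b) / a]%classic); last first.
  apply/seteqP; split => x /=; rewrite !in_itv /= ltr_pdivrMr// ler_pdivlMr//;
   move=> /andP[]; rewrite (mulrC x); move=> *; apply/andP; split; lra.
rewrite !lebesgue_measure_itv /= !lte_fin ltr_pM2r ?invr_gt0// ltrD2r.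
case: ifPn => _; last by rewrite mule0.
by rewrite -!EFinB -EFinM; congr _%:E; field; rewrite gt_eqF.
Qed.

Lemma ge0_integral_affine a b D f : 0 < a -> measurable D ->
  measurable_fun D f -> (forall x, D x -> 0 <= f x)%E ->
  (\int[leb]_(y in D) f y =
   a%:E * \int[leb]_(x in (fun x => a * x + b)%R @^-1` D) f (a * x + b)%R)%E.
Proof.
move=> a0 mD mf f0.
pose g : measurableTypeR R -> measurableTypeR R := fun x => a * x + b.
have mg : measurable_fun setT g := measurable_affine a b.
pose m := mscale (NngNum (ltW a0)) (pushforward leb g).
transitivity (\int[m mg]_(y in D) f y)%E.
  apply: eq_measure_integral => //= A mA AD.
  by rewrite (lebesgue_measure_affine b a0).
rewrite ge0_integral_mscale//= ge0_integral_pushforward//.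
by move=> y /set_mem; exact: f0.
Qed.

Lemma ge0_integral_opp D f : measurable D ->
  measurable_fun D f -> (forall x, D x -> 0 <= f x)%E ->
  (\int[leb]_(y in D) f y = \int[leb]_(x in -%R @^-1` D) f (- x)%R)%E.
Proof.
move=> mD mf f0.
have mo : measurable_fun setT (-%R : measurableTypeR R -> measurableTypeR R) by [].
apply: etrans; last apply: (@ge0_integral_pushforward _ _ _ _ R _ mo leb D f mD mf).
  by apply: eq_measure_integral => //= A mA AS; exact/esym/lebesgue_measureN.
by move=> y /set_mem; exact: f0.
Qed.

End change_of_variables.

(** * Folding one-dimensional integrals by parity and reflection *)

Section folding.
Context {R : realType}.
Notation leb := (@lebesgue_measure R).
Implicit Types (g : R -> \bar R).
Local Open Scope ereal_scope.

(** Recentre at x, then reflect the part to the left of the origin. Used once in each coordinate,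
    this cuts the unit square at a point into four rectangles with a corner at the origin. *)
Lemma integral_even_shift g (x : R) : measurable_fun setT g ->
  (forall y, 0 <= g y) -> (forall y, g (- y)%R = g y) -> (0 <= x <= 1)%R ->
  \int[leb]_(y in `[0%R, 1%R]) g (y - x)%R =
  \int[leb]_(y in `[0%R, x]) g y + \int[leb]_(y in `[0%R, (1 - x)%R]) g y.
Proof.
move=> mg g0 gN /andP[x0 x1].
have mgS (D : set R) : measurable_fun D g by exact: measurable_funS mg.
transitivity (\int[leb]_(y in `[(- x)%R, (1 - x)%R]) g y).
  rewrite [RHS](@ge0_integral_affine R 1%R (- x)%R)// mul1e.
  rewrite (_ : _ @^-1` _ = `[0%R, 1%R]%classic); last first.
    by apply/seteqP; split => y /=; rewrite !in_itv/= => /andP[? ?];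
      apply/andP; split; lra.
  by apply: eq_integral => y _; rewrite mul1r.
have -> : `[(- x)%R, (1 - x)%R]%classic = `[(- x)%R, 0%R[ `|` `[0%R, (1 - x)%R].
  apply/seteqP; split => y /=; rewrite !in_itv/=.
    by move=> /andP[? ?]; have [?|?] := ltP y 0%R; [left|right]; apply/andP; split; lra.
  by move=> [] /andP[? ?]; apply/andP; split; lra.
have dis : [disjoint (`[(- x)%R, 0%R[%classic : set R) & (`[0%R, (1 - x)%R]%classic : set R)].
  apply/disj_setPS => y /= []; rewrite !in_itv/= => /andP[_ ?] /andP[? _]; lra.
rewrite (@ge0_integral_setU _ _ _ leb _ _ _ _ g (mgS _) _ dis)//.
congr (_ + _).
rewrite [LHS]ge0_integral_opp// (_ : _ @^-1` _ = `]0%R, x]%classic); last first.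
  by apply/seteqP; split => y /=; rewrite !in_itv/= => /andP[? ?];
      apply/andP; split; lra.
under eq_integral do rewrite gN.
exact: integral_itv_obnd_cbnd.
Qed.

Lemma integral_even g : measurable_fun setT g ->
  (forall y, 0 <= g y) -> (forall y, g (- y)%R = g y) ->
  \int[leb]_y g y = 2%:E * \int[leb]_(y in `[0%R, +oo[) g y.
Proof.
move=> mg g0 gN.
have mgS (D : set R) : measurable_fun D g by exact: measurable_funS mg.
have -> : [set: R] = `]-oo, 0%R[ `|` `[0%R, +oo[.
  apply/seteqP; split => y //= _; rewrite !in_itv/= andbT.
  by have [?|?] := ltP y 0%R; [left|right].
have dis : [disjoint (`]-oo, 0%R[%classic : set R) & (`[0%R, +oo[%classic : set R)].
  apply/disj_setPS => y /= []; rewrite !in_itv/= andbT; lra.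
rewrite (@ge0_integral_setU _ _ _ leb _ _ _ _ g (mgS _) _ dis)//.
rewrite [X in X + _]ge0_integral_opp// (_ : _ @^-1` _ = `]0%R, +oo[%classic); last first.
  by apply/seteqP; split => y /=; rewrite !in_itv/= andbT; lra.
under [X in X + _]eq_integral do rewrite gN.
rewrite integral_itv_obnd_cbnd//.
by rewrite (_ : 2%R = 1 + 1)%R // EFinD ge0_muleDl// !mul1e.
Qed.

Lemma integral_symm_half g : measurable_fun setT g ->
  (forall y, 0 <= g y) -> (forall y, 0 <= y <= 1 -> g (1 - y) = g y)%R ->
  \int[leb]_(y in `[0%R, 1%R]) g y = 2%:E * \int[leb]_(y in `[0%R, 2^-1%R]) g y.
Proof.
move=> mg g0 gN.
have mgS (D : set R) : measurable_fun D g by exact: measurable_funS mg.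
have -> : `[0%R, 1%R]%classic = `[0%R, 2^-1%R] `|` `]2^-1%R, 1%R] :> set R.
  apply/seteqP; split => y /=; rewrite !in_itv/=.
    by move=> /andP[? ?]; have [?|?] := leP y 2^-1%R; [left|right]; apply/andP; split; lra.
  by move=> [] /andP[? ?]; apply/andP; split; lra.
have dis : [disjoint (`[0%R, 2^-1%R]%classic : set R) & (`]2^-1%R, 1%R]%classic : set R)].
  apply/disj_setPS => y /= []; rewrite !in_itv/= => /andP[_ ?] /andP[? _]; lra.
rewrite (@ge0_integral_setU _ _ _ leb _ _ _ _ g (mgS _) _ dis)//.
rewrite [X in _ + X](_ : _ = \int[leb]_(y in `[0%R, 2^-1%R]) g y).
  by rewrite (_ : 2%R = 1 + 1)%R // EFinD ge0_muleDl// ?lee_fin// !mul1e.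
rewrite [LHS]ge0_integral_opp// (_ : _ @^-1` _ = `[(- 1)%R, (- 2^-1)%R[%classic); last first.
  by apply/seteqP; split => y /=; rewrite !in_itv/= => /andP[? ?];
      apply/andP; split; lra.
have mgo : measurable_fun setT (fun y : R => g (- y)%R).
  exact: (measurableT_comp mg).
have mgoS (D : set R) : measurable_fun D (fun y : R => g (- y)%R).
  exact: measurable_funS mgo.
rewrite [LHS](@ge0_integral_affine R 1%R (- 1)%R)//.
rewrite mul1e (_ : _ @^-1` _ = `[0%R, 2^-1%R[%classic); last first.
  by apply/seteqP; split => y /=; rewrite !in_itv/= => /andP[? ?];
      apply/andP; split; lra.
rewrite -integral_itv_bndo_bndc//; apply: eq_integral => y /set_mem.
rewrite /= in_itv/= => /andP[y0 y1]; rewrite mul1r opprB gN// y0/=; lra.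
Qed.

End folding.

(** * Tonelli's theorem on product sets *)

Lemma measurable_integral_section d1 d2 (T1 : measurableType d1)
    (T2 : measurableType d2) (R : realType)
    (m : {sigma_finite_measure set T2 -> \bar R}) (f : T1 * T2 -> \bar R)
    (B : set T2) : measurable B -> measurable_fun setT f -> (forall z, 0 <= f z)%E ->
  measurable_fun setT (fun u => \int[m]_(v in B) f (u, v))%E.
Proof.
move=> mB mf f0.
have -> : (fun u => \int[m]_(v in B) f (u, v))%E =
    fubini_F m (f \_ ([set: T1] `*` B)).
  apply/funext => u; rewrite /fubini_F [LHS]integral_mkcond.
  by apply: eq_integral => v _; rewrite !patchE in_setX/= mem_setT.
apply: measurable_fun_fubini_tonelli_F.
- by apply/(measurable_restrictT _ _).1 => //; [exact: measurableX|exact: measurable_funS mf].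
- by move=> z; rewrite patchE; case: ifP.
Qed.

Section tonelli.
Context {R : realType}.
Notation leb := (@lebesgue_measure R).
Local Open Scope ereal_scope.

Lemma integral_setX (f : R * R -> \bar R) (A B : set R) :
  measurable A -> measurable B -> measurable_fun setT f -> (forall z, 0 <= f z) ->
  \int[@lebesgue2 R]_(z in A `*` B) f z =
  \int[leb]_(u in A) \int[leb]_(v in B) f (u, v).
Proof.
move=> mA mB mf f0.
rewrite integral_mkcond (fubini_tonelli1 (m1 := leb) (m2 := leb))/=; last first.
- by move=> z; rewrite patchE; case: ifP.
- by apply/(measurable_restrictT _ _).1 => //; [exact: measurableX|exact: measurable_funS mf].
rewrite [RHS]integral_mkcond; apply: eq_integral => u _.
rewrite /fubini_F patchE; case: ifPn => uA.
  rewrite [RHS]integral_mkcond; apply: eq_integral => v _.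
  by rewrite !patchE in_setX/= uA.
by rewrite integral0_eq// => v _; rewrite patchE in_setX/= (negbTE uA).
Qed.

Lemma integral_setX_swap (f : R * R -> \bar R) (A B : set R) :
  measurable A -> measurable B -> measurable_fun setT f -> (forall z, 0 <= f z) ->
  \int[leb]_(u in A) \int[leb]_(v in B) f (u, v) =
  \int[leb]_(v in B) \int[leb]_(u in A) f (u, v).
Proof.
move=> mA mB mf f0.
rewrite -integral_setX//.
rewrite integral_mkcond (fubini_tonelli2 (m1 := leb) (m2 := leb))/=; last first.
- by move=> z; rewrite patchE; case: ifP.
- by apply/(measurable_restrictT _ _).1 => //; [exact: measurableX|exact: measurable_funS mf].
rewrite [RHS]integral_mkcond; apply: eq_integral => v _.
rewrite /fubini_G patchE; case: ifPn => vB.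
  rewrite [RHS]integral_mkcond; apply: eq_integral => u _.
  by rewrite !patchE in_setX/= vB andbT.
by rewrite integral0_eq// => u _; rewrite patchE in_setX/= (negbTE vB) andbF.
Qed.

End tonelli.

(** * Integrals of radial functions over a quadrant *)

Section polar.
Context {R : realType}.
Notation leb := (@lebesgue_measure R).
Local Open Scope ereal_scope.

Lemma measurable_sqrt : measurable_fun setT (@Num.sqrt R).
Proof. apply: continuous_measurable_fun; exact: sqrt_continuous. Qed.

(* The substitution [v = u * w] replaces polar coordinates. *)
Lemma integral_quadrant_radial (f : R -> \bar R) :
  measurable_fun setT f -> (forall t, 0 <= f t) ->
  \int[leb]_(u in `[0%R, +oo[) \int[leb]_(v in `[0%R, +oo[)
    f (Num.sqrt (u ^+ 2 + v ^+ 2)) =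
  (pi / 2)%:E * \int[leb]_(t in `[0%R, +oo[) (t%:E * f t).
Proof.
move=> mf f0.
have mfS (D : set R) : measurable_fun D f by exact: measurable_funS mf.
pose s (w : R) : R := Num.sqrt (1 + w ^+ 2).
have s0 w : (0 < s w)%R.
  by rewrite sqrtr_gt0 ltr_pwDl// sqr_ge0.
have ms : measurable_fun setT s.
  apply: measurableT_comp; first exact: measurable_sqrt.
  by apply: measurable_funD => //; exact: measurable_funX.
(* The factor is the Jacobian u of v = u w, truncated at 0 so that the integrand is nonnegative on
   the whole plane before the order of integration is exchanged. *)
pose F (z : R * R) : \bar R := (Num.max z.1 0)%:E * f (z.1 * s z.2)%R.
have F0 z : 0 <= F z.
  by rewrite mule_ge0// lee_fin le_max lexx orbT.
have mF : measurable_fun setT F.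
  apply: emeasurable_funM.
    apply/measurable_EFinP; apply: measurable_maxr => //.
  apply: measurableT_comp => //; apply: measurable_funM => //.
  exact: measurableT_comp.
have mH : measurable_fun setT
    (fun z : R * R => f (Num.sqrt (z.1 ^+ 2 + z.2 ^+ 2))).
  apply: measurableT_comp => //; apply: measurableT_comp; first exact: measurable_sqrt.
  by apply: measurable_funD => //; apply: measurable_funX.
have mgu (u : R) : measurable_fun setT
    (fun v : R => f (Num.sqrt (u ^+ 2 + (u * v + 0) ^+ 2))).
  apply: measurableT_comp => //; apply: measurableT_comp; first exact: measurable_sqrt.
  apply: measurable_funD => //; apply: measurable_funX.
  by apply: measurable_funD => //; apply: measurable_funM.
have mFs (w : R) : measurable_fun setT
    (fun u : R => (Num.max (s w * u + 0) 0)%:E * f (s w * u + 0)%R).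
  have ma : measurable_fun setT (fun u : R => s w * u + 0)%R.
    by apply: measurable_funD => //; apply: measurable_funM.
  apply: emeasurable_funM; last exact: measurableT_comp.
  by apply/measurable_EFinP; apply: measurable_maxr.
have step1 (u : R) : u \in `]0%R, +oo[%classic ->
  \int[leb]_(v in `[0%R, +oo[) f (Num.sqrt (u ^+ 2 + v ^+ 2)) =
  \int[leb]_(w in `[0%R, +oo[) F (u, w).
  move=> /set_mem; rewrite /= in_itv/= andbT => u0.
  have mg : measurable_fun setT (fun v : R => f (Num.sqrt (u ^+ 2 + v ^+ 2))).
    apply: measurableT_comp => //; apply: measurableT_comp => //; first exact: measurable_sqrt.
    by apply: measurable_funD => //; exact: measurable_funX.
  rewrite (@ge0_integral_affine R u 0%R)//; last exact: measurable_funS mg.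
  rewrite (_ : _ @^-1` _ = `[0%R, +oo[%classic); last first.
    by apply/seteqP; split => y /=; rewrite !in_itv/= !andbT addr0 pmulr_rge0.
  rewrite -ge0_integralZl_EFin//; last 2 first.
  - exact: measurable_funTS (mgu u).
  - exact: ltW.
  apply: eq_integral => w _; rewrite /F/= (max_idPl _) ?ltW//; congr (_ * f _).
  rewrite addr0 /s exprMn -{1}(mulr1 (u ^+ 2)%R) -mulrDr sqrtrM ?sqr_ge0//.
  by rewrite sqrtr_sqr gtr0_norm.
(* After the exchange, t = u sqrt (1 + w^2) leaves the factor 1 / (1 + w^2), whose integral over the
   half-line is pi / 2. *)
have step2 (w : R) :
  \int[leb]_(u in `]0%R, +oo[) F (u, w) =
   ((oneDsqr w)^-1)%:E * \int[leb]_(t in `[0%R, +oo[) (t%:E * f t).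
  have mg : measurable_fun setT (fun t : R => (Num.max t 0)%:E * f t).
    by apply: emeasurable_funM => //; apply/measurable_EFinP; apply: measurable_maxr => //.
  have -> : \int[leb]_(t in `[0%R, +oo[) (t%:E * f t) =
      \int[leb]_(t in `]0%R, +oo[) ((Num.max t 0)%:E * f t).
    rewrite integral_itv_obnd_cbnd; last exact: measurable_funS mg.
    apply: eq_integral => t /set_mem; rewrite /= in_itv/= andbT => t0.
    by rewrite (max_idPl _).
  rewrite [in RHS](@ge0_integral_affine R (s w) 0%R)//; last 2 first.
  - exact: measurable_funS mg.
  - by move=> x _; rewrite mule_ge0// lee_fin le_max lexx orbT.
  rewrite (_ : _ @^-1` _ = `]0%R, +oo[%classic); last first.
    by apply/seteqP; split => y /=; rewrite !in_itv/= !andbT addr0 pmulr_rgt0.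
  rewrite muleA -EFinM -ge0_integralZl_EFin//; last 3 first.
  - by move=> x _; rewrite mule_ge0// lee_fin le_max lexx orbT.
  - exact: measurable_funTS (mFs w).
  - by rewrite mulr_ge0// ?invr_ge0// ?ltW// (lt_le_trans _ (oneDsqr_ge1 _)).
  apply: eq_integral => u /set_mem; rewrite /= in_itv/= andbT => u0.
  rewrite /F/= addr0 muleA -EFinM (max_idPl _) ?ltW// (max_idPl _) ?mulr_ge0 ?ltW//.
  rewrite (mulrC u); congr (_%:E * _).
  have ss : (s w ^+ 2 = oneDsqr w)%R by rewrite sqr_sqrtr// addr_ge0// sqr_ge0.
  by rewrite -ss; field; rewrite gt_eqF.
rewrite -integral_itv_obnd_cbnd; last first.
  by apply: measurable_funTS; exact: (measurable_integral_section leb _ mH).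
transitivity (\int[leb]_(u in `]0%R, +oo[) \int[leb]_(w in `[0%R, +oo[) F (u, w)).
  exact: eq_integral.
rewrite integral_setX_swap//.
under eq_integral do rewrite step2.
rewrite ge0_integralZr//; last 2 first.
- apply/measurable_EFinP; apply: measurable_funTS.
  by apply: continuous_measurable_fun; exact: continuous_oneDsqrV.
- by apply: integral_ge0 => t /=; rewrite in_itv/= andbT => t0; rewrite mule_ge0.
by rewrite integral0y_oneDsqr.
Qed.

End polar.

(** * Masses of rectangles for a radial kernel *)

Lemma le_of_EFin {R : realType} (x y : R) (X Y : \bar R) :
  x%:E = X -> y%:E = Y -> (X <= Y)%E -> x <= y.
Proof. by move=> <- <-; rewrite lee_fin. Qed.

Lemma add_of_EFin {R : realType} (x y z : R) (X Y : \bar R) :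
  x%:E = X -> y%:E = Y -> z%:E = (X + Y)%E -> z = x + y.
Proof. by move=> <- <-; rewrite -EFinD; exact: EFin_inj. Qed.

Section radial.
Context {R : realType} (phi : R * R -> R) (p M0 M1 M2 : R).
Notation leb := (@lebesgue_measure R).
Context (mphi : measurable_fun setT phi) (phi_ge0 : forall z, 0 <= phi z)
  (phi_le : forall z, phi z <= p)
  (phi_rad : forall x y, enorm x <= enorm y -> phi y <= phi x)
  (moment0 : (\int[leb]_(t in `[0%R, +oo[) (phi (t, 0%R))%:E)%E = M0%:E)
  (moment1 : (\int[leb]_(t in `[0%R, +oo[) (t * phi (t, 0%R))%:E)%E = M1%:E)
  (moment2 : (\int[leb]_(t in `[0%R, +oo[) (t ^+ 2 * phi (t, 0%R))%:E)%E = M2%:E).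

Lemma phi_enorm x y : enorm x = enorm y -> phi x = phi y.
Proof. by move=> e; apply/eqP; rewrite eq_le !phi_rad// e. Qed.

Lemma phi_swap u v : phi (u, v) = phi (v, u).
Proof. by apply: phi_enorm; rewrite /enorm/= addrC. Qed.

Lemma phi_oppl u v : phi (- u, v) = phi (u, v).
Proof. by apply: phi_enorm; rewrite /enorm/= sqrrN. Qed.

Lemma phi_oppr u v : phi (u, - v) = phi (u, v).
Proof. by apply: phi_enorm; rewrite /enorm/= sqrrN. Qed.

Lemma phi_axis u v : phi (Num.sqrt (u ^+ 2 + v ^+ 2), 0) = phi (u, v).
Proof.
apply: phi_enorm; rewrite /enorm/= expr0n/= addr0 sqr_sqrtr//.
by rewrite addr_ge0 ?sqr_ge0.
Qed.

Let mphiE : measurable_fun setT (EFin \o phi).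
Proof. exact/measurable_EFinP. Qed.

Let mphi1 u : measurable_fun setT (fun v => (phi (u, v))%:E).
Proof. by apply/measurable_EFinP; apply: measurableT_comp. Qed.

Let mphi2 v : measurable_fun setT (fun u => (phi (u, v))%:E).
Proof. by apply/measurable_EFinP; apply: measurableT_comp. Qed.

Definition massE (A B : set R) : \bar R :=
  (\int[leb]_(u in A) \int[leb]_(v in B) (phi (u, v))%:E)%E.

Lemma massEE A B : massE A B =
  (\int[leb]_(u in A) \int[leb]_(v in B) (phi (u, v))%:E)%E.
Proof. by []. Qed.

Let inner (B : set R) u : \bar R := (\int[leb]_(v in B) (phi (u, v))%:E)%E.

Let inner_ge0 B u : (0 <= inner B u)%E.
Proof. by apply: integral_ge0 => v _; rewrite lee_fin. Qed.

Let m_inner B : measurable B -> measurable_fun setT (inner B).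
Proof.
move=> mB; by apply: (@measurable_integral_section _ _ _ _ _ leb (EFin \o phi)).
Qed.

Lemma massE_ge0 A B : (0 <= massE A B)%E.
Proof. by apply: integral_ge0 => u _; exact: inner_ge0. Qed.

Lemma massE_sym A B : measurable A -> measurable B -> massE A B = massE B A.
Proof.
move=> mA mB; rewrite /massE [LHS](@integral_setX_swap _ (EFin \o phi))//.
apply: eq_integral => u _; apply: eq_integral => v _.
by rewrite /= phi_swap.
Qed.

Lemma le_massE A A' B B' : measurable A -> measurable A' -> measurable B ->
  measurable B' -> A `<=` A' -> B `<=` B' -> (massE A B <= massE A' B')%E.
Proof.
move=> mA mA' mB mB' AA BB; apply: (@le_trans _ _ (massE A' B)).
  apply: ge0_subset_integral => //; first exact: measurable_funTS (m_inner mB).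
  by move=> u _; exact: inner_ge0.
apply: ge0_le_integral => //.
- by move=> u _; exact: inner_ge0.
- exact: measurable_funTS (m_inner mB).
- exact: measurable_funTS (m_inner mB').
- move=> u _; apply: ge0_subset_integral => //; first exact: measurable_funTS (mphi1 u).
  by move=> v _; rewrite lee_fin.
Qed.

Lemma massEUl A A' B : measurable A -> measurable A' -> measurable B ->
  [disjoint A & A'] -> massE (A `|` A') B = (massE A B + massE A' B)%E.
Proof.
move=> mA mA' mB AA; rewrite /massE ge0_integral_setU//.
- exact: measurable_funTS (m_inner mB).
- by move=> u _; exact: inner_ge0.
Qed.

Local Notation Ry := (`[0%R, +oo[%classic : set R).

(** The weight is 1 for the mass of the quadrant and |t| for the first moment behind
    [hmass_tail]. *)
Lemma integral_quadrant_weight (w : R -> R) : measurable_fun setT w ->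
  (forall t, 0 <= w t) ->
  (\int[leb]_(u in Ry) \int[leb]_(v in Ry)
     (w (Num.sqrt (u ^+ 2 + v ^+ 2)) * phi (u, v))%:E)%E =
  ((pi / 2)%:E * \int[leb]_(t in Ry) (t * (w t * phi (t, 0%R)))%:E)%E.
Proof.
move=> mw w0.
transitivity (\int[leb]_(u in Ry) \int[leb]_(v in Ry)
   (fun t => (w t * phi (t, 0))%:E) (Num.sqrt (u ^+ 2 + v ^+ 2)%R))%E.
  by apply: eq_integral => u _; apply: eq_integral => v _; rewrite phi_axis.
rewrite (@integral_quadrant_radial _ (fun t => (w t * phi (t, 0))%:E)).
- by apply: congr1; apply: eq_integral => t _; rewrite -EFinM.
- apply/measurable_EFinP; apply: measurable_funM => //.
  exact: measurableT_comp.
- by move=> t; rewrite lee_fin mulr_ge0.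
Qed.

Definition Hmass : R := pi / 2 * M1.

Lemma massE_quadrant : massE Ry Ry = Hmass%:E.
Proof.
rewrite /massE -[LHS]/(massE _ _) /Hmass EFinM -moment1.
have := @integral_quadrant_weight (cst 1) (@measurable_cst _ _ _ _ _ _) (fun=> ler01).
under [in X in _ -> X]eq_integral do rewrite -{1}(mul1r (phi _)).
move=> <-; apply: eq_integral => u _; apply: eq_integral => v _.
by rewrite /= mul1r.
Qed.

Definition mass A B : R := fine (massE A B).

Lemma massK A B : measurable A -> measurable B -> A `<=` Ry -> B `<=` Ry ->
  (mass A B)%:E = massE A B.
Proof.
move=> mA mB AR BR; rewrite /mass fineK// ge0_fin_numE ?massE_ge0//.
by rewrite (le_lt_trans (@le_massE A Ry B Ry _ _ _ _ _ _))// massE_quadrant ltry.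
Qed.

Definition kmass a b : R := mass `[0, a]%classic `[0, b]%classic.
Definition hmass a : R := mass `[0, a]%classic Ry.

Let itvRy (a : R) : `[0, a]%classic `<=` Ry.
Proof. by move=> x; rewrite /= !in_itv/= => /andP[->]. Qed.

Let oitvRy (a : R) : 0 <= a -> `]a, +oo[%classic `<=` Ry.
Proof. by move=> a0 x; rewrite /= !in_itv/= !andbT => /ltW; exact: le_trans. Qed.


Lemma kmassE a b : (kmass a b)%:E = massE `[0, a]%classic `[0, b]%classic.
Proof. by rewrite massK//; exact: itvRy. Qed.

Lemma hmassE a : (hmass a)%:E = massE `[0, a]%classic Ry.
Proof. by rewrite massK//; exact: itvRy. Qed.

Lemma kmass_ge0 a b : 0 <= kmass a b.
Proof. by rewrite -lee_fin kmassE massE_ge0. Qed.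

Lemma hmass_ge0 a : 0 <= hmass a.
Proof. by rewrite -lee_fin hmassE massE_ge0. Qed.

Lemma kmass_sym a b : kmass a b = kmass b a.
Proof.
exact: EFin_inj (etrans (kmassE a b) (etrans
  (massE_sym (measurable_itv _) (measurable_itv _)) (esym (kmassE b a)))).
Qed.

Lemma kmass_le_hmass a b : kmass a b <= hmass a.
Proof.
by apply: (le_of_EFin (kmassE a b) (hmassE a)); apply: le_massE => //; exact: itvRy.
Qed.

Lemma hmass_le_Hmass a : hmass a <= Hmass.
Proof.
apply: (le_of_EFin (hmassE a) (esym massE_quadrant)).
by apply: le_massE => //; exact: itvRy.
Qed.

Lemma hmass_mono a b : a <= b -> hmass a <= hmass b.
Proof.
move=> ab; apply: (le_of_EFin (hmassE a) (hmassE b)); apply: le_massE => // x /=.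
by rewrite !in_itv/= => /andP[-> /le_trans ->].
Qed.

Let massE_split a (B : set R) : 0 <= a -> measurable B ->
  massE Ry B = (massE `[0%R, a]%classic B + massE `]a, +oo[%classic B)%E.
Proof.
move=> a0 mB; rewrite -massEUl//.
  congr massE; apply/seteqP; split => x; rewrite /= !in_itv/= !andbT.
    by move=> x0; have [?|?] := leP x a; [left; apply/andP|right].
  by move=> [/andP[]//|/ltW]; exact: le_trans.
apply/disj_setPS => x []/=; rewrite !in_itv/= andbT => /andP[_ xa] ax; lra.
Qed.

(** Inclusion-exclusion in the quadrant: the strip of width a along one axis and the strip of width
    b along the other overlap exactly in the rectangle of [kmass a b]. By symmetry both are cut at b
    in the first coordinate. *)
Lemma hmassD_le a b : 0 <= a -> 0 <= b -> hmass a + hmass b <= Hmass + kmass a b.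
Proof.
move=> a0 b0.
have arith (x y z k k' s t : R) : k = k' -> x = k' + s -> z = y + t -> s <= t ->
    x + y <= z + k by lra.
have rE := massK (measurable_itv `]b, +oo[) (measurable_itv `[0, +oo[)
  (oitvRy b0) (@subset_refl _ Ry).
have sE := massK (measurable_itv `]b, +oo[) (measurable_itv `[0, a])
  (oitvRy b0) (@itvRy a).
have hb := add_of_EFin (hmassE b) rE
  (etrans (esym massE_quadrant) (massE_split b0 (measurable_itv _))).
have ha := add_of_EFin (kmassE b a) sE (etrans (hmassE a) (etrans
  (massE_sym (measurable_itv _) (measurable_itv _)) (massE_split b0 (measurable_itv _)))).
have st : mass `]b, +oo[%classic `[0, a]%classic <= mass `]b, +oo[%classic Ry.
  apply: (le_of_EFin sE rE); apply: le_massE => //; exact: itvRy.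
exact: arith (kmass_sym a b) ha hb st.
Qed.

Lemma kmass_le a b : 0 <= a -> 0 <= b -> kmass a b <= p * a * b.
Proof.
move=> a0 b0; rewrite -lee_fin kmassE massEE.
have le1 u : (inner `[0%R, b]%classic u <= (p * b)%:E)%E.
  have -> : (p * b)%:E = (\int[leb]_(v in `[0%R, b]) (cst p%:E) v)%E.
    by rewrite integral_cst//= lebesgue_measure_itv/= lte_fin; case: ltP => b0';
      rewrite ?oppr0 ?adde0// mule0 (_ : b = 0) ?mulr0//; apply/eqP; rewrite eq_le b0' b0.
  apply: ge0_le_integral => //.
  - by move=> v _; rewrite lee_fin.
  - exact: measurable_funTS (mphi1 u).
  - by move=> v _; rewrite lee_fin.
apply: (@le_trans _ _ (\int[leb]_(u in `[0%R, a]) (cst (p * b)%:E) u)%E).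
  apply: ge0_le_integral => //.
  - by move=> u _; exact: inner_ge0.
  - exact: measurable_funTS (m_inner _).
  - by move=> u _; exact: le1.
rewrite integral_cst//= lebesgue_measure_itv/= lte_fin; case: ltP => a0'.
  by rewrite oppr0 adde0 -EFinM mulrAC.
by rewrite mule0 lee_fin !mulr_ge0//; exact: le_trans (phi_ge0 0) (phi_le _).
Qed.

(** Moving a column off the axis only increases the norm, so no column carries more than the axial
    mass [M0]. *)
Let inner_le u : (inner Ry u <= M0%:E)%E.
Proof.
rewrite -moment0; apply: ge0_le_integral => //.
- by move=> v _; rewrite lee_fin.
- exact: measurable_funTS (mphi1 u).
- exact: measurable_funTS (mphi2 _).
- move=> v _; rewrite lee_fin phi_rad// /enorm/= ler_wsqrtr// expr0n addr0.
  by rewrite lerDr sqr_ge0.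
Qed.

Lemma moment0_ge0 : 0 <= M0.
Proof. by rewrite -lee_fin -moment0 integral_ge0// => t _; rewrite lee_fin. Qed.

Lemma hmass_le a : 0 <= a -> hmass a <= M0 * a.
Proof.
move=> a0; rewrite -lee_fin hmassE massEE.
apply: (@le_trans _ _ (\int[leb]_(u in `[0%R, a]) (cst M0%:E) u)%E).
  apply: ge0_le_integral => //.
  - by move=> u _; exact: inner_ge0.
  - exact: measurable_funTS (m_inner _).
  - by move=> u _; exact: inner_le.
rewrite integral_cst//= lebesgue_measure_itv/= lte_fin; case: ltP => a0'.
  by rewrite oppr0 adde0.
by rewrite mule0 lee_fin mulr_ge0// moment0_ge0.
Qed.

(** The norm of (u, v) is at most u + v, so the column at u dominates the axial integral started at
    u; what is lost is the axial mass of [0, u[, at most p u. *)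
Let inner_ge d u : 0 <= u <= d -> (M0%:E <= inner Ry u + (p * d)%:E)%E.
Proof.
move=> /andP[u0 ud].
have pge0 : 0 <= p by exact: le_trans (phi_ge0 0) (phi_le _).
have -> : M0%:E = (\int[leb]_(t in `[0%R, u[) (phi (t, 0%R))%:E +
                  \int[leb]_(t in `[u, +oo[) (phi (t, 0%R))%:E)%E.
  have dis : [disjoint (`[0, u[%classic : set R) & (`[u, +oo[%classic : set R)].
    by apply/disj_setPS => x []/=; rewrite !in_itv/= andbT => /andP[_ xa] ax; lra.
  rewrite -(@ge0_integral_setU _ _ _ leb _ _ _ _ _ _ _ dis)//.
  - rewrite -moment0; congr (integral _ _ _); apply/seteqP; split => x; rewrite /= !in_itv/= !andbT.
      by move=> x0; have [?|?] := leP u x; [right|left; apply/andP].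
    by move=> [/andP[]//|]; exact: le_trans.
  - exact: measurable_funTS (mphi2 0).
  - by move=> t _; rewrite lee_fin.
rewrite addeC leeD//.
  rewrite (@ge0_integral_affine R 1 u)//.
  - rewrite mul1e (_ : _ @^-1` _ = Ry); last first.
      by apply/seteqP; split => x; rewrite /= !in_itv/= !andbT mul1r => ?; lra.
    apply: ge0_le_integral => //.
    + by move=> v _; rewrite lee_fin.
    + by apply: measurable_funTS; apply: (measurableT_comp (mphi2 0)); exact: measurable_affine.
    + exact: measurable_funTS (mphi1 u).
    + move=> v; rewrite /= in_itv/= andbT => v0; rewrite lee_fin phi_rad// /enorm/= mul1r.
      rewrite ler_wsqrtr// expr0n addr0 sqrrD; nra.
  - exact: measurable_funTS (mphi2 0).
  - by move=> t _; rewrite lee_fin.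
apply: (@le_trans _ _ (\int[leb]_(u in `[0%R, u[) (cst p%:E) u)%E).
  apply: ge0_le_integral => //.
  - by move=> v _; rewrite lee_fin.
  - exact: measurable_funTS (mphi2 0).
  - by move=> v _; rewrite lee_fin.
rewrite integral_cst//= lebesgue_measure_itv/= lte_fin; case: ltP => a0'.
  by rewrite oppr0 adde0 lee_fin ler_wpM2l.
by rewrite mule0 lee_fin mulr_ge0// (le_trans u0).
Qed.

(** Integrating [inner_ge] with the uniform loss p d lowers the slope by p d. Together with
    [hmass_le] this is the linearity of the strip mass near 0. *)
Lemma hmass_ge d a : 0 <= a <= d -> (M0 - p * d) * a <= hmass a.
Proof.
move=> /andP[a0 ad].
have pge0 : 0 <= p by exact: le_trans (phi_ge0 0) (phi_le _).
have d0 : 0 <= d by exact: le_trans ad.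
rewrite mulrBl lerBlDr -lee_fin EFinD hmassE massEE.
have cstE (c : R) : (\int[leb]_(u in `[0%R, a]) (cst c%:E) u)%E = (c * a)%:E.
  rewrite integral_cst//= lebesgue_measure_itv/= lte_fin; case: ltP => a0'.
    by rewrite oppr0 adde0.
  by rewrite mule0 (_ : a = 0) ?mulr0//; apply/eqP; rewrite eq_le a0 a0'.
rewrite -!cstE -ge0_integralD//.
- apply: ge0_le_integral => //.
  + by move=> u _; rewrite lee_fin moment0_ge0.
  + apply: emeasurable_funD => //; exact: measurable_funTS (m_inner _).
  + move=> u /=; rewrite in_itv/= => /andP[u0 ua]; apply: inner_ge.
    by rewrite u0 (le_trans ua).
- by move=> u _; exact: inner_ge0.
- exact: measurable_funTS (m_inner _).
- by move=> u _; rewrite lee_fin mulr_ge0.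
Qed.

(** Markov's inequality: outside the strip the norm is at least a, and the integral of the norm
    against [phi] over the quadrant is pi / 2 times the second axial moment. *)
Lemma hmass_tail a : 0 <= a -> a * (Hmass - hmass a) <= pi / 2 * M2.
Proof.
move=> a0.
have -> : Hmass - hmass a = mass `]a, +oo[%classic Ry.
  apply: EFin_inj; rewrite massK//; last exact: oitvRy.
  rewrite EFinB -massE_quadrant (massE_split a0)// -(hmassE a) addeAC subee ?add0e//.
rewrite -lee_fin EFinM massK//; last exact: oitvRy.
rewrite massEE.
rewrite EFinM -moment2.
have := @integral_quadrant_weight (fun t => `|t|) (@normr_measurable R setT) (@normr_ge0 _ _).
rewrite (_ : (\int[leb]_(t in Ry) (t * (`|t| * phi (t, 0%R)))%:E)%E =
  (\int[leb]_(t in Ry) (t ^+ 2 * phi (t, 0%R))%:E)%E); last first.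
  apply: eq_integral => t /set_mem; rewrite /= in_itv/= andbT => t0.
  by rewrite ger0_norm// expr2 mulrA.
move=> <-.
have mw u : measurable_fun setT (fun v : R => (`|Num.sqrt (u ^+ 2 + v ^+ 2)| * phi (u, v))%:E).
  apply/measurable_EFinP; apply: measurable_funM; last exact: measurableT_comp.
  apply: measurableT_comp => //; apply: measurableT_comp; first exact: measurable_sqrt.
  by apply: measurable_funD => //; exact: measurable_funX.
have mW : measurable_fun setT (fun z : R * R => (`|Num.sqrt (z.1 ^+ 2 + z.2 ^+ 2)| * phi z)%:E).
  apply/measurable_EFinP; apply: measurable_funM => //.
  apply: measurableT_comp => //; apply: measurableT_comp; first exact: measurable_sqrt.
  by apply: measurable_funD => //; exact: measurable_funX.
have W0 z : (0 <= (fun z : R * R => (`|Num.sqrt (z.1 ^+ 2 + z.2 ^+ 2)| * phi z)%:E) z)%E.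
  by rewrite lee_fin mulr_ge0.
have mWi := @measurable_integral_section _ _ _ _ _ leb _ Ry _ mW W0.
apply: (@le_trans _ _ (\int[leb]_(u in `]a, +oo[) \int[leb]_(v in Ry)
     (`|Num.sqrt (u ^+ 2 + v ^+ 2)| * phi (u, v))%:E)%E); last first.
  apply: ge0_subset_integral => //.
  - exact: measurable_funTS (mWi _).
  - by move=> u _; apply: integral_ge0 => v _; exact: (W0 (u, v)).
  - exact: oitvRy.
rewrite -ge0_integralZl_EFin//.
- apply: ge0_le_integral => //.
  + by move=> u _; rewrite mule_ge0// inner_ge0.
  + apply: emeasurable_funM => //; exact: measurable_funTS (m_inner _).
  + exact: measurable_funTS (mWi _).
  + move=> u; rewrite /= in_itv/= andbT => au; rewrite -ge0_integralZl_EFin//.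
    * apply: ge0_le_integral => //.
      - by move=> v _; rewrite lee_fin mulr_ge0.
      - apply: emeasurable_funM => //; exact: measurable_funTS (mphi1 _).
      - exact: measurable_funTS (mw _).
      - move=> v _; rewrite -EFinM lee_fin ler_wpM2r// (le_trans _ (ler_norm _))//.
        rewrite -(ger0_norm a0) -sqrtr_sqr ler_wsqrtr//; nra.
    * by move=> v _; rewrite lee_fin.
    * exact: measurable_funTS (mphi1 _).
- by move=> u _; exact: inner_ge0.
- exact: measurable_funTS (m_inner _).
Qed.

Let phi1_ge0 u v : (0 <= (phi (u, v))%:E)%E.
Proof. by rewrite lee_fin. Qed.

Let phi1_even u v : (phi (u, - v))%:E = (phi (u, v))%:E.
Proof. by rewrite phi_oppr. Qed.

Lemma mass_plane : (\int[@lebesgue2 R]_z (phi z)%:E)%E = (4 * Hmass)%:E.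
Proof.
rewrite -setXTT (@integral_setX _ (EFin \o phi))//.
transitivity (\int[leb]_u (2%:E * inner Ry u))%E.
  apply: eq_integral => u _.
  exact: (integral_even (mphi1 u) (phi1_ge0 u) (phi1_even u)).
rewrite integral_even//; last 3 first.
- by apply: emeasurable_funM => //; exact: m_inner.
- by move=> u; rewrite mule_ge0// ?inner_ge0.
- by move=> u; congr (_ * _)%E; apply: eq_integral => v _; rewrite phi_oppl.
rewrite ge0_integralZl_EFin//; last exact: measurable_funTS (m_inner _).
rewrite -massEE massE_quadrant -!EFinM mulrA; congr (_ * _)%:E.
by rewrite -natrM.
Qed.

Lemma mass_unit_square x1 x2 : 0 <= x1 <= 1 -> 0 <= x2 <= 1 ->
  (\int[@lebesgue2 R]_(y in unit_square) (phi (y - (x1, x2)))%:E)%E =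
  (kmass x1 x2 + kmass x1 (1 - x2) + (kmass (1 - x1) x2 + kmass (1 - x1) (1 - x2)))%:E.
Proof.
move=> x1P x2P.
have mS : measurable_fun setT (fun y : R * R => (phi (y - (x1, x2)))%:E).
  apply/measurable_EFinP; apply: measurableT_comp => //.
  by apply: measurable_fun_pair => /=; apply: measurable_funB.
rewrite /unit_square (@integral_setX _ (fun y : R * R => (phi (y - (x1, x2)))%:E))//; last first.
  by move=> z; rewrite lee_fin.
pose g t := (inner `[0%R, x2] t + inner `[0%R, (1 - x2)%R] t)%E.
transitivity (\int[leb]_(u in `[0%R, 1%R]) g (u - x1)%R)%E.
  apply: eq_integral => u _.
  exact: (@integral_even_shift _ (fun v => (phi (u - x1, v))%:E) x2 (mphi1 _)
    (phi1_ge0 _) (phi1_even _) x2P).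
have mg : measurable_fun setT g by apply: emeasurable_funD; exact: m_inner.
have g0 u : (0 <= g u)%E by rewrite adde_ge0// ?inner_ge0.
have gN u : g (- u) = g u.
  by congr (_ + _)%E; apply: eq_integral => v _; rewrite phi_oppl.
rewrite (integral_even_shift mg g0 gN x1P).
have gD (A : set R) : measurable A -> (\int[leb]_(u in A) g u =
    massE A `[0%R, x2] + massE A `[0%R, (1 - x2)%R])%E.
  by move=> mA; apply: ge0_integralD => //;
    solve [exact: measurable_funTS (m_inner _) | move=> u _; exact: inner_ge0].
rewrite gD// gD// 3!EFinD; congr (_ + _ + (_ + _))%E; apply/esym.
- exact: (kmassE x1 x2).
- exact: (kmassE x1 (1 - x2)).
- exact: (kmassE (1 - x1) x2).
- exact: (kmassE (1 - x1) (1 - x2)).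
Qed.

End radial.

(** * Deterministic bounds on the covering integral *)

(* [h a] and [k a b] stand for the masses of [0, a] x [0, +oo[ and
   [0, a] x [0, b], and [H] for the mass of the quadrant. *)
Record profile (R : realType) (p g W H : R) (h : R -> R) (k : R -> R -> R) :
    Prop := Profile {
  profile_h_ge0 : forall a, 0 <= h a ;
  profile_h_le : forall a, h a <= H ;
  profile_h_mono : forall a b, a <= b -> h a <= h b ;
  profile_h_lin : forall a, 0 <= a -> h a <= g * a ;
  profile_h_ge : forall d a, 0 <= a <= d -> (g - p * d) * a <= h a ;
  profile_h_tail : forall a, 0 <= a -> a * (H - h a) <= W ;
  profile_k_sym : forall a b, k a b = k b a ;
  profile_k_ge0 : forall a b, 0 <= k a b ;
  profile_k_le : forall a b, k a b <= h a ;
  profile_k_ge : forall a b, 0 <= a -> 0 <= b -> h a + h b <= H + k a b ;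
  profile_k_area : forall a b, 0 <= a -> 0 <= b -> k a b <= p * a * b }.

Definition square_mass (R : realType) (k : R -> R -> R) (x y : R) : R :=
  k x y + k x (1 - y) + (k (1 - x) y + k (1 - x) (1 - y)).

Section integrals.
Context {R : realType}.
Notation leb := (@lebesgue_measure R).

Lemma integral_cst_itv (b1 b2 : bool) (a b c : R) : a <= b ->
  (\int[leb]_(x in [set` Interval (BSide b1 a) (BSide b2 b)]) c%:E)%E = (c * (b - a))%:E.
Proof.
move=> ab; rewrite integral_cst//= lebesgue_measure_itv/= lte_fin.
case: ltP => ab'; first by rewrite -EFinB -EFinM.
by rewrite mule0 (_ : b = a) ?subrr ?mulr0//; apply/eqP; rewrite eq_le ab ab'.
Qed.

Lemma integral_expR_linear (c t : R) : 0 < c -> 0 <= t ->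
  (\int[leb]_(x in `[0%R, t]) (expR (- (c * x)))%:E)%E =
  ((1 - expR (- (c * t))) / c)%:E.
Proof.
move=> c0; rewrite le_eqVlt => /predU1P[<-|t0].
  by rewrite set_itv1 integral_set1 mulr0 oppr0 expR0 subrr mul0r.
have cf : continuous (fun x : R => expR (- (c * x))).
  move=> x; apply: continuous_comp; last exact: continuous_expR.
  by apply: cvgN; apply: cvgM => //; exact: cvg_cst.
have dF (x : R) : is_derive x 1 (fun x : R => - (expR (- (c * x)) / c)) (expR (- (c * x))).
  have -> : (fun x : R => - (expR (- (c * x)) / c)) = (fun x : R => - c^-1 * (expR (- c * x))).
    by apply/funext => y; rewrite mulNr mulrC mulNr.
  apply: is_derive_eq.
  rewrite /GRing.scale/= mulr1 (mulNr c x); field; exact: lt0r_neq0.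
rewrite (@continuous_FTC2 _ _ (fun x => - (expR (- (c * x)) / c)))//.
- rewrite -EFinB mulr0 oppr0 expR0; congr _%:E; ring.
- exact: continuous_subspaceT.
- have cF : continuous (fun x : R => - (expR (- (c * x)) / c)).
    by move=> x; apply: cvgN; apply: cvgM; [exact: cf|exact: cvg_cst].
  split => //.
  + by apply: cvg_at_right_filter; exact: cF.
  + by apply: cvg_at_left_filter; exact: cF.
- by move=> x _; rewrite derive1E; exact: derive_val.
Qed.

Lemma integral_tensor (a b : R -> R) (A B : set R) :
  measurable A -> measurable B -> measurable_fun setT a -> measurable_fun setT b ->
  (forall x, 0 <= a x) -> (forall x, 0 <= b x) ->
  (\int[@lebesgue2 R]_(z in A `*` B) (a z.1 * b z.2)%:E =
   (\int[leb]_(x in A) (a x)%:E) * (\int[leb]_(y in B) (b y)%:E))%E.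
Proof.
move=> mA mB ma mb a0 b0.
rewrite (@integral_setX _ (fun z => (a z.1 * b z.2)%:E))//; last 2 first.
- by apply/measurable_EFinP; apply: measurable_funM; apply: measurableT_comp.
- by move=> z; rewrite lee_fin mulr_ge0.
transitivity (\int[leb]_(x in A) ((a x)%:E * \int[leb]_(y in B) (b y)%:E))%E.
  apply: eq_integral => x _; rewrite -ge0_integralZl_EFin//.
  - by move=> y _; rewrite lee_fin.
  - by apply: measurable_funTS; exact/measurable_EFinP.
rewrite ge0_integralZr//.
- by apply: measurable_funTS; exact/measurable_EFinP.
- by move=> y _; rewrite lee_fin.
- by apply: integral_ge0 => y _; rewrite lee_fin.
Qed.

End integrals.

(** * Bounds on the mass in the square and on exponential integrals of a profile *)

Section profile_bounds.
Context {R : realType} (p g W H : R) (h : R -> R) (k : R -> R -> R).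
Context (P : profile p g W H h k).
Notation leb := (@lebesgue_measure R).

Let k_le2 a b : k a b <= h b.
Proof. by rewrite (profile_k_sym P) (profile_k_le P). Qed.

Lemma square_mass_le1 x y : square_mass k x y <= 4 * H.
Proof.
rewrite /square_mass.
have le a b : k a b <= H := le_trans (profile_k_le P a b) (profile_h_le P a).
have := (le x y, le x (1 - y), le (1 - x) y, le (1 - x) (1 - y)).
move=> [[[? ?] ?] ?]; lra.
Qed.

Lemma square_mass_le2l x y : square_mass k x y <= 2 * h x + 2 * H.
Proof.
rewrite /square_mass.
have le a b : k a b <= H := le_trans (profile_k_le P a b) (profile_h_le P a).
have := (profile_k_le P x y, profile_k_le P x (1 - y), le (1 - x) y, le (1 - x) (1 - y)).
move=> [[[? ?] ?] ?]; lra.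
Qed.

Lemma square_mass_le2r x y : square_mass k x y <= 2 * h y + 2 * H.
Proof.
rewrite /square_mass.
have le a b : k a b <= H := le_trans (profile_k_le P a b) (profile_h_le P a).
have := (k_le2 x y, k_le2 (1 - x) y, le x (1 - y), le (1 - x) (1 - y)).
move=> [[[? ?] ?] ?]; lra.
Qed.

Lemma square_mass_le3 x y : 0 <= x -> 0 <= y ->
  square_mass k x y <= H + h x + h y + p * x * y.
Proof.
move=> x0 y0; rewrite /square_mass.
have le a b : k a b <= H := le_trans (profile_k_le P a b) (profile_h_le P a).
have := (profile_k_area P x0 y0, profile_k_le P x (1 - y), k_le2 (1 - x) y, le (1 - x) (1 - y)).
move=> [[[? ?] ?] ?]; lra.
Qed.

(** Inclusion-exclusion is applied to the three rectangles with a side 1 - x or 1 - y; these sides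
    are at least 1/2, so each strip of such a width misses at most H - h (1/2). The term [k x y] is
    kept because its two lower bounds, 0 and h x + h y - H, give the two bounds that follow. *)
Lemma square_mass_ge x y : 0 <= x <= 2^-1 -> 0 <= y <= 2^-1 ->
  k x y + h x + h y + H <= square_mass k x y + 4 * (H - h 2^-1).
Proof.
move=> /andP[x0 x1] /andP[y0 y1]; rewrite /square_mass.
have x0' : 0 <= 1 - x by lra.
have y0' : 0 <= 1 - y by lra.
have xh : h 2^-1 <= h (1 - x) by apply: (profile_h_mono P); lra.
have yh : h 2^-1 <= h (1 - y) by apply: (profile_h_mono P); lra.
have := (profile_k_ge P x0 y0', profile_k_ge P x0' y0, profile_k_ge P x0' y0').
move=> [[? ?] ?]; lra.
Qed.

Lemma square_mass_ge1 x y : 0 <= x <= 2^-1 -> 0 <= y <= 2^-1 ->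
  H + h x + h y <= square_mass k x y + 4 * (H - h 2^-1).
Proof.
move=> xP yP; have := square_mass_ge xP yP; have := profile_k_ge0 P x y; lra.
Qed.

Lemma square_mass_ge2 x y : 0 <= x <= 2^-1 -> 0 <= y <= 2^-1 ->
  2 * h x + 2 * h y <= square_mass k x y + 4 * (H - h 2^-1).
Proof.
move=> xP yP; have := square_mass_ge xP yP.
have x0 : 0 <= x by lra. have y0 : 0 <= y by lra.
have := profile_k_ge P x0 y0; lra.
Qed.

Lemma measurable_profile_exp (m : R) :
  measurable_fun setT (fun x : R => expR (- (m * h x))).
Proof.
apply: measurableT_comp => //; apply: measurableT_comp => //.
apply: measurable_funM => //; apply: nondecreasing_measurable => // x y.
exact: (profile_h_mono P).
Qed.

(** Up to d the exponent is at least linear with slope m (g - p d); beyond d monotonicity keeps it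
    at least at its linear value at d. *)
Lemma integral_exp_profile_near (m d t : R) : 0 < m -> 0 < d -> 0 <= t ->
  0 < g - p * d ->
  (\int[leb]_(x in `[0%R, t]) (expR (- (m * h x)))%:E <=
   ((m * (g - p * d))^-1 + t * expR (- (m * (g - p * d) * d)))%:E)%E.
Proof.
move=> m0 d0 t0 c0; set c := g - p * d.
have mc0 : 0 < m * c by rewrite mulr_gt0.
have mE : measurable_fun setT (fun x : R => (expR (- (m * c * x)))%:E).
  by apply/measurable_EFinP; apply: measurableT_comp => //; apply: measurableT_comp.
apply: (@le_trans _ _ (\int[leb]_(x in `[0%R, t])
    ((expR (- (m * c * x)))%:E + (expR (- (m * c * d)))%:E))%E).
  apply: ge0_le_integral => //.
  - by apply/measurable_EFinP; apply: measurable_funTS; exact: measurable_profile_exp.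
  - by apply: emeasurable_funD => //; exact: measurable_funTS.
  - move=> x /=; rewrite in_itv/= => /andP[x0 xt]; rewrite -EFinD lee_fin.
    have [xd|/ltW dx] := leP x d.
      rewrite ler_wpDr ?expR_ge0// ler_expR lerN2 -mulrA ler_wpM2l ?(ltW m0)//.
      by apply: (profile_h_ge P); rewrite x0.
    rewrite ler_wpDl ?expR_ge0// ler_expR lerN2 -mulrA ler_wpM2l ?(ltW m0)//.
    apply: le_trans (profile_h_mono P dx); apply: (profile_h_ge P).
    by rewrite lexx (ltW d0).
rewrite ge0_integralD//; last exact: measurable_funTS.
rewrite integral_expR_linear// integral_cst_itv// subr0 -EFinD lee_fin.
rewrite lerD//; last by rewrite mulrC.
by rewrite ler_pdivrMr// mulVf ?gt_eqF// lerBlDr lerDl expR_ge0.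
Qed.

(** On each of ]s, t] and ]t, 1/2] the integrand is at most its value at the left end. The point t
    trades the crude value at s against a short interval. *)
Lemma integral_exp_profile_far (m s t : R) : 0 <= m -> 0 <= s <= t -> t <= 2^-1 ->
  (\int[leb]_(x in `]s, 2^-1%R]) (expR (- (m * h x)))%:E <=
   (t * expR (- (m * h s)) + 2^-1 * expR (- (m * h t)))%:E)%E.
Proof.
move=> m0 /andP[s0 st] t1.
have mE D : measurable_fun D (fun x : R => (expR (- (m * h x)))%:E).
  by apply/measurable_EFinP; apply: measurable_funTS; exact: measurable_profile_exp.
have -> : `]s, 2^-1]%classic = `]s, t] `|` `]t, 2^-1] :> set R.
  apply/seteqP; split => y /=; rewrite !in_itv/=.
    by move=> /andP[? ?]; have [?|?] := leP y t; [left|right]; apply/andP; split; lra.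
  by move=> [] /andP[? ?]; apply/andP; split; lra.
have dis : [disjoint (`]s, t]%classic : set R) & (`]t, 2^-1]%classic : set R)].
  by apply/disj_setPS => x []/=; rewrite !in_itv/= => /andP[_ xa] /andP[ax _]; lra.
have e0 D (x : R) : D x -> (0 <= (expR (- (m * h x)))%:E)%E.
  by rewrite lee_fin expR_ge0.
rewrite (@ge0_integral_setU _ _ _ leb _ _ _ _ _ (mE _) (e0 _) dis)//.
have bd u v : 0 <= u <= v ->
  (\int[leb]_(x in `]u, v]) (expR (- (m * h x)))%:E <= (expR (- (m * h u)) * (v - u))%:E)%E.
  move=> /andP[u0 uv]; rewrite -(integral_cst_itv false false _ uv).
  apply: ge0_le_integral => //.
  - exact: mE.
  - move=> x /=; rewrite in_itv/= => /andP[/ltW ux _].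
    by rewrite lee_fin ler_expR lerN2 ler_wpM2l// (profile_h_mono P).
rewrite EFinD leeD//.
- apply: le_trans (bd _ _ _) _; first by rewrite s0.
  by rewrite lee_fin mulrC ler_wpM2r ?expR_ge0//; lra.
- apply: le_trans (bd _ _ _) _; first by rewrite t1 (le_trans s0).
  by rewrite lee_fin mulrC ler_wpM2r ?expR_ge0//; lra.
Qed.

End profile_bounds.

(** * Comparison with product integrands on rectangles *)

Section rectangles.
Context {R : realType} (E : R * R -> R).
Context (mE : measurable_fun setT E) (E0 : forall z, 0 <= E z).
Notation leb := (@lebesgue_measure R).
Implicit Types (A B : set R) (a b : R -> R).

Let mES (D : set (R * R)) : measurable_fun D (EFin \o E).
Proof. by apply: measurable_funTS; exact/measurable_EFinP. Qed.

Let EE0 (D : set (R * R)) z : D z -> (0 <= (E z)%:E)%E.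
Proof. by rewrite lee_fin. Qed.

Lemma integral_rectangle_le A B a b c X Y :
  measurable A -> measurable B -> measurable_fun setT a -> measurable_fun setT b ->
  (forall x, 0 <= a x) -> (forall x, 0 <= b x) -> 0 <= c ->
  (forall x y, A x -> B y -> E (x, y) <= c * (a x * b y)) ->
  (\int[leb]_(x in A) (a x)%:E <= X%:E)%E ->
  (\int[leb]_(x in B) (b x)%:E <= Y%:E)%E ->
  (\int[@lebesgue2 R]_(z in A `*` B) (E z)%:E <= (c * (X * Y))%:E)%E.
Proof.
move=> mA mB ma mb a0 b0 c0 Eab aX bY.
have mab : measurable_fun setT (fun z : R * R => (a z.1 * b z.2)%:E).
  by apply/measurable_EFinP; apply: measurable_funM; apply: measurableT_comp.
have mAB : measurable (A `*` B) by exact: measurableX.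
apply: (@le_trans _ _ (\int[@lebesgue2 R]_(z in A `*` B) (c%:E * (a z.1 * b z.2)%:E))%E).
  apply: ge0_le_integral => //.
  - exact: EE0.
  - exact: mES.
  - by apply: emeasurable_funM => //; exact: measurable_funTS.
  - by move=> [x y] [/= Ax By]; rewrite -EFinM lee_fin Eab.
rewrite ge0_integralZl_EFin//; last 2 first.
- by move=> z _; rewrite lee_fin mulr_ge0.
- exact: measurable_funTS.
rewrite integral_tensor// !EFinM lee_wpmul2l ?lee_fin//.
by rewrite lee_pmul//; apply: integral_ge0 => x _; rewrite lee_fin.
Qed.

Lemma integral_rectangle_ge A B a b c X Y :
  measurable A -> measurable B -> measurable_fun setT a -> measurable_fun setT b ->
  (forall x, 0 <= a x) -> (forall x, 0 <= b x) -> 0 <= c -> 0 <= X -> 0 <= Y ->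
  (forall x y, A x -> B y -> c * (a x * b y) <= E (x, y)) ->
  (X%:E <= \int[leb]_(x in A) (a x)%:E)%E ->
  (Y%:E <= \int[leb]_(x in B) (b x)%:E)%E ->
  ((c * (X * Y))%:E <= \int[@lebesgue2 R]_(z in A `*` B) (E z)%:E)%E.
Proof.
move=> mA mB ma mb a0 b0 c0 X0 Y0 Eab aX bY.
have mab : measurable_fun setT (fun z : R * R => (a z.1 * b z.2)%:E).
  by apply/measurable_EFinP; apply: measurable_funM; apply: measurableT_comp.
have mAB : measurable (A `*` B) by exact: measurableX.
apply: (@le_trans _ _ (\int[@lebesgue2 R]_(z in A `*` B) (c%:E * (a z.1 * b z.2)%:E))%E); last first.
  apply: ge0_le_integral => //.
  - by move=> z _; rewrite -EFinM lee_fin !mulr_ge0.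
  - by apply: emeasurable_funM => //; exact: measurable_funTS.
  - exact: mES.
  - by move=> [x y] [/= Ax By]; rewrite -EFinM lee_fin Eab.
rewrite ge0_integralZl_EFin//; last 2 first.
- by move=> z _; rewrite lee_fin mulr_ge0.
- exact: measurable_funTS.
by rewrite integral_tensor// !EFinM lee_wpmul2l ?lee_fin// lee_pmul.
Qed.

Lemma integral_rectangleUl A A' B : measurable A -> measurable A' -> measurable B ->
  [disjoint A & A'] ->
  (\int[@lebesgue2 R]_(z in (A `|` A') `*` B) (E z)%:E =
   \int[@lebesgue2 R]_(z in A `*` B) (E z)%:E +
   \int[@lebesgue2 R]_(z in A' `*` B) (E z)%:E)%E.
Proof.
move=> mA mA' mB /disj_setPS dis.
rewrite (_ : (A `|` A') `*` B = A `*` B `|` A' `*` B); last first.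
  by apply/seteqP; split => -[x y] /=; tauto.
have disX : [disjoint (A `*` B : set (R * R)) & (A' `*` B : set (R * R))].
  by apply/disj_setPS => -[x y] [[/= Ax _] [A'x _]]; apply: (dis x).
by apply: ge0_integral_setU => //;
  do ?[exact: measurableX|exact: mES|by move=> z _; rewrite lee_fin].
Qed.

Lemma integral_rectangleUr A B B' : measurable A -> measurable B -> measurable B' ->
  [disjoint B & B'] ->
  (\int[@lebesgue2 R]_(z in A `*` (B `|` B')) (E z)%:E =
   \int[@lebesgue2 R]_(z in A `*` B) (E z)%:E +
   \int[@lebesgue2 R]_(z in A `*` B') (E z)%:E)%E.
Proof.
move=> mA mB mB' /disj_setPS dis.
rewrite (_ : A `*` (B `|` B') = A `*` B `|` A `*` B'); last first.
  by apply/seteqP; split => -[x y] /=; tauto.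
have disX : [disjoint (A `*` B : set (R * R)) & (A `*` B' : set (R * R))].
  by apply/disj_setPS => -[x y] [[/= _ Bx] [_ B'x]]; apply: (dis y).
by apply: ge0_integral_setU => //;
  do ?[exact: measurableX|exact: mES|by move=> z _; rewrite lee_fin].
Qed.

Lemma integral_rectangle_sub (D : set (R * R)) A B : measurable A -> measurable B ->
  measurable D -> D `<=` A `*` B ->
  (\int[@lebesgue2 R]_(z in D) (E z)%:E <= \int[@lebesgue2 R]_(z in A `*` B) (E z)%:E)%E.
Proof.
move=> mA mB mD DAB.
by apply: ge0_subset_integral => //;
  do ?[exact: measurableX|exact: mES|by move=> z _; rewrite lee_fin].
Qed.

Let mEl u : measurable_fun setT (fun v => (E (u, v))%:E).
Proof. by apply/measurable_EFinP; apply: measurableT_comp. Qed.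

Lemma integral_square_fold :
  (forall x y, 0 <= x <= 1 -> 0 <= y <= 1 -> E (1 - x, y) = E (x, y)) ->
  (forall x y, 0 <= x <= 1 -> 0 <= y <= 1 -> E (x, 1 - y) = E (x, y)) ->
  (\int[@lebesgue2 R]_(z in unit_square) (E z)%:E =
   4%:E * \int[@lebesgue2 R]_(z in `[0%R, 2^-1%R] `*` `[0%R, 2^-1%R]) (E z)%:E)%E.
Proof.
move=> El Er.
rewrite /unit_square !(@integral_setX _ (EFin \o E))//.
pose G (u : R) := (\int[leb]_(v in `[0%R, 2^-1%R]) (E (u, v))%:E)%E.
have mG : measurable_fun setT G.
  apply: (@measurable_integral_section _ _ _ _ _ leb (EFin \o E)) => //.
  exact: mES.
have G0 u : (0 <= G u)%E by apply: integral_ge0 => v _; rewrite lee_fin.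
transitivity (\int[leb]_(u in `[0%R, 1%R]) (2%:E * G u))%E.
  apply: eq_integral => u /set_mem; rewrite /= in_itv/= => uP.
  apply: (@integral_symm_half _ (fun v => (E (u, v))%:E) (mEl u)) => [v|v vP].
    by rewrite lee_fin.
  by rewrite Er.
rewrite ge0_integralZl_EFin//; last exact: measurable_funTS.
rewrite integral_symm_half//; last first.
  move=> u uP; apply: eq_integral => v /set_mem; rewrite /= in_itv/= => /andP[v0 v1].
  by rewrite El// v0/=; lra.
by rewrite muleA -EFinM; congr (_%:E * _)%E; ring.
Qed.

End rectangles.

(** * Lower and upper bounds on the integral over the unit square *)

Section target.
Context {R : realType} (p g W H : R) (h : R -> R) (k : R -> R -> R).
Context (P : profile p g W H h k).
Context (E : R * R -> R) (n : R) (n0 : 0 < n) (g0 : 0 < g).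
Context (mE : measurable_fun setT E) (E0 : forall z, 0 <= E z).
Context (EE : forall x y, 0 <= x <= 1 -> 0 <= y <= 1 ->
  E (x, y) = expR (- (n * square_mass k x y))).
Notation leb := (@lebesgue_measure R).

Local Notation half := (`[0%R, 2^-1%R]%classic : set R).
Let q := (\int[@lebesgue2 R]_(z in half `*` half) (E z)%:E)%E.
Let T := \int[@lebesgue2 R]_(z in unit_square) E z.

Let EEh x y : half x -> half y ->
  [/\ 0 <= x <= 2^-1, 0 <= y <= 2^-1 & E (x, y) = expR (- (n * square_mass k x y))].
Proof.
by rewrite /= !in_itv/= => /andP[? ?] /andP[? ?]; split; [lra|lra|apply: EE; lra].
Qed.

Let q_ge0 : (0 <= q)%E.
Proof. by apply: integral_ge0 => z _; rewrite lee_fin. Qed.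

Let q_fin : q \is a fin_num.
Proof.
rewrite ge0_fin_numE// (@le_lt_trans _ _ (1 * (2^-1 * 2^-1))%:E) ?ltry//.
have i1 : (\int[leb]_(x in half) (cst 1 x)%:E <= (2^-1)%:E)%E.
  by rewrite integral_cst_itv ?subr0 ?mul1r// invr_ge0.
apply: (integral_rectangle_le mE E0 _ _ _ _ _ _ _ _ i1 i1) => // x y hx hy.
have [_ _ ->] := EEh hx hy; rewrite /= !mulr1 -expR0 ler_expR oppr_le0 mulr_ge0 ?(ltW n0)//.
by rewrite /square_mass !addr_ge0// (profile_k_ge0 P).
Qed.

(** The mass is invariant under x |-> 1 - x and y |-> 1 - y, so one quarter of the square suffices.
    Finiteness of [q] passes from the extended-real bounds to the real-valued integral. *)
Let TE : T = 4 * fine q.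
Proof.
rewrite /T /Rintegral integral_square_fold//.
- by rewrite -/q -(fineK q_fin) -EFinM.
- move=> x y xP yP; rewrite !EE//; last lra.
  by congr (expR (- (_ * _))); rewrite /square_mass (_ : 1 - (1 - x) = x); [ring|ring].
- move=> x y xP yP; rewrite !EE//; last lra.
  by congr (expR (- (_ * _))); rewrite /square_mass (_ : 1 - (1 - y) = y); [ring|ring].
Qed.

Let T_ge l : (l%:E <= q)%E -> 4 * l <= T.
Proof. by move=> lq; rewrite TE ler_pM2l// -lee_fin fineK. Qed.

Let T_le l : (q <= l%:E)%E -> T <= 4 * l.
Proof. by move=> lq; rewrite TE ler_pM2l// -lee_fin fineK. Qed.

Lemma target_ge1 : expR (- (4 * (n * H))) <= T.
Proof.
have i1 : ((2^-1)%:E <= \int[leb]_(x in half) (cst 1 x)%:E)%E.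
  by rewrite integral_cst_itv ?subr0 ?mul1r// invr_ge0.
rewrite (_ : expR _ = 4 * (expR (- (4 * (n * H))) * (2^-1 * 2^-1))); last by field.
apply: T_ge; apply: (integral_rectangle_ge mE _ _ _ _ _ _ _ _ _ _ i1 i1) => //; do ?[by rewrite invr_ge0].
- move=> x y hx hy; have [_ _ ->] := EEh hx hy; rewrite /= !mulr1 ler_expR lerN2.
  by rewrite mulrCA ler_pM2l// (square_mass_le1 P).
Qed.

(** Only [0, t] x ]t, 1/2] and its transpose are kept; there the mass is at most 2 H plus twice the
    linear bound in the short coordinate. The factor 8 counts four quarters and two strips in
    each. *)
Lemma target_ge2 t : 0 <= t <= 2^-1 ->
  8 * expR (- (2 * (n * H))) *
    ((1 - expR (- (2 * (n * g) * t))) / (2 * (n * g)) * (2^-1 - t)) <= T.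
Proof.
move=> /andP[t0 t1]; set X := _ / _.
have c0 : 0 < 2 * (n * g) by rewrite !mulr_gt0.
have i1 : (X%:E <= \int[leb]_(x in `[0%R, t]) (expR (- (2 * (n * g) * x)))%:E)%E.
  by rewrite integral_expR_linear.
have i2 : ((2^-1 - t)%:E <= \int[leb]_(x in `]t, 2^-1%R]) (cst 1 x)%:E)%E.
  by rewrite integral_cst_itv// mul1r.
have X0 : 0 <= X.
  apply: divr_ge0; last exact: ltW.
  by rewrite subr_ge0 -[leRHS]expR0 ler_expR oppr_le0 mulr_ge0// ltW.
rewrite (_ : _ * _ = 4 * (expR (- (2 * (n * H))) * (X * (2^-1 - t)) +
   expR (- (2 * (n * H))) * ((2^-1 - t) * X))); last by ring.
have me : measurable_fun setT (fun x : R => expR (- (2 * (n * g) * x))).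
  by apply: measurableT_comp => //; apply: measurableT_comp.
have sub1 x : `[0, t]%classic x -> half x.
  by rewrite /= !in_itv/= => /andP[-> /le_trans ->].
have sub2 x : `]t, 2^-1]%classic x -> half x.
  by rewrite /= !in_itv/= => /andP[/ltW /(le_trans t0) -> ->].
have ge0t : 0 <= 2^-1 - t by lra.
apply: T_ge; rewrite EFinD.
apply: (@le_trans _ _
  (\int[@lebesgue2 R]_(z in `[0%R, t] `*` `]t, 2^-1%R]) (E z)%:E +
   \int[@lebesgue2 R]_(z in `]t, 2^-1%R] `*` `[0%R, t]) (E z)%:E)%E).
  apply: leeD.
  - apply: (integral_rectangle_ge mE _ _ me _ _ _ _ _ _ _ i1 i2) => //.
    + move=> x y Ax By; have [xP yP ->] := EEh (sub1 _ Ax) (sub2 _ By).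
      rewrite /= mulr1 -expRD ler_expR -opprD lerN2.
      have x0 : 0 <= x by lra.
      have := ler_wpM2l (ltW n0) (square_mass_le2l P x y).
      have := ler_wpM2l (ltW n0) (profile_h_lin P x0); lra.
  - apply: (integral_rectangle_ge mE _ _ _ me _ _ _ _ _ _ i2 i1) => //.
    + move=> x y Ax By; have [xP yP ->] := EEh (sub2 _ Ax) (sub1 _ By).
      rewrite /= mul1r -expRD ler_expR -opprD lerN2.
      have y0 : 0 <= y by lra.
      have := ler_wpM2l (ltW n0) (square_mass_le2r P x y).
      have := ler_wpM2l (ltW n0) (profile_h_lin P y0); lra.
have mES (D : set (R * R)) : measurable_fun D (EFin \o E).
  by apply: measurable_funTS; exact/measurable_EFinP.
have dis : [disjoint (`[0, t] `*` `]t, 2^-1] : set (R * R)) &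
    (`]t, 2^-1] `*` `[0, t] : set (R * R))].
  apply/disj_setPS => -[x y] [[/= xA _] [xB _]].
  by move: xA xB; rewrite !in_itv/= => /andP[_ ?] /andP[? _]; lra.
have m1 := measurableX (measurable_itv `[0, t]) (measurable_itv `]t, 2^-1]).
have m2 := measurableX (measurable_itv `]t, 2^-1]) (measurable_itv `[0, t]).
have U : (\int[@lebesgue2 R]_(z in `[0%R, t] `*` `]t, 2^-1%R] `|` `]t, 2^-1%R] `*` `[0%R, t])
      (E z)%:E =
    \int[@lebesgue2 R]_(z in `[0%R, t] `*` `]t, 2^-1%R]) (E z)%:E +
    \int[@lebesgue2 R]_(z in `]t, 2^-1%R] `*` `[0%R, t]) (E z)%:E)%E.
  by apply: ge0_integral_setU => //; do ?[exact: mES|by move=> z _; rewrite lee_fin].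
rewrite -U.
apply: integral_rectangle_sub => //; first exact: measurableU.
move=> -[x y] [] [/= xA yA]; split => //=; by [exact: sub1|exact: sub2].
Qed.

(** Only the corner square of side d is kept, where the overlap p x y is at most p d^2. The choice
    of d must make n p d^2 small while n g d stays large. *)
Lemma target_ge3 d : 0 <= d <= 2^-1 ->
  4 * (expR (- (n * H + n * p * d ^+ 2)) *
    (((1 - expR (- (n * g * d))) / (n * g)) * ((1 - expR (- (n * g * d))) / (n * g)))) <= T.
Proof.
move=> /andP[d0 d1]; set X := _ / _.
have c0 : 0 < n * g by rewrite !mulr_gt0.
have i1 : (X%:E <= \int[leb]_(x in `[0%R, d]) (expR (- (n * g * x)))%:E)%E.
  by rewrite integral_expR_linear.
have X0 : 0 <= X.
  apply: divr_ge0; last exact: ltW.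
  by rewrite subr_ge0 -[leRHS]expR0 ler_expR oppr_le0 mulr_ge0// ltW.
have me : measurable_fun setT (fun x : R => expR (- (n * g * x))).
  by apply: measurableT_comp => //; apply: measurableT_comp.
have sub1 x : `[0, d]%classic x -> half x.
  by rewrite /= !in_itv/= => /andP[-> /le_trans ->].
have e0 x : 0 <= expR (- (n * g * x)) by exact: expR_ge0.
apply: T_ge; apply: (@le_trans _ _
  (\int[@lebesgue2 R]_(z in `[0%R, d] `*` `[0%R, d]) (E z)%:E)%E).
  apply: (integral_rectangle_ge mE _ _ me me _ _ _ _ _ _ i1 i1) => //.
  move=> x y Ax Ay; have [xP yP ->] := EEh (sub1 _ Ax) (sub1 _ Ay).
  rewrite -!expRD ler_expR -!opprD lerN2.
  have x0 : 0 <= x by lra.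
  have y0 : 0 <= y by lra.
  have := ler_wpM2l (ltW n0) (square_mass_le3 P x0 y0).
  have := ler_wpM2l (ltW n0) (profile_h_lin P x0).
  have := ler_wpM2l (ltW n0) (profile_h_lin P y0).
  have p0 : 0 <= p.
    have := profile_k_area P ler01 ler01; rewrite !mulr1; apply: le_trans.
    exact: profile_k_ge0 P _ _.
  have xy : p * x * y <= p * d ^+ 2.
    rewrite -mulrA ler_wpM2l// expr2 ler_pM//.
    - by move: Ax; rewrite /= in_itv/= => /andP[].
    - by move: Ay; rewrite /= in_itv/= => /andP[].
  have := ler_wpM2l (ltW n0) xy; lra.
apply: integral_rectangle_sub => //; first exact: measurableX.
by move=> -[x y] [/= xA yA]; split => //=; exact: sub1.
Qed.

(** The quarter square is cut at t in both coordinates. The corner piece uses H + h x + h y as lower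
    bound for the mass, the other three use 2 h x + 2 h y; in both cases the exponential factorises,
    so the integrals become products. The factor in front absorbs 4 (H - h (1/2)). *)
Lemma target_le t A1 B1 Q1 : 0 <= t <= 2^-1 ->
  (\int[leb]_(x in `[0%R, t]) (expR (- (n * h x)))%:E <= A1%:E)%E ->
  (\int[leb]_(x in `[0%R, t]) (expR (- (2 * n * h x)))%:E <= B1%:E)%E ->
  (\int[leb]_(x in `]t, 2^-1%R]) (expR (- (2 * n * h x)))%:E <= Q1%:E)%E ->
  T <= 4 * (expR (4 * (n * (H - h 2^-1))) *
    (expR (- (n * H)) * (A1 * A1) + B1 * Q1 + Q1 * B1 + Q1 * Q1)).
Proof.
move=> /andP[t0 t1] iA iB iQ; set c := expR (4 * _).
have c0 : 0 <= c by exact: expR_ge0.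
have ma := measurable_profile_exp P n.
have mb := measurable_profile_exp P (2 * n).
have halfE : half = `[0, t]%classic `|` `]t, 2^-1]%classic.
  apply/seteqP; split => y /=; rewrite /= !in_itv/=.
    by move=> /andP[? ?]; have [?|?] := leP y t; [left|right]; apply/andP; split; lra.
  by move=> [] /andP[? ?]; apply/andP; split; lra.
have dis : [disjoint (`[0, t]%classic : set R) & (`]t, 2^-1]%classic : set R)].
  by apply/disj_setPS => x []/=; rewrite !in_itv/= => /andP[_ xa] /andP[ax _]; lra.
have sub1 x : `[0, t]%classic x -> half x by rewrite halfE; left.
have sub2 x : `]t, 2^-1]%classic x -> half x by rewrite halfE; right.
have bE x y : half x -> half y ->
    E (x, y) <= c * (expR (- (2 * n * h x)) * expR (- (2 * n * h y))).
  move=> hx hy; have [xP yP ->] := EEh hx hy; rewrite -!expRD ler_expR.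
  have := ler_wpM2l (ltW n0) (square_mass_ge2 P xP yP); lra.
have cE : c * (expR (- (n * H)) * (A1 * A1) + B1 * Q1 + Q1 * B1 + Q1 * Q1) =
  (c * expR (- (n * H))) * (A1 * A1) + c * (B1 * Q1) + (c * (Q1 * B1) + c * (Q1 * Q1)) by ring.
apply: T_le; rewrite cE !EFinD /q halfE.
rewrite integral_rectangleUl//; last exact: measurableU.
rewrite !integral_rectangleUr//.
apply: leeD; apply: leeD.
- apply: (integral_rectangle_le mE E0 _ _ ma ma _ _ _ _ iA iA) => //.
    by rewrite mulr_ge0 ?expR_ge0.
  move=> x y Ax Ay; have [xP yP ->] := EEh (sub1 _ Ax) (sub1 _ Ay).
  rewrite -!expRD ler_expR.
  have := ler_wpM2l (ltW n0) (square_mass_ge1 P xP yP); lra.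
- apply: (integral_rectangle_le mE E0 _ _ mb mb _ _ _ _ iB iQ) => // x y Ax Ay.
  by apply: bE; [exact: sub1|exact: sub2].
- apply: (integral_rectangle_le mE E0 _ _ mb mb _ _ _ _ iQ iB) => // x y Ax Ay.
  by apply: bE; [exact: sub2|exact: sub1].
- apply: (integral_rectangle_le mE E0 _ _ mb mb _ _ _ _ iQ iQ) => // x y Ax Ay.
  by apply: bE; exact: sub2.
Qed.

End target.

(** * Moments of the kernels in the class *)

(** For t >= 1 an integer m > 4 / eta gives t^4 <= (t^eta)^m, and the exponential series gives x^m /
    m! <= e^x. The power 4 is what (1 + t^2) t^j with j <= 2 requires. *)
Lemma stretched_exp_bound (R : realType) (eta : R) : 0 < eta ->
  exists2 C, 0 < C & forall t, 0 <= t -> (1 + t ^+ 4) * expR (- (eta * t `^ eta)) <= C.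
Proof.
move=> eta0.
have q0 : 0 < 4 / eta by rewrite divr_gt0.
have := archi_boundP (ltW q0); set m := Num.bound _ => mP.
have m0 : 0 < (m%:R : R) by exact: lt_trans mP.
have fm0 : 0 < (m`!%:R : R) by rewrite ltr0n fact_gt0.
have D0 : 0 < m`!%:R / eta ^+ m by rewrite divr_gt0// exprn_gt0.
exists (2 + m`!%:R / eta ^+ m); first by rewrite addr_gt0.
move=> t t0.
have x0 : 0 <= eta * t `^ eta by rewrite mulr_ge0 ?(ltW eta0)// powR_ge0.
have e1 : expR (- (eta * t `^ eta)) <= 1 by rewrite expR_le1 oppr_le0.
have e0 : 0 <= expR (- (eta * t `^ eta)) by exact: expR_ge0.
have [t1|/ltW t1] := leP t 1.
  have t4 : t ^+ 4 <= 1 by rewrite exprn_ile1.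
  apply: (@le_trans _ _ 2); last by rewrite lerDl ltW.
  by rewrite -[leRHS]mulr1 ler_pM// ?addr_ge0 ?exprn_ge0//; lra.
have key : t ^+ 4 * expR (- (eta * t `^ eta)) <= m`!%:R / eta ^+ m.
  have tm : t ^+ 4 <= (t `^ eta) ^+ m.
    rewrite -(powR_mulrn m (powR_ge0 _ _)) -powRrM -(powR_mulrn 4 t0) ler_powR//.
    by rewrite mulrC -ler_pdivrMr// ltW.
  have mm : m = m.-1.+1 by rewrite prednK// -(ltr0n R).
  have := expR_ge1Dxn m.-1 x0; rewrite -mm => ex.
  rewrite expRN ler_pdivrMr ?expR_gt0// mulrAC ler_pdivlMr ?exprn_gt0//.
  apply: (@le_trans _ _ ((eta * t `^ eta) ^+ m)).
    by rewrite exprMn mulrC ler_wpM2l// exprn_ge0// ltW.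
  by rewrite [leRHS]mulrC -ler_pdivrMr//; apply: le_trans ex; rewrite lerDr.
rewrite mulrDl mul1r; lra.
Qed.

Section kernel_class.
Context {R : realType} (eta : R) (eta01 : 0 < eta <= 1).
Notation leb := (@lebesgue_measure R).

Let eta0 : 0 < eta. Proof. by case/andP: eta01. Qed.

Lemma moment_scale (phi : R * R -> R) (r : R) (j : nat) : 0 < r ->
  measurable_fun setT phi -> (forall z, 0 <= phi z) ->
  (\int[leb]_(t in `[0%R, +oo[) (t ^+ j * phi (t, 0%R))%:E =
   (r ^+ j.+1)%:E * \int[leb]_(t in `[0%R, +oo[) (t ^+ j * phi ((r * t)%R, 0%R))%:E)%E.
Proof.
move=> r0 mphi phi0.
have mt : measurable_fun setT (fun t : R => (t ^+ j * phi (t, 0))%:E).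
  apply/measurable_EFinP; apply: measurable_funM; first exact: measurable_funX.
  exact: measurableT_comp.
have mrt : measurable_fun setT (fun t : R => (t ^+ j * phi (r * t, 0))%:E).
  apply/measurable_EFinP; apply: measurable_funM; first exact: measurable_funX.
  by apply: measurableT_comp => //; apply: measurable_fun_pair => //; exact: measurable_funM.
have tphi0 (t : R) : (`[0, +oo[%classic : set R) t -> (0 <= (t ^+ j * phi (t, 0%R))%:E)%E.
  by rewrite /= in_itv/= andbT => t0; rewrite lee_fin mulr_ge0// exprn_ge0.
rewrite [LHS](@ge0_integral_affine R r 0%R _ _ r0 _ _ tphi0)//; last exact: measurable_funTS.
rewrite (_ : _ @^-1` _ = `[0%R, +oo[%classic); last first.
  by apply/seteqP; split => y /=; rewrite !in_itv/= !andbT addr0 pmulr_rge0.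
rewrite exprS EFinM -muleA; congr (_ * _)%E.
rewrite -ge0_integralZl_EFin ?exprn_ge0 ?(ltW r0)//.
- by apply: eq_integral => t _; rewrite addr0 exprMn -mulrA EFinM.
- by move=> t; rewrite /= in_itv/= andbT => t0; rewrite lee_fin mulr_ge0// exprn_ge0.
- exact: measurable_funTS.
Qed.

(** Rescaled by [rho] and divided by [mu], the kernels have axial moments of order at most 2 bounded
    in terms of eta alone: from above by the stretched exponential tail, and from below, for orders
    0 and 1, because the kernel is at least eta [mu] at norms below [rho]. Hence a single C serves
    the whole class. *)
Lemma class_profile : exists2 C, 0 < C &
  forall phi : R * R -> R, (Phi2 eta `&` Psi2) phi ->
  [/\ 0 < mu phi <= 1, 0 < rho eta phi, eta <= J1 eta phi <= C,
      eta <= J2 eta phi <= C &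
      Iint phi = mu phi * rho eta phi ^+ 2 * J2 eta phi] /\
  exists h k, profile (mu phi) (mu phi * rho eta phi * J1 eta phi)
    (C * (mu phi * rho eta phi ^+ 3)) (Iint phi / 4) h k /\
    forall x1 x2, 0 <= x1 <= 1 -> 0 <= x2 <= 1 ->
      \int[lebesgue2]_(y in unit_square) phi (y - (x1, x2)) = square_mass k x1 x2.
Proof.
have [C0 C00 C0P] := stretched_exp_bound eta0.
(* Bound for the rescaled moments over p: 2 from (1 + t^2)^2 <= 2 (1 + t^4), 3 / eta from the class,
   pi / 2 as the integral of 1 / (1 + t^2). *)
pose D := 2 * (3 / eta * C0) * (pi / 2).
have D0 : 0 < D by rewrite !mulr_gt0 ?invr_gt0// ?pi_gt0.
(* The factor 8 covers 2 pi in [J2], as pi <= 4, and pi / 2 in the tail bound. *)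
exists (8 * D).
  by rewrite mulr_gt0.
move=> phi [[[mphi phi01 _] /andP[rE0 rEy] phi_le] [_ phi_rad]].
set p := mu phi in phi_le *; set r := rho eta phi in phi_le *.
have phi0 z : 0 <= phi z by case/andP: (phi01 z).
have ub : ubound (range phi) 1 by move=> _ [z _ <-]; case/andP: (phi01 z).
have phip z : phi z <= p.
  by apply: ub_le_sup; [exists 1|exists z].
have p1 : p <= 1 by apply: ge_sup => //; exists (phi 0); exists 0.
have rEf : rhoE eta phi = r%:E.
  by rewrite fineK// ge0_fin_numE// ltW.
have r0 : 0 < r by rewrite -lte_fin -rEf.
have pge0 : 0 <= p by exact: le_trans (phi0 0) (phip 0).
(* If p were 0, no point would satisfy phi < eta p, and the infimum defining [rhoE] would be +oo. *)
have p0 : 0 < p.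
  rewrite lt_neqAle pge0 andbT eq_sym; apply/eqP => p0.
  move: rEy; rewrite /rhoE (_ : [set _ | _ in _] = set0) ?ereal_inf0//.
  apply/seteqP; split => // y [z /=]; rewrite -/p p0 mulr0 => zlt.
  by have := phi0 z; rewrite leNgt zlt.
have phi_ge z : enorm z < r -> eta * p <= phi z.
  move=> zr; rewrite leNgt; apply/negP => zlt.
  have : (rhoE eta phi <= (enorm z)%:E)%E by apply: ereal_inf_lbound; exists z.
  by rewrite rEf lee_fin leNgt zr.
have enormr t : 0 <= t -> enorm (r * t, 0) = r * t.
  by move=> t0; rewrite /enorm/= expr0n addr0 sqrtr_sqr ger0_norm// mulr_ge0// ltW.
pose m (j : nat) : \bar R := (\int[leb]_(t in `[0%R, +oo[) (t ^+ j * phi ((r * t)%R, 0%R))%:E)%E.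
have mrt j : measurable_fun setT (fun t : R => (t ^+ j * phi (r * t, 0))%:E).
  apply/measurable_EFinP; apply: measurable_funM; first exact: measurable_funX.
  by apply: measurableT_comp => //; apply: measurable_fun_pair => //; exact: measurable_funM.
have mpos j (t : R) : (`[0, +oo[%classic : set R) t -> (0 <= (t ^+ j * phi ((r * t)%R, 0%R))%:E)%E.
  by rewrite /= in_itv/= andbT => t0; rewrite lee_fin mulr_ge0// exprn_ge0.
have m0 j : (0 <= m j)%E by apply: integral_ge0 => t; exact: mpos.
have mle j : (j <= 2)%N -> (m j <= (p * D)%:E)%E.
  move=> j2.
  pose c := 2 * (3 / eta * C0) * p.
  have c0 : 0 <= c by rewrite !mulr_ge0 ?invr_ge0 ?(ltW C00) ?(ltW eta0).
  have -> : p * D = c * (pi / 2) by rewrite /c /D; ring.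
  rewrite EFinM -integral0y_oneDsqr -ge0_integralZl_EFin//; last first.
    apply/measurable_EFinP; apply: measurable_funTS.
    by apply: continuous_measurable_fun; exact: continuous_oneDsqrV.
  apply: ge0_le_integral => //.
  - exact: mpos.
  - exact: measurable_funTS (mrt j).
  - apply: emeasurable_funM => //; apply/measurable_EFinP; apply: measurable_funTS.
    by apply: continuous_measurable_fun; exact: continuous_oneDsqrV.
  - move=> t; rewrite /= in_itv/= andbT => t0; rewrite -EFinM lee_fin.
    have o1 : 1 <= oneDsqr t by exact: oneDsqr_ge1.
    rewrite ler_pdivlMr; last exact: lt_le_trans o1.
    have bd := phi_le (r * t, 0); rewrite enormr// (mulrC r) mulfK ?gt_eqF// in bd.
    have tj : t ^+ j <= 1 + t ^+ 2.
      have [t1|/ltW t1] := leP t 1.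
        by rewrite (@le_trans _ _ 1) ?exprn_ile1// lerDl sqr_ge0.
      by rewrite (@le_trans _ _ (t ^+ 2)) ?lerDr// ler_weXn2l.
    have tj0 : 0 <= t ^+ j by rewrite exprn_ge0.
    have E0 := expR_ge0 (- (eta * t `^ eta)).
    have K0 : 0 <= 3 / eta * p by rewrite !mulr_ge0// invr_ge0 ltW.
    have : t ^+ j * oneDsqr t <= 2 * (1 + t ^+ 4).
      apply: (@le_trans _ _ ((1 + t ^+ 2) * (1 + t ^+ 2))).
        by rewrite ler_pM// (le_trans ler01).
      have := sqr_ge0 (t ^+ 2 - 1); rewrite (_ : t ^+ 4 = (t ^+ 2) ^+ 2); last by rewrite -exprM.
      rewrite !expr2; lra.
    move=> h1.
    apply: (@le_trans _ _ (2 * (1 + t ^+ 4) * (3 / eta * p * expR (- (eta * t `^ eta))))).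
      rewrite mulrAC mulrC (mulrC (2 * _)); apply: ler_pM => //.
      by rewrite mulr_ge0// (le_trans ler01).
      by rewrite (mulrC r).
    rewrite (_ : 2 * _ * _ = 2 * (3 / eta) * p * ((1 + t ^+ 4) * expR (- (eta * t `^ eta)))); last by ring.
    rewrite (_ : c = 2 * (3 / eta) * p * C0); last by rewrite /c; ring.
    by rewrite ler_wpM2l ?C0P// !mulr_ge0// invr_ge0 ltW.
have mfin j : (j <= 2)%N -> m j = (fine (m j))%:E.
  move=> j2; rewrite fineK// ge0_fin_numE//.
  by rewrite (le_lt_trans (mle _ j2))// ltry.
have mom j : (j <= 2)%N ->
    (\int[leb]_(t in `[0%R, +oo[) (t ^+ j * phi (t, 0%R))%:E)%E = (r ^+ j.+1 * fine (m j))%:E.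
  by move=> j2; rewrite (moment_scale _ r0)// -/(m j) EFinM -mfin.
have J1E : J1 eta phi = p^-1 * fine (m 0%N).
  rewrite /J1 /Rintegral -/p -/r; congr (_ * fine _).
  by apply: eq_integral => t _; rewrite expr0 mul1r.
have J2E : J2 eta phi = p^-1 * (2 * pi * fine (m 1%N)).
  rewrite /J2 /Rintegral -/p -/r; congr (_ * _).
  rewrite (_ : (\int[_]_(t in _) _)%E = ((2 * pi)%:E * m 1%N)%E); first by rewrite mfin.
  rewrite /m -ge0_integralZl_EFin//.
  - by apply: eq_integral => t _; rewrite expr1 -EFinM; congr _%:E; ring.
  - exact: mpos.
  - exact: measurable_funTS (mrt 1%N).
  - by rewrite mulr_ge0// ltW// pi_gt0.
have mle_r j : (j <= 2)%N -> fine (m j) <= p * D.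
  by move=> j2; rewrite -lee_fin -mfin// mle.
(* Integrate over [d, 1[ only. The choice d = 0 serves [J1]; for [J2], d = 1/2 gives the factor 1/4,
   compensated by 2 pi >= 4. *)
have low j (d : R) : 0 <= d <= 1 -> (j <= 2)%N ->
    eta * p * (d ^+ j * (1 - d)) <= fine (m j).
  move=> /andP[d0 d1] j2; rewrite -lee_fin -mfin// mulrA.
  rewrite -(@integral_cst_itv R true true d 1)//.
  apply: (@le_trans _ _ (\int[leb]_(t in `[d, 1%R[) (t ^+ j * phi ((r * t)%R, 0%R))%:E)%E).
    apply: ge0_le_integral => //.
    - by move=> t _; rewrite lee_fin !mulr_ge0// ?exprn_ge0// ltW.
    - exact: measurable_funTS (mrt j).
    - move=> t /=; rewrite in_itv/= => /andP[dt t1]; rewrite lee_fin mulrC.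
      apply: ler_pM => //; rewrite ?exprn_ge0// ?mulr_ge0// ?(ltW eta0)//.
        by rewrite lerXn2r// nnegrE// (le_trans d0).
      by apply: phi_ge; rewrite enormr ?(le_trans d0)// -[ltRHS]mulr1 ltr_pM2l.
  apply: ge0_subset_integral => //.
  - exact: measurable_funTS (mrt j).
  - exact: mpos.
  - by move=> t /=; rewrite !in_itv/= andbT => /andP[/(le_trans d0)].
have J1b : eta <= J1 eta phi <= 8 * D.
  rewrite J1E; apply/andP; split.
    rewrite mulrC ler_pdivlMr//; have := low 0%N 0 _ isT.
    by rewrite expr0 subr0 !mulr1; apply; rewrite lexx ler01.
  rewrite mulrC ler_pdivrMr//; have := mle_r 0%N isT.
  have : 0 <= p * D by rewrite mulr_ge0// ltW.
  lra.
have pi2 : 2 <= (pi : R) by exact: pi_ge2.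
have pi4 : (pi : R) <= 4 by have := @pihalf_lt2 R; lra.
have J2b : eta <= J2 eta phi <= 8 * D.
  rewrite J2E; apply/andP; split.
    rewrite mulrC ler_pdivlMr//; have := low 1%N 2^-1 _ isT.
    rewrite expr1 => h; have {}h := h _.
    have ep : 0 <= eta * p by rewrite mulr_ge0// ltW.
    have {}h : eta * p * (2^-1 * (1 - 2^-1)) <= fine (m 1%N) by apply: h; lra.
    have f0 : 0 <= fine (m 1%N) by lra.
    have : 4 * fine (m 1%N) <= 2 * pi * fine (m 1%N) by rewrite ler_wpM2r//; lra.
    lra.
  rewrite mulrC ler_pdivrMr//; have := mle_r 1%N isT.
  have f0 : 0 <= fine (m 1%N) by rewrite fine_ge0.
  have : 2 * pi * fine (m 1%N) <= 8 * fine (m 1%N) by rewrite ler_wpM2r//; lra.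
  lra.
have mom0 : (\int[leb]_(t in `[0%R, +oo[) (phi (t, 0%R))%:E)%E = (r * fine (m 0%N))%:E.
  rewrite -[X in X * _]expr1 -(mom 0%N)//.
  by apply: eq_integral => t _; rewrite expr0 mul1r.
have mom1 : (\int[leb]_(t in `[0%R, +oo[) (t * phi (t, 0%R))%:E)%E = (r ^+ 2 * fine (m 1%N))%:E.
  by rewrite -(mom 1%N)//.
have mom2 := mom 2%N isT.
have IE : Iint phi = 4 * Hmass (r ^+ 2 * fine (m 1%N)).
  by rewrite /Iint /Rintegral (mass_plane mphi phi0 phi_rad mom1).
split.
  split => //; first by rewrite p0.
  rewrite IE J2E /Hmass; field; by rewrite gt_eqF.
exists (hmass phi), (kmass phi).
split.
  have -> : p * r * J1 eta phi = r * fine (m 0%N).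
    by rewrite J1E; field; rewrite gt_eqF.
  have -> : Iint phi / 4 = Hmass (r ^+ 2 * fine (m 1%N)).
    by rewrite IE; field.
  split.
  - exact: hmass_ge0 mphi phi0 phi_rad mom1.
  - exact: hmass_le_Hmass mphi phi0 phi_rad mom1.
  - exact: hmass_mono mphi phi0 phi_rad mom1.
  - exact: hmass_le mphi phi0 phi_rad mom0 mom1.
  - exact: hmass_ge mphi phi0 phip phi_rad mom0 mom1.
  - move=> a a0; apply: le_trans (hmass_tail mphi phi0 phi_rad mom1 mom2 a0) _.
    have := mle_r 2%N isT; have r3 : 0 <= r ^+ 3 by rewrite exprn_ge0// ltW.
    move=> m2; have {m2} := ler_wpM2l r3 m2.
    have f0 : 0 <= r ^+ 3 * fine (m 2%N) by rewrite mulr_ge0// fine_ge0.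
    have : pi / 2 * (r ^+ 3 * fine (m 2%N)) <= 2 * (r ^+ 3 * fine (m 2%N)).
      by rewrite ler_wpM2r//; lra.
    lra.
  - exact: kmass_sym mphi phi0 phi_rad mom1.
  - exact: kmass_ge0 mphi phi0 phi_rad mom1.
  - exact: kmass_le_hmass mphi phi0 phi_rad mom1.
  - exact: hmassD_le mphi phi0 phi_rad mom1.
  - exact: kmass_le mphi phi0 phip phi_rad mom1.
move=> x1 x2 x1P x2P.
by rewrite /Rintegral (mass_unit_square mphi phi0 phi_rad mom1).
Qed.

End kernel_class.

(** * Interior, edge and corner contributions *)

Section sandwich.
Context {R : realType} (p r a C H : R) (h : R -> R) (k : R -> R -> R).
Context (P : profile p (p * r * a) (C * (p * r ^+ 3)) H h k).
Context (E : R * R -> R) (n M K : R).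
Context (mE : measurable_fun setT E) (E0 : forall z, 0 <= E z).
Context (EE : forall x y, 0 <= x <= 1 -> 0 <= y <= 1 ->
  E (x, y) = expR (- (n * square_mass k x y))).
Context (n0 : 0 < n) (p0 : 0 < p) (r0 : 0 < r) (a0 : 0 < a) (M0 : 0 < M) (K0 : 0 < K).
Context (MN : M ^+ 3 = n * p * r ^+ 2).

Let T := \int[@lebesgue2 R]_(z in unit_square) E z.
(** Corner cutoff in units of r: at d = r s one has n p d^2 = 1 / M, which vanishes, while n p r d =
    M diverges. Taking M as the cube root of n p r^2 makes both integral powers of M. *)
Let s := (M ^+ 2)^-1.
Let w := n * p * r.

Definition interior_term := n * expR (- (4 * (n * H))).
(** With g = p r a, four edges of length 1 each contribute the integral of exp (- 2 n (H + g x))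
    over x >= 0, and four corners each that of exp (- n (H + g x + g y)) over the quadrant; both are
    then multiplied by n. *)
Definition edge_term := 2 * n * expR (- (2 * (n * H))) / (n * p * r * a).
Definition corner_term := 4 * n * expR (- (n * H)) / (n * p * r * a) ^+ 2.

Let s0 : 0 < s. Proof. by rewrite invr_gt0 exprn_gt0. Qed.
Let w0 : 0 < w. Proof. by rewrite !mulr_gt0. Qed.
Let g0 : 0 < p * r * a. Proof. by rewrite !mulr_gt0. Qed.
Let wr : w * r = M ^+ 3. Proof. by rewrite MN /w; ring. Qed.

Let tail x : 0 < x -> n * (H - h x) <= C * M ^+ 3 * r / x.
Proof.
move=> x0; rewrite ler_pdivlMr//.
have := ler_wpM2l (ltW n0) (profile_h_tail P (ltW x0)).
rewrite (_ : C * M ^+ 3 * r = n * (C * (p * r ^+ 3))); last by rewrite MN; ring.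
by rewrite (_ : n * (H - h x) * x = n * (x * (H - h x))); last by ring.
Qed.

Lemma interior_le : interior_term <= n * T.
Proof. by rewrite /interior_term ler_pM2l// (target_ge1 P n0 mE E0 EE). Qed.

Lemma edge_le : K * r <= 2^-1 ->
  edge_term * ((1 - expR (- (2 * (a * K) * M ^+ 3))) * (1 - 2 * K * r)) <= n * T.
Proof.
move=> Kr.
have t0 : 0 <= K * r <= 2^-1 by rewrite Kr mulr_ge0// ltW.
have := target_ge2 P n0 g0 mE E0 EE t0; rewrite -(ler_pM2l n0); apply: le_trans.
rewrite (_ : 2 * (n * (p * r * a)) * (K * r) = 2 * (a * K) * M ^+ 3); last first.
  by rewrite -wr /w; ring.
rewrite /edge_term le_eqVlt; apply/orP; left; apply/eqP; field.
by rewrite !gt_eqF// !mulr_gt0.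
Qed.

Lemma corner_le : r * s <= 2^-1 ->
  corner_term * (expR (- M^-1) * (1 - expR (- (a * M))) ^+ 2) <= n * T.
Proof.
move=> rs.
have t0 : 0 <= r * s <= 2^-1 by rewrite rs mulr_ge0// ltW.
have := target_ge3 P n0 g0 mE E0 EE t0; rewrite -(ler_pM2l n0); apply: le_trans.
rewrite (_ : n * (p * r * a) * (r * s) = a * M); last first.
  have -> : n * (p * r * a) * (r * s) = a * (w * r) * s by rewrite /w; ring.
  by rewrite wr /s; field; rewrite gt_eqF.
rewrite (_ : n * p * (r * s) ^+ 2 = M^-1); last first.
  have -> : n * p * (r * s) ^+ 2 = (w * r) * s ^+ 2 by rewrite /w; ring.
  by rewrite wr /s; field; rewrite gt_eqF.
rewrite /corner_term opprD expRD le_eqVlt; apply/orP; left; apply/eqP; field.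
by rewrite !gt_eqF// !mulr_gt0.
Qed.

(** In the upper bound U / w and U / (2 w) control the integrals up to K r with exponents n h and 2
    n h; the factor 2 in U lets one expression serve both. The integral beyond K r is controlled by
    exp (- 2 n H) V / 2, and X pays for truncating the quadrants at 1/2. In the limit a U, V and X
    tend to 1. *)
Let U := (a - s)^-1 + 2 * K * M ^+ 3 * expR (- (M * (a - s))).
Let V := 2 * Num.sqrt r * expR (2 * (C * M ^+ 3 / K)) +
  expR (2 * (C * M ^+ 3 * Num.sqrt r)).
Let X := expR (8 * (C * M ^+ 3 * r)).

(** Cut at K r, and the far part again at sqrt r. In [target_le] the product of two near integrals
    becomes the corner term, the two mixed products the edge term, and the product of two far
    integrals the interior term. *)
Lemma target_upper : s < a -> K * r <= Num.sqrt r -> Num.sqrt r <= 2^-1 ->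
  n * T <= interior_term * (X * V ^+ 2) + edge_term * (X * (a * U * V)) +
           corner_term * (X * (a * U) ^+ 2).
Proof.
move=> sa Ks s1.
have as0 : 0 < a - s by rewrite subr_gt0.
have sq0 : 0 < Num.sqrt r by rewrite sqrtr_gt0.
have t0 : 0 < K * r by rewrite mulr_gt0.
have d0 : 0 < r * s by rewrite mulr_gt0.
have gd : p * r * a - p * (r * s) = p * r * (a - s) by ring.
have gd0 : 0 < p * r * a - p * (r * s) by rewrite gd !mulr_gt0.
have Ms : w * r * s = M by rewrite wr /s; field; rewrite gt_eqF.
have KrE : K * r = K * M ^+ 3 / w by rewrite -wr; field; rewrite gt_eqF.
have y0 : 0 <= M * (a - s) by rewrite mulr_ge0// ltW.
have e0 := expR_ge0 (- (M * (a - s))).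
have KM0 : 0 <= K * M ^+ 3 by rewrite mulr_ge0 ?exprn_ge0// ltW.
have iA := integral_exp_profile_near P n0 d0 (ltW t0) gd0.
have n20 : 0 < 2 * n by rewrite mulr_gt0.
have iB := integral_exp_profile_near P n20 d0 (ltW t0) gd0.
have iQ := integral_exp_profile_far P (ltW n20) (introT andP (conj (ltW t0) Ks)) s1.
have hA : (n * (p * r * a - p * (r * s)))^-1 +
    K * r * expR (- (n * (p * r * a - p * (r * s)) * (r * s))) <= U / w.
  rewrite gd (_ : n * (p * r * (a - s)) * (r * s) = M * (a - s)); last by rewrite -[in RHS]Ms /w; ring.
  rewrite KrE (_ : U / w = (n * (p * r * (a - s)))^-1 + 2 * (K * M ^+ 3 / w * expR (- (M * (a - s))))).
    rewrite lerD2l ler_peMl ?ler1n// mulr_ge0// divr_ge0// ltW//.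
  by rewrite /U /w; field; rewrite !gt_eqF.
have hB : (2 * n * (p * r * a - p * (r * s)))^-1 +
    K * r * expR (- (2 * n * (p * r * a - p * (r * s)) * (r * s))) <= U / (2 * w).
  rewrite gd (_ : 2 * n * (p * r * (a - s)) * (r * s) = 2 * (M * (a - s))); last by rewrite -[in RHS]Ms /w; ring.
  rewrite KrE (_ : U / (2 * w) = (2 * n * (p * r * (a - s)))^-1 + (K * M ^+ 3 / w * expR (- (M * (a - s))))).
    rewrite lerD2l ler_wpM2l ?divr_ge0 ?(ltW w0)// ler_expR lerN2; lra.
  by rewrite /U /w; field; rewrite !gt_eqF.
have hQ : Num.sqrt r * expR (- (2 * n * h (K * r))) + 2^-1 * expR (- (2 * n * h (Num.sqrt r))) <=
    2^-1 * expR (- (2 * (n * H))) * V.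
  have tK := tail t0.
  rewrite (_ : C * M ^+ 3 * r / (K * r) = C * M ^+ 3 / K) in tK; last by field; rewrite !gt_eqF.
  have tS := tail sq0.
  rewrite (_ : C * M ^+ 3 * r / Num.sqrt r = C * M ^+ 3 * Num.sqrt r) in tS; last first.
    rewrite -{1}(sqr_sqrtr (ltW r0)); by field; rewrite gt_eqF.
  have e1 : expR (- (2 * n * h (K * r))) <= expR (- (2 * (n * H))) * expR (2 * (C * M ^+ 3 / K)).
    by rewrite -expRD ler_expR; lra.
  have e2 : expR (- (2 * n * h (Num.sqrt r))) <= expR (- (2 * (n * H))) * expR (2 * (C * M ^+ 3 * Num.sqrt r)).
    by rewrite -expRD ler_expR; lra.
  have := ler_wpM2l (ltW sq0) e1; rewrite /V; lra.
have hX : expR (4 * (n * (H - h 2^-1))) <= X.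
  have h2 : 0 < (2^-1 : R) by rewrite invr_gt0.
  have := tail h2; rewrite invrK /X ler_expR; lra.
have kr : K * r <= 2^-1 by exact: le_trans s1.
have t01 : 0 <= K * r <= 2^-1 by rewrite (ltW t0).
have iA' := le_trans iA (etrans (lee_fin _ _) hA).
have iB' := le_trans iB (etrans (lee_fin _ _) hB).
have iQ' := le_trans iQ (etrans (lee_fin _ _) hQ).
have := target_le P n0 mE E0 EE t01 iA' iB' iQ'.
rewrite -(ler_pM2l n0) => /le_trans; apply.
set Z := (X in expR _ * X).
have U0 : 0 <= U.
  by rewrite addr_ge0 ?invr_ge0 ?(ltW as0)// mulr_ge0// -mulrA mulr_ge0.
have V0 : 0 <= V by rewrite addr_ge0 ?mulr_ge0 ?expR_ge0// ltW.
have Z0 : 0 <= Z.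
  by rewrite /Z !addr_ge0// !mulr_ge0 ?expR_ge0 ?invr_ge0 ?(ltW w0) ?(ltW n20)// mulr_ge0// ltW.
apply: (@le_trans _ _ (n * (4 * (X * Z)))).
  by rewrite ler_pM2l// ler_pM2l// ler_wpM2r.
rewrite le_eqVlt; apply/orP; left; apply/eqP.
rewrite /Z /interior_term /edge_term /corner_term.
rewrite (_ : expR (- (4 * (n * H))) = expR (- (2 * (n * H))) ^+ 2); last first.
  by rewrite -expRM_natl; congr expR; ring.
rewrite /w; field.
by rewrite !gt_eqF.
Qed.

End sandwich.

(** * Elementary limits of sequences *)

Section sequences.
Context {R : realType}.
Implicit Types f g : nat -> R.

Lemma cvg_inv_pinfty f : f n @[n --> \oo] --> +oo -> (f n)^-1 @[n --> \oo] --> (0 : R).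
Proof.
move=> fy; apply/(@gtr0_cvgV0 _ _ _ _ f) => //.
by move/cvgryPgt : fy => /(_ 0).
Qed.

Lemma cvg_pow_expN f (c : R) (j : nat) : 0 < c -> f n @[n --> \oo] --> +oo ->
  f n ^+ j * expR (- (c * f n)) @[n --> \oo] --> (0 : R).
Proof.
(* The term of degree j + 1 of the exponential series leaves a bound D / f. *)
move=> c0 fy; pose D := (j.+1)`!%:R / c ^+ j.+1.
have D0 : 0 < D by rewrite divr_gt0 ?exprn_gt0// ltr0n fact_gt0.
apply: (@squeeze_cvgr _ _ _ _ (cst 0) (fun n => D * (f n)^-1)).
- move/cvgryPgt : fy => /(_ 0); apply: filterS => n fn0.
  rewrite mulr_ge0 ?exprn_ge0 ?expR_ge0 ?(ltW fn0)//=.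
  rewrite expRN ler_pdivrMr ?expR_gt0// mulrAC ler_pdivlMr//.
  have y0 : 0 <= c * f n by rewrite mulr_ge0 ?ltW.
  have := expR_ge1Dxn j y0; rewrite exprMn => h.
  have {}h : c ^+ j.+1 * f n ^+ j.+1 / (j.+1)`!%:R <= expR (c * f n) by lra.
  rewrite -exprSr /D mulrAC ler_pdivlMr ?exprn_gt0// mulrC.
  by move: h; rewrite ler_pdivrMr ?ltr0n ?fact_gt0// [leRHS]mulrC.
- exact: cvg_cst.
- by rewrite -(mulr0 D); apply: cvgM; [exact: cvg_cst|exact: cvg_inv_pinfty].
Qed.

Lemma cvg_expN f (c : R) : 0 < c -> f n @[n --> \oo] --> +oo ->
  expR (- (c * f n)) @[n --> \oo] --> (0 : R).
Proof.
move=> c0 fy; have := @cvg_pow_expN f c 0 c0 fy.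
by under eq_fun do rewrite expr0 mul1r.
Qed.

Lemma cvg_expR f (l : R) : f n @[n --> \oo] --> l ->
  expR (f n) @[n --> \oo] --> expR l.
Proof. by move=> fl; apply: (cvg_comp _ _ fl); exact: continuous_expR. Qed.

Lemma cvg_squeeze_near g f1 f2 (l : R) : (\forall n \near \oo, f1 n <= g n <= f2 n) ->
  f1 n @[n --> \oo] --> l -> f2 n @[n --> \oo] --> l -> g n @[n --> \oo] --> l.
Proof. by move=> sq f1l f2l; exact: (squeeze_cvgr sq f1l f2l). Qed.

Lemma cvg_exprn_pinfty f (j : nat) : f n @[n --> \oo] --> +oo ->
  f n ^+ j.+1 @[n --> \oo] --> +oo.
Proof.
move=> fy; apply: (ger_cvgy _ fy).
move/cvgryPge : fy => /(_ 1); apply: filterS => n f1.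
by rewrite exprS ler_peMr ?exprn_ege1// (le_trans ler01).
Qed.

End sequences.

(** * Asymptotic form of the sandwich *)

Section sandwich_limit.
Context {R : realType} (eta C c : R) (p r a H M : nat -> R)
  (h : nat -> R -> R) (k : nat -> R -> R -> R) (E : nat -> R * R -> R).
Context (eta0 : 0 < eta) (C0 : 0 < C) (c0 : 0 < c).
Context (P : forall n, profile (p n) (p n * r n * a n) (C * (p n * r n ^+ 3)) (H n) (h n) (k n)).
Context (mE : forall n, measurable_fun setT (E n)) (E0 : forall n z, 0 <= E n z).
Context (EE : forall n x y, 0 <= x <= 1 -> 0 <= y <= 1 ->
  E n (x, y) = expR (- (n%:R * square_mass (k n) x y))).
Context (p0 : forall n, 0 < p n) (r0 : forall n, 0 < r n)
  (aP : forall n, eta <= a n <= C).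
Context (MN : \forall n \near \oo, M n ^+ 3 = n%:R * p n * r n ^+ 2)
  (My : M n @[n --> \oo] --> +oo)
  (rM : \forall n \near \oo, r n <= expR (- (c * M n ^+ 3))).

Let A n := n%:R * \int[@lebesgue2 R]_(z in unit_square) E n z.
Let t1 n := interior_term (H n) n%:R.
Let t2 n := edge_term (p n) (r n) (a n) (H n) n%:R.
Let t3 n := corner_term (p n) (r n) (a n) (H n) n%:R.
(** With this width 2 C M^3 / K = c M^3 / 4, so the growing exponential in [V] is beaten by sqrt r
    <= exp (- c M^3 / 2). *)
Let K := 8 * C / c.
Let K0 : 0 < K. Proof. by rewrite divr_gt0// mulr_gt0. Qed.
Let M3y : M n ^+ 3 @[n --> \oo] --> +oo. Proof. exact: cvg_exprn_pinfty. Qed.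

Let a0 n : 0 < a n. Proof. by case/andP: (aP n) => /(lt_le_trans eta0). Qed.
Let aC n : a n <= C. Proof. by case/andP: (aP n). Qed.
Let ea n : eta <= a n. Proof. by case/andP: (aP n). Qed.

Let s_0 : (M n ^+ 2)^-1 @[n --> \oo] --> (0 : R).
Proof. by apply: cvg_inv_pinfty; exact: cvg_exprn_pinfty. Qed.

Let r_0 : r n @[n --> \oo] --> (0 : R).
Proof.
apply: (@cvg_squeeze_near _ _ (cst 0) (fun n => expR (- (c * M n ^+ 3)))).
- by move: rM; apply: filterS => n ->; rewrite /= ltW.
- exact: cvg_cst.
- exact: cvg_expN.
Qed.

Let sqr_le : \forall n \near \oo, Num.sqrt (r n) <= expR (- (c / 2 * M n ^+ 3)).
Proof.
move: rM; apply: filterS => n /ler_wsqrtr /le_trans; apply.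
rewrite (_ : - (c * _) = 2%:R * - (c / 2 * M n ^+ 3)); last by field.
by rewrite expRM_natl sqrtr_sqr ger0_norm// expR_ge0.
Qed.

Let sqr_0 : Num.sqrt (r n) @[n --> \oo] --> (0 : R).
Proof.
apply: (@cvg_squeeze_near _ _ (cst 0) (fun n => expR (- (c / 2 * M n ^+ 3)))).
- by move: sqr_le; apply: filterS => n ->; rewrite /= sqrtr_ge0.
- exact: cvg_cst.
- by apply: cvg_expN => //; rewrite divr_gt0.
Qed.

Let U n := (a n - (M n ^+ 2)^-1)^-1 +
  2 * K * M n ^+ 3 * expR (- (M n * (a n - (M n ^+ 2)^-1))).
Let V n := 2 * Num.sqrt (r n) * expR (2 * (C * M n ^+ 3 / K)) +
  expR (2 * (C * M n ^+ 3 * Num.sqrt (r n))).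
Let X n := expR (8 * (C * M n ^+ 3 * r n)).

(** Once s = M^(-2) is at most eta / 2, a / (a - s) <= 1 + 2 s / eta, and the other summand is O(M^3
    exp (- eta M / 2)). Only the bounds on a enter, as a itself may oscillate. *)
Let aU_1 : a n * U n @[n --> \oo] --> (1 : R).
Proof.
apply: (@cvg_squeeze_near _ _ (cst 1) (fun n => 1 + 2 / eta * (M n ^+ 2)^-1 +
  2 * K * C * (M n ^+ 3 * expR (- (eta / 2 * M n))))); last 2 first.
- exact: cvg_cst.
- rewrite -[X in _ --> X]addr0 -[X in _ --> X + _]addr0.
  apply: cvgD; first apply: cvgD; first exact: cvg_cst.
  + by rewrite -[X in _ --> X](mulr0 (2 / eta)); apply: cvgM => //; exact: cvg_cst.
  + rewrite -[X in _ --> X](mulr0 (2 * K * C)); apply: cvgM; first exact: cvg_cst.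
    by apply: cvg_pow_expN => //; rewrite divr_gt0.
have e2 : 0 < eta / 2 by rewrite divr_gt0.
move/cvgryPge : My => /(_ 1) M1; move/cvgr0_norm_le : s_0 => /(_ _ e2).
move: M1; apply: filterS2 => n M1 /(le_trans (ler_norm _)) s2.
have M0 : 0 < M n by lra.
have s0 : 0 < (M n ^+ 2)^-1 by rewrite invr_gt0 exprn_gt0.
set s := (M n ^+ 2)^-1 in s0 s2 *.
have an := ea n; have as0 : 0 < a n - s by lra.
have M3 : 0 <= M n ^+ 3 by rewrite exprn_ge0 ?ltW.
have x0 : 0 <= 2 * K * M n ^+ 3 * expR (- (M n * (a n - s))).
  by rewrite mulr_ge0 ?expR_ge0// mulr_ge0// mulr_ge0// ltW.
rewrite /U -/s mulrDr; apply/andP; split => /=.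
  have : 1 <= a n * (a n - s)^-1 by rewrite ler_pdivlMr// mul1r; lra.
  have : 0 <= a n * (2 * K * M n ^+ 3 * expR (- (M n * (a n - s)))) by rewrite mulr_ge0 ?(ltW (a0 n)).
  lra.
apply: lerD.
  rewrite ler_pdivrMr//.
  have : 0 <= 2 / eta * s * (a n - s - eta / 2).
    apply: mulr_ge0; last lra.
    by rewrite mulr_ge0 ?(ltW s0)// divr_ge0// ltW.
  have : 2 / eta * s * (eta / 2) = s by field; rewrite gt_eqF.
  lra.
have ex : expR (- (M n * (a n - s))) <= expR (- (eta / 2 * M n)).
  by rewrite ler_expR lerN2 mulrC ler_wpM2l ?(ltW M0)//; lra.
have KM : 0 <= 2 * K * M n ^+ 3 by rewrite mulr_ge0// mulr_ge0// ltW.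
rewrite (_ : 2 * K * C * (M n ^+ 3 * expR (- (eta / 2 * M n))) =
   C * (2 * K * M n ^+ 3 * expR (- (eta / 2 * M n)))); last by ring.
by apply: ler_pM => //; [exact: ltW|exact: ler_wpM2l].
Qed.

Let V_1 : V n @[n --> \oo] --> (1 : R).
Proof.
apply: (@cvg_squeeze_near _ _ (cst 1) (fun n => 2 * expR (- (c / 4 * M n ^+ 3)) +
   expR (2 * C * ((M n ^+ 3) ^+ 1 * expR (- (c / 2 * M n ^+ 3)))))); last 2 first.
- exact: cvg_cst.
- rewrite -[X in _ --> X]add0r; apply: cvgD.
    rewrite -[X in _ --> X](mulr0 2); apply: cvgM; first exact: cvg_cst.
    by apply: cvg_expN => //; rewrite divr_gt0.
  rewrite -[X in _ --> X]expR0; apply: cvg_expR.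
  rewrite -[X in _ --> X](mulr0 (2 * C)); apply: cvgM; first exact: cvg_cst.
  by apply: cvg_pow_expN => //; rewrite divr_gt0.
move/cvgryPge : My => /(_ 1) M1; move: M1 sqr_le; apply: filterS2 => n M1 sr.
have M3 : 0 <= M n ^+ 3 by rewrite exprn_ge0//; lra.
have s0 := sqrtr_ge0 (r n).
apply/andP; split => /=.
  have : 1 <= expR (2 * (C * M n ^+ 3 * Num.sqrt (r n))).
    by rewrite -[leLHS]expR0 ler_expR mulr_ge0// mulr_ge0// mulr_ge0// ltW.
  have : 0 <= 2 * Num.sqrt (r n) * expR (2 * (C * M n ^+ 3 / K)).
    by rewrite mulr_ge0 ?expR_ge0// mulr_ge0.
  rewrite /V; lra.
rewrite /V lerD//.
  rewrite -mulrA ler_pM2l//.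
  rewrite (_ : 2 * (C * M n ^+ 3 / K) = c / 4 * M n ^+ 3); last first.
    by rewrite /K; field; rewrite !gt_eqF.
  apply: le_trans (ler_wpM2r (expR_ge0 _) sr) _.
  by rewrite -expRD ler_expR; lra.
rewrite ler_expR expr1.
rewrite (_ : 2 * C * (_ * _) = 2 * (C * M n ^+ 3 * expR (- (c / 2 * M n ^+ 3)))); last by ring.
by rewrite ler_wpM2l// ler_wpM2l// mulr_ge0// ltW.
Qed.

Let X_1 : X n @[n --> \oo] --> (1 : R).
Proof.
rewrite -[X in _ --> X]expR0; apply: cvg_expR.
apply: (@cvg_squeeze_near _ _ (cst 0)
   (fun n => 8 * C * ((M n ^+ 3) ^+ 1 * expR (- (c * M n ^+ 3))))); last 2 first.
- exact: cvg_cst.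
- rewrite -[X in _ --> X](mulr0 (8 * C)); apply: cvgM; first exact: cvg_cst.
  by apply: cvg_pow_expN.
move/cvgryPge : My => /(_ 1) M1; move: M1 rM; apply: filterS2 => n M1 rn.
have M3 : 0 <= M n ^+ 3 by rewrite exprn_ge0//; lra.
apply/andP; split => /=; first by rewrite mulr_ge0// mulr_ge0 ?(ltW (r0 n))// mulr_ge0// ltW.
rewrite expr1 (_ : 8 * C * (_ * _) = 8 * (C * M n ^+ 3 * expR (- (c * M n ^+ 3)))); last by ring.
by rewrite ler_wpM2l// ler_wpM2l// mulr_ge0// ltW.
Qed.

(** All errors are multiplicative factors tending to 1, so the comparison needs no knowledge of
    which term survives; that depends on the regime. *)
Lemma sandwich_limit : exists x1 x2 x3 l2 l3 : nat -> R,
  [/\ [/\ x1 n @[n --> \oo] --> (1 : R), x2 n @[n --> \oo] --> (1 : R) &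
          x3 n @[n --> \oo] --> (1 : R)],
      l2 n @[n --> \oo] --> (1 : R), l3 n @[n --> \oo] --> (1 : R) &
      \forall n \near \oo, [/\ t1 n <= A n, t2 n * l2 n <= A n, t3 n * l3 n <= A n &
        A n <= t1 n * x1 n + t2 n * x2 n + t3 n * x3 n]].
Proof.
exists (fun n => X n * (V n * V n)), (fun n => X n * (a n * U n * V n)),
  (fun n => X n * ((a n * U n) * (a n * U n))),
  (fun n => (1 - expR (- (2 * (a n * K) * M n ^+ 3))) * (1 - 2 * K * r n)),
  (fun n => expR (- (M n)^-1) * ((1 - expR (- (a n * M n))) * (1 - expR (- (a n * M n))))).
split.
- split.
  + rewrite -[X in _ --> X]mulr1; apply: cvgM => //.
    rewrite -[X in _ --> X]mulr1; exact: cvgM.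
  + rewrite -[X in _ --> X]mulr1; apply: cvgM => //.
    rewrite -[X in _ --> X]mulr1; exact: cvgM.
  + rewrite -[X in _ --> X]mulr1; apply: cvgM => //.
    rewrite -[X in _ --> X]mulr1; exact: cvgM.
- rewrite -[X in _ --> X]mulr1; apply: cvgM.
    rewrite -[X in _ --> X]subr0; apply: cvgB; first exact: cvg_cst.
    apply: (@cvg_squeeze_near _ _ (cst 0) (fun n => expR (- (2 * eta * K * M n ^+ 3)))).
    * move/cvgryPge : M3y => /(_ 0); apply: filterS => n M3.
      by rewrite expR_ge0 ler_expR lerN2 ler_wpM2r// mulrA ler_wpM2r ?(ltW K0)// ler_wpM2l.
    * exact: cvg_cst.
    * by apply: cvg_expN => //; rewrite mulr_gt0// mulr_gt0.
  rewrite -[X in _ --> X]subr0; apply: cvgB; first exact: cvg_cst.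
  by rewrite -[X in _ --> X](mulr0 (2 * K)); apply: cvgM => //; exact: cvg_cst.
- rewrite -[X in _ --> X]mulr1; apply: cvgM.
    rewrite -[X in _ --> X]expR0; apply: cvg_expR.
    by rewrite -oppr0; apply: cvgN; exact: cvg_inv_pinfty.
  have e1 : 1 - expR (- (a n * M n)) @[n --> \oo] --> (1 : R).
    rewrite -[X in _ --> X]subr0; apply: cvgB; first exact: cvg_cst.
    apply: (@cvg_squeeze_near _ _ (cst 0) (fun n => expR (- (eta * M n)))).
    * move/cvgryPge : My => /(_ 0); apply: filterS => n Mn0.
      by rewrite expR_ge0 ler_expR lerN2 ler_wpM2r.
    * exact: cvg_cst.
    * exact: cvg_expN.
  by rewrite -[X in _ --> X]mulr1; apply: cvgM.
have Kd : 0 < K^-1 by rewrite invr_gt0.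
have h2 : 0 < (2^-1 : R) by rewrite invr_gt0.
have n1 : \forall n \near \oo, (0 : R) < n%:R by near=> n; rewrite ltr0n; near: n; exact: nbhs_infty_gt.
have s_a : \forall n \near \oo, (M n ^+ 2)^-1 < eta.
  by move/cvgr0_norm_lt : s_0 => /(_ _ eta0); apply: filterS => n; exact: le_lt_trans (ler_norm _).
have sK : \forall n \near \oo, Num.sqrt (r n) < K^-1.
  by move/cvgr0_norm_lt : sqr_0 => /(_ _ Kd); apply: filterS => n; exact: le_lt_trans (ler_norm _).
have s2 : \forall n \near \oo, Num.sqrt (r n) < 2^-1.
  by move/cvgr0_norm_lt : sqr_0 => /(_ _ h2); apply: filterS => n; exact: le_lt_trans (ler_norm _).
have M1 : \forall n \near \oo, 1 <= M n by move/cvgryPge : My => /(_ 1).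
near=> n.
have n0 : (0 : R) < n%:R by near: n.
have M1n : 1 <= M n by near: n.
have M0 : 0 < M n by lra.
have MNn : M n ^+ 3 = n%:R * p n * r n ^+ 2 by near: n.
have sa : (M n ^+ 2)^-1 < a n by apply: lt_le_trans (ea n); near: n.
have sq0 : 0 <= Num.sqrt (r n) by exact: sqrtr_ge0.
have rE : r n = Num.sqrt (r n) * Num.sqrt (r n) by rewrite -expr2 sqr_sqrtr// ltW.
have Ks : K * r n <= Num.sqrt (r n).
  rewrite {1}rE mulrA -[leRHS]mul1r ler_wpM2r// -ler_pdivlMl// mulr1 ltW//.
  by near: n.
have s12 : Num.sqrt (r n) <= 2^-1 by apply: ltW; near: n.
have Kr2 : K * r n <= 2^-1 by exact: le_trans s12.
have r12 : r n <= 2^-1.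
  rewrite rE; apply: le_trans (_ : Num.sqrt (r n) * 1 <= _); last by rewrite mulr1.
  by rewrite ler_wpM2l//; lra.
have rs : r n * (M n ^+ 2)^-1 <= 2^-1.
  rewrite -[leRHS]mulr1 ler_pM ?(ltW (r0 n))// ?invr_ge0 ?exprn_ge0 ?(ltW M0)//.
  by rewrite invf_le1 ?exprn_gt0// exprn_ege1.
have EEn := @EE n.
split.
- exact: (interior_le (P n) (mE n) (E0 n) EEn n0).
- exact: (edge_le (P n) (mE n) (E0 n) EEn n0 (p0 n) (r0 n) (a0 n) K0 MNn Kr2).
- exact: (corner_le (P n) (mE n) (E0 n) EEn n0 (p0 n) (r0 n) (a0 n) M0 MNn rs).
- exact: (target_upper (P n) (mE n) (E0 n) EEn n0 (p0 n) (r0 n) (a0 n) M0 K0 MNn sa Ks s12).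
Unshelve. all: by end_near.
Qed.

End sandwich_limit.

(** * Limits on the logarithmic scale *)

Section log_scale.
Context {R : realType}.
Implicit Types f g : nat -> R.

Lemma cvg_ln_nat : ln (n%:R : R) @[n --> \oo] --> +oo.
Proof.
apply/cvgryPge => A; near=> n.
rewrite -ler_expR lnK; last by rewrite posrE ltr0n; near: n; exact: nbhs_infty_gt.
by near: n; exact: nbhs_infty_ger.
Unshelve. all: by end_near. Qed.

Lemma natr_expR_ln (n : nat) : (0 < n)%N -> n%:R = expR (ln n%:R) :> R.
Proof. by move=> n0; rewrite lnK// posrE ltr0n. Qed.

Lemma cvg_ln_pinfty f : f n @[n --> \oo] --> +oo -> ln (f n) @[n --> \oo] --> +oo.
Proof.
move=> /cvgryPge fy; apply/cvgryPge => A; move: (fy (expR A)).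
apply: filterS => n fA.
have f0 : 0 < f n by apply: lt_le_trans fA; exact: expR_gt0.
by rewrite -ler_expR lnK.
Qed.

(** Here ln X = o(X) is y e^(-y) -> 0 at y = ln X. The ratio allows the iterated logarithm of the
    hypotheses to be exchanged for ln lam, up to a constant and o(1), and lam is the factor inside
    q. *)
Lemma cvg_sub_ln_ratio X v B : (X : nat -> R) n @[n --> \oo] --> +oo ->
  (\forall n \near \oo, `|v n| <= B :> R) ->
  (X n - ln (X n) + v n) / X n @[n --> \oo] --> (1 : R).
Proof.
move=> Xy vB.
have Xi := cvg_inv_pinfty Xy.
have lX : ln (X n) * (X n)^-1 @[n --> \oo] --> (0 : R).
  have := @cvg_pow_expN R (fun n => ln (X n)) 1 1 ltr01 (cvg_ln_pinfty Xy).
  apply: cvg_trans; apply: near_eq_cvg.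
  move/cvgryPgt : Xy => /(_ 0); apply: filterS => n X0.
  by rewrite /= expr1 mul1r expRN lnK.
have vX : v n * (X n)^-1 @[n --> \oo] --> (0 : R).
  apply: (@cvg_squeeze_near _ _ (fun n => - (B * (X n)^-1)) (fun n => B * (X n)^-1)).
  - move/cvgryPgt : Xy => /(_ 0); move: vB; apply: filterS2 => n vn X0.
    by rewrite -ler_norml normrM [X in _ * X]gtr0_norm ?invr_gt0// ler_wpM2r// invr_ge0 ltW.
  - by rewrite -oppr0 -(mulr0 B); apply: cvgN; apply: cvgM => //; exact: cvg_cst.
  - by rewrite -(mulr0 B); apply: cvgM => //; exact: cvg_cst.
have : 1 - ln (X n) * (X n)^-1 + v n * (X n)^-1 @[n --> \oo] --> (1 : R).
  rewrite -[X in _ --> X]addr0; apply: cvgD => //.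
  by rewrite -[X in _ --> X]subr0; apply: cvgB => //; exact: cvg_cst.
apply: cvg_trans; apply: near_eq_cvg.
move/cvgryPgt : Xy => /(_ 0); apply: filterS => n X0 /=.
by field; rewrite gt_eqF.
Qed.

Lemma cvg_of_sqr f (l : R) : (\forall n \near \oo, 0 <= f n) -> 0 <= l ->
  f n ^+ 2 @[n --> \oo] --> l ^+ 2 -> f n @[n --> \oo] --> l.
Proof.
move=> f0 l0 f2.
have : Num.sqrt (f n ^+ 2) @[n --> \oo] --> Num.sqrt (l ^+ 2).
  by apply: (cvg_comp _ _ f2); exact: sqrt_continuous.
rewrite sqrtr_sqr ger0_norm//; apply: cvg_trans; apply: near_eq_cvg.
by move: f0; apply: filterS => n fn; rewrite /= sqrtr_sqr ger0_norm.
Qed.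

End log_scale.

(** * From the three terms to the limit of the expected value *)

Section target_limit.
Context {R : realType} (eta C : R) (p r a b lam : nat -> R)
  (h : nat -> R -> R) (k : nat -> R -> R -> R) (E : nat -> R * R -> R).
Context (eta0 : 0 < eta) (C0 : 0 < C).
Context (P : forall n, profile (p n) (p n * r n * a n) (C * (p n * r n ^+ 3))
  (p n * r n ^+ 2 * b n / 4) (h n) (k n)).
Context (mE : forall n, measurable_fun setT (E n)) (E0 : forall n z, 0 <= E n z).
Context (EE : forall n x y, 0 <= x <= 1 -> 0 <= y <= 1 ->
  E n (x, y) = expR (- (n%:R * square_mass (k n) x y))).
Context (p0 : forall n, 0 < p n) (r0 : forall n, 0 < r n)
  (aP : forall n, eta <= a n <= C) (bP : forall n, eta <= b n <= C).
Context (lamE : forall n, lam n = n%:R * (p n * r n ^+ 2 * b n)).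

Let L n : R := ln n%:R.

Context (c1 C1 c2 : R) (c10 : 0 < c1) (C10 : 0 < C1) (c20 : 0 < c2)
  (lam_ge : \forall n \near \oo, c1 * L n <= lam n)
  (lam_le : \forall n \near \oo, lam n <= C1 * L n)
  (r_le : \forall n \near \oo, r n <= expR (- (c2 * L n))).

Let q n := p n * lam n * a n ^+ 2 / (4 * b n).

Let A n := n%:R * \int[@lebesgue2 R]_(z in unit_square) E n z.
Let t1 n := interior_term (p n * r n ^+ 2 * b n / 4) n%:R.
Let t2 n := edge_term (p n) (r n) (a n) (p n * r n ^+ 2 * b n / 4) n%:R.
Let t3 n := corner_term (p n) (r n) (a n) (p n * r n ^+ 2 * b n / 4) n%:R.

Let a0 n : 0 < a n. Proof. by case/andP: (aP n) => /(lt_le_trans eta0). Qed.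
Let b0 n : 0 < b n. Proof. by case/andP: (bP n) => /(lt_le_trans eta0). Qed.

Let n_gt0 : \forall n \near \oo, (0 < n)%N. Proof. exact: nbhs_infty_gt. Qed.

Let N n := n%:R * p n * r n ^+ 2.
Let NE n : N n = lam n / b n.
Proof. by rewrite lamE /N; field; rewrite gt_eqF. Qed.

Let N0 n : 0 <= N n.
Proof. by rewrite /N !mulr_ge0 ?exprn_ge0// ltW. Qed.

Let Ny : N n @[n --> \oo] --> +oo.
Proof.
apply/cvgryPge => B.
have Ly := @cvg_ln_nat R.
move/cvgryPge : Ly => /(_ (Num.max B 0 * C / c1)); move: lam_ge.
apply: filterS2 => n lg; rewrite ler_pdivrMr// => LB.
rewrite NE ler_pdivlMr//; case/andP: (bP n) => _ bC; apply: le_trans lg.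
rewrite /L [leRHS]mulrC; apply: le_trans LB.
apply: (@le_trans _ _ (Num.max B 0 * b n)).
  by rewrite ler_wpM2r ?(ltW (b0 n))// le_max lexx.
by rewrite ler_wpM2l// le_max lexx orbT.
Qed.

Let M n := N n `^ 3^-1.
Let M3 n : M n ^+ 3 = N n.
Proof.
by rewrite /M -powR_mulrn ?powR_ge0// -powRrM mulVf// powRr1.
Qed.

Let My : M n @[n --> \oo] --> +oo.
Proof.
apply/cvgryPge => B; move/cvgryPgt : Ny => /(_ (Num.max B 0 ^+ 3)).
apply: filterS => n NB; rewrite leNgt; apply/negP => MB.
have M0 : 0 <= M n by exact: powR_ge0.
have B0 : 0 < B by exact: le_lt_trans MB.
move: NB; rewrite (max_idPl (ltW B0)) -M3 ltNge => /negP; apply.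
by rewrite lerXn2r// ?nnegrE// ltW.
Qed.

(** Since N = lam / b is at most C1 L / eta, the decay exp (- c2 L) is at least as fast as exp (- c
    N) with c = c2 eta / C1. *)
Let rM : \forall n \near \oo, r n <= expR (- (c2 * eta / C1 * M n ^+ 3)).
Proof.
move: lam_le r_le; apply: filterS2 => n ll /le_trans; apply.
rewrite ler_expR lerN2 M3 NE.
have lam0 : 0 <= lam n.
  by rewrite lamE mulr_ge0// mulr_ge0 ?(ltW (b0 n))// mulr_ge0 ?exprn_ge0 ?(ltW (p0 n)) ?(ltW (r0 n)).
case/andP: (bP n) => eb _.
rewrite (_ : c2 * eta / C1 * (lam n / b n) = c2 * (lam n / C1 * (eta / b n))); last by ring.
rewrite ler_wpM2l ?(ltW c20)//.
have lb : lam n / C1 <= L n by rewrite ler_pdivrMr// mulrC.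
apply: le_trans lb.
rewrite ler_piMr// ?divr_ge0 ?(ltW C10)//.
by rewrite ler_pdivrMr// mul1r.
Qed.

Lemma interior_termE : \forall n \near \oo, t1 n = expR (L n - lam n).
Proof.
move: n_gt0; apply: filterS => n n0.
rewrite /t1 /interior_term {1}(@natr_expR_ln R n n0) -expRD; congr expR.
by rewrite /L lamE; field.
Qed.

Lemma edge_term_ge0 n : 0 <= t2 n.
Proof.
by rewrite /t2 /edge_term divr_ge0// ?mulr_ge0 ?expR_ge0// ltW.
Qed.

(** Because lam = n p r^2 b, the quantity q equals (n p r a)^2 / (4 n), the scale common to the edge
    and corner terms. Squaring keeps the identity free of roots. *)
Lemma edge_term_sqr : \forall n \near \oo, t2 n ^+ 2 = expR (L n - lam n) / q n.
Proof.
move: n_gt0; apply: filterS => n n0.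
have nn0 : 0 < (n%:R : R) by rewrite ltr0n.
rewrite /L expRD -(@natr_expR_ln R n n0).
have -> : expR (- lam n) = expR (- (2 * (n%:R * (p n * r n ^+ 2 * b n / 4)))) ^+ 2.
  by rewrite -expRM_natl; congr expR; rewrite lamE; field.
rewrite /t2 /edge_term /q lamE; field.
by rewrite !gt_eqF.
Qed.

Lemma corner_termE : \forall n \near \oo, t3 n = expR (- (lam n / 4)) / q n.
Proof.
move: n_gt0; apply: filterS => n n0.
have nn0 : 0 < (n%:R : R) by rewrite ltr0n.
have -> : expR (- (lam n / 4)) = expR (- (n%:R * (p n * r n ^+ 2 * b n / 4))).
  by congr expR; rewrite lamE; field.
rewrite /t3 /corner_term /q lamE; field.
by rewrite !gt_eqF.
Qed.

(** The upper bound tends to l1 + l2 + l3, whereas each lower bound sees a single term. The two meet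
    because l is both the sum and one of the summands. *)
Lemma target_cvg (l1 l2 l3 l : R) :
  t1 n @[n --> \oo] --> l1 -> t2 n @[n --> \oo] --> l2 -> t3 n @[n --> \oo] --> l3 ->
  l = l1 + l2 + l3 -> [\/ l = l1, l = l2 | l = l3] -> A n @[n --> \oo] --> l.
Proof.
move=> t1l t2l t3l lE lP.
have c0 : 0 < c2 * eta / C1 by rewrite divr_gt0// mulr_gt0.
have MN : \forall n \near \oo, M n ^+ 3 = n%:R * p n * r n ^+ 2.
  by near=> n; exact: M3.
have [x1 [x2 [x3 [m2 [m3 [[x11 x21 x31] m21 m31 sw]]]]]] :=
  sandwich_limit eta0 C0 c0 P mE E0 EE p0 r0 aP MN My rM.
have up : t1 n * x1 n + t2 n * x2 n + t3 n * x3 n @[n --> \oo] --> l.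
  rewrite lE -[l1]mulr1 -[l2]mulr1 -[l3]mulr1.
  by apply: cvgD; [apply: cvgD|]; exact: cvgM.
case: lP => ll.
- apply: (cvg_squeeze_near _ _ up); last by rewrite ll; exact: t1l.
  by move: sw; apply: filterS => n [? _ _ ?]; apply/andP.
- apply: (cvg_squeeze_near (f1 := fun n => t2 n * m2 n) _ _ up).
    by move: sw; apply: filterS => n [_ ? _ ?]; apply/andP.
  by rewrite ll -[l2]mulr1; exact: cvgM.
- apply: (cvg_squeeze_near (f1 := fun n => t3 n * m3 n) _ _ up).
    by move: sw; apply: filterS => n [_ _ ? ?]; apply/andP.
  by rewrite ll -[l3]mulr1; exact: cvgM.
Unshelve. all: by end_near. Qed.

End target_limit.

Lemma ler_norm_ln (R : realType) (m1 m2 x : R) : 0 < m1 -> m1 <= x <= m2 ->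
  `|ln x| <= `|ln m1| + `|ln m2|.
Proof.
move=> m10 /andP[mx xm].
have x0 : 0 < x by exact: lt_le_trans mx.
have m20 : 0 < m2 by exact: lt_le_trans xm.
have l1 : ln m1 <= ln x by rewrite ler_ln ?posrE.
have l2 : ln x <= ln m2 by rewrite ler_ln ?posrE.
have := ler_norm (ln m2); have := ler_norm (- ln m1); rewrite normrN => h1 h2.
have := normr_ge0 (ln m1); have := normr_ge0 (ln m2) => h3 h4.
by rewrite ler_norml; apply/andP; split; lra.
Qed.

(** * Asymptotics of the three terms in each regime *)

Section regimes.
Context {R : realType} (eta C alpha : R) (p a b lam L : nat -> R).
Context (eta0 : 0 < eta) (C0 : 0 < C) (alpha0 : 0 < alpha).
Context (pP : forall n, 0 < p n <= 1)
  (aP : forall n, eta <= a n <= C) (bP : forall n, eta <= b n <= C).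
Context (Ly : L n @[n --> \oo] --> +oo).

Let q n := p n * lam n * a n ^+ 2 / (4 * b n).

Let p0 n : 0 < p n. Proof. by case/andP: (pP n). Qed.
Let a0 n : 0 < a n. Proof. by case/andP: (aP n) => /(lt_le_trans eta0). Qed.
Let b0 n : 0 < b n. Proof. by case/andP: (bP n) => /(lt_le_trans eta0). Qed.

Let L1 : \forall n \near \oo, 1 <= L n. Proof. by move/cvgryPge : Ly => /(_ 1). Qed.

Let ab_le n : a n ^+ 2 / (4 * b n) <= C ^+ 2 / (4 * eta).
Proof.
case/andP: (aP n) => _ aC; case/andP: (bP n) => eb _.
apply: ler_pM.
- exact: sqr_ge0.
- by rewrite invr_ge0 mulr_ge0// ltW.
- by rewrite lerXn2r// nnegrE ltW.
- by rewrite lef_pV2 ?posrE ?mulr_gt0// ler_pM2l.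
Qed.

Let ab_ge n : eta ^+ 2 / (4 * C) <= a n ^+ 2 / (4 * b n).
Proof.
case/andP: (aP n) => ea _; case/andP: (bP n) => _ bC.
apply: ler_pM.
- exact: sqr_ge0.
- by rewrite invr_ge0 mulr_ge0// ltW.
- by rewrite lerXn2r// nnegrE ltW.
- by rewrite lef_pV2 ?posrE ?mulr_gt0// ler_pM2l.
Qed.

Let e2C : 0 < eta ^+ 2 / (4 * C).
Proof. by rewrite divr_gt0 ?exprn_gt0// mulr_gt0. Qed.

Let qE n : q n = p n * lam n * (a n ^+ 2 / (4 * b n)).
Proof. by rewrite /q mulrA. Qed.

Let q_ge0 n : 0 <= lam n -> 0 <= q n.
Proof.
move=> l0; rewrite qE; apply: mulr_ge0; first by rewrite mulr_ge0// ltW.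
by apply: le_trans (ab_ge n); exact: ltW.
Qed.

Let q_ge c1 n : 0 < c1 -> 0 < L n -> c1 * L n <= lam n ->
  c1 * (eta ^+ 2 / (4 * C)) * (p n * L n) <= q n.
Proof.
move=> c10 L0 lg.
rewrite (_ : _ * (p n * L n) = p n * (c1 * L n) * (eta ^+ 2 / (4 * C))); last by ring.
rewrite qE; apply: ler_pM => //.
- by rewrite mulr_ge0 ?mulr_ge0// ltW.
- exact: ltW.
- by rewrite ler_pM2l.
Qed.

Let q_le C1 n : 0 <= lam n -> lam n <= C1 * L n ->
  q n <= C1 * (C ^+ 2 / (4 * eta)) * (p n * L n).
Proof.
move=> l0 lg.
rewrite (_ : _ * (p n * L n) = p n * (C1 * L n) * (C ^+ 2 / (4 * eta))); last by ring.
rewrite qE; apply: ler_pM => //.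
- by rewrite mulr_ge0// ltW.
- by rewrite divr_ge0 ?sqr_ge0// mulr_ge0// ltW.
- by rewrite ler_pM2l.
Qed.

(** The interior term converges by hypothesis, and q, at least a constant times p L, diverges: this
    kills the squared edge term, and the corner term as well since exp (- lam / 4) <= 1. *)
Lemma dense_regime : p n * L n @[n --> \oo] --> +oo ->
  lam n - L n @[n --> \oo] --> - ln alpha ->
  [/\ \forall n \near \oo, 2^-1 * L n <= lam n, \forall n \near \oo, lam n <= 2 * L n,
      expR (L n - lam n) @[n --> \oo] --> alpha,
      expR (L n - lam n) / q n @[n --> \oo] --> (0 : R) &
      expR (- (lam n / 4)) / q n @[n --> \oo] --> (0 : R)].
Proof.
move=> pLy lamL.
have near1 : \forall n \near \oo, `|lam n - L n - (- ln alpha)| < 1.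
  by move/cvgrPdist_lt : lamL => /(_ _ ltr01); apply: filterS => n; rewrite distrC.
(* From here on |lam - L| < 1 + |ln alpha| <= L / 2. *)
have Lbig : \forall n \near \oo, 2 * (1 + `|ln alpha|) <= L n.
  by move/cvgryPge : Ly => /(_ (2 * (1 + `|ln alpha|))).
have lnb : `|ln alpha| >= ln alpha /\ `|ln alpha| >= - ln alpha.
  by split; [exact: ler_norm|rewrite -normrN ler_norm].
have lg : \forall n \near \oo, 2^-1 * L n <= lam n.
  move: near1 Lbig; apply: filterS2 => n; rewrite ltr_norml => /andP[h1 h2] h3.
  case: lnb => ? ?; lra.
have ll : \forall n \near \oo, lam n <= 2 * L n.
  move: near1 Lbig; apply: filterS2 => n; rewrite ltr_norml => /andP[h1 h2] h3.
  case: lnb => ? ?; lra.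
have t1 : expR (L n - lam n) @[n --> \oo] --> alpha.
  have -> : (fun n => expR (L n - lam n)) = (fun n => expR (- (lam n - L n))).
    by apply/funext => n; rewrite opprB.
  rewrite -[X in _ --> X]lnK ?posrE//; apply: cvg_expR.
  by rewrite -[X in _ --> X]opprK; exact: cvgN.
have h0 : 0 < (2^-1 : R) by rewrite invr_gt0.
have qV : (q n)^-1 @[n --> \oo] --> (0 : R).
  apply: cvg_inv_pinfty; apply/cvgryPge => B.
  have K0 : 0 < 2^-1 * (eta ^+ 2 / (4 * C)) by rewrite mulr_gt0.
  move/cvgryPge : pLy => /(_ (B / (2^-1 * (eta ^+ 2 / (4 * C))))) pB.
  near=> n; apply: (@le_trans _ _ (2^-1 * (eta ^+ 2 / (4 * C)) * (p n * L n))).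
    by rewrite mulrC -ler_pdivrMr//; near: n.
  apply: q_ge => //; last by near: n.
  by apply: (lt_le_trans ltr01); near: n.
split; [exact: lg|exact: ll|exact: t1| |].
- by rewrite -(mulr0 alpha); exact: cvgM.
- apply: (cvg_squeeze_near (f1 := cst 0) (f2 := fun n => (q n)^-1)) => //; last exact: cvg_cst.
  near=> n.
  have Ln1 : 1 <= L n by near: n.
  have lgn : 2^-1 * L n <= lam n by near: n.
  have lam0 : 0 <= lam n by lra.
  have qn0 : 0 <= (q n)^-1.
    by rewrite invr_ge0 q_ge0.
  rewrite /= mulr_ge0 ?expR_ge0//= ler_piMl// expR_le1; lra.
Unshelve. all: by end_near. Qed.

(** With X = L - ln p, substituting the formula for lam turns the squared edge term into e^(-o)
    alpha^2 X / lam, and lam / X -> 1. The interior term is this times q -> 0; the corner term is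
    compared through its fourth power. *)
Lemma intermediate_regime (o : nat -> R) : p n * L n @[n --> \oo] --> (0 : R) ->
  p n * L n * expR (L n / 3) @[n --> \oo] --> +oo ->
  (\forall n \near \oo, lam n = ln (4 * b n / (alpha ^+ 2 * a n ^+ 2)) +
     (L n - ln (p n)) - ln (L n - ln (p n)) + o n) ->
  o n @[n --> \oo] --> (0 : R) ->
  [/\ \forall n \near \oo, 2^-1 * L n <= lam n, \forall n \near \oo, lam n <= 6 * L n,
      expR (L n - lam n) @[n --> \oo] --> (0 : R),
      expR (L n - lam n) / q n @[n --> \oo] --> alpha ^+ 2 &
      expR (- (lam n / 4)) / q n @[n --> \oo] --> (0 : R)].
Proof.
move=> pL0 wy lamE o0.
pose B n := 4 * b n / (alpha ^+ 2 * a n ^+ 2).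
pose X n := L n - ln (p n).
have B0 n : 0 < B n by rewrite divr_gt0 ?mulr_gt0 ?exprn_gt0.
have BE n : B n = (alpha ^+ 2 * (a n ^+ 2 / (4 * b n)))^-1.
  by rewrite /B; field; rewrite !gt_eqF.
have al2 : 0 < alpha ^+ 2 by rewrite exprn_gt0.
have m10 : 0 < (alpha ^+ 2 * (C ^+ 2 / (4 * eta)))^-1.
  by rewrite invr_gt0 mulr_gt0// divr_gt0 ?exprn_gt0// mulr_gt0.
have BP n : (alpha ^+ 2 * (C ^+ 2 / (4 * eta)))^-1 <= B n <=
    (alpha ^+ 2 * (eta ^+ 2 / (4 * C)))^-1.
  have ab0 : 0 < a n ^+ 2 / (4 * b n) by exact: lt_le_trans (ab_ge n).
  have C2 : 0 < C ^+ 2 / (4 * eta) by exact: lt_le_trans (ab_le n).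
  rewrite BE; apply/andP; split.
  - by rewrite lef_pV2 ?posrE ?(mulr_gt0 al2)// ler_pM2l.
  - by rewrite lef_pV2 ?posrE ?(mulr_gt0 al2)// ler_pM2l.
have XL n : L n <= X n by rewrite /X lerDl oppr_ge0 ln_le0//; case/andP: (pP n).
have Xy : X n @[n --> \oo] --> +oo.
  by apply: (ger_cvgy _ Ly); apply: nearW.
have o1 : \forall n \near \oo, `|o n| <= 1 by move/cvgr0_norm_le : o0 => /(_ _ ltr01).
set D := `|ln (alpha ^+ 2 * (C ^+ 2 / (4 * eta)))^-1| + `|ln (alpha ^+ 2 * (eta ^+ 2 / (4 * C)))^-1|.
have vB : \forall n \near \oo, `|ln (B n) + o n| <= D + 1.
  move: o1; apply: filterS => n on; apply: le_trans (ler_normD _ _) _.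
  by rewrite lerD// ler_norm_ln.
have rat0 := cvg_sub_ln_ratio Xy vB.
have rat : lam n / X n @[n --> \oo] --> (1 : R).
  move: rat0; apply: cvg_trans; apply: near_eq_cvg; move: lamE; apply: filterS => n ->.
  by congr (_ / _); rewrite /X -/(B n); ring.
have rb : \forall n \near \oo, `|1 - lam n / X n| <= 2^-1.
  by move/cvgrPdist_le : rat; apply; rewrite invr_gt0.
have w1 : \forall n \near \oo, 1 <= p n * L n * expR (L n / 3).
  by move/cvgryPge : wy => /(_ 1).
have lX : \forall n \near \oo, 2^-1 * X n <= lam n <= 2 * X n.
  move: rb L1; apply: filterS2 => n; rewrite ler_norml => /andP[h1 h2] Ln1.
  have X0 : 0 < X n by apply: lt_le_trans (XL n); lra.
  apply/andP; split.
    by rewrite -ler_pdivlMr//; lra.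
  by rewrite -ler_pdivrMr//; lra.
(* From p L e^(L/3) >= 1, - ln p <= L / 3 + ln L. *)
have X3 : \forall n \near \oo, X n <= 3 * L n.
  move: w1 L1; apply: filterS2 => n wn Ln1.
  have L0 : 0 < L n by lra.
  have := ln_ge0 wn; rewrite lnM ?posrE ?expR_gt0 ?mulr_gt0// lnM ?posrE// expRK.
  have := ln_sublinear L0; rewrite /X; lra.
have lg : \forall n \near \oo, 2^-1 * L n <= lam n.
  move: lX; apply: filterS => n /andP[h _]; have := XL n; lra.
have ll : \forall n \near \oo, lam n <= 6 * L n.
  move: lX X3; apply: filterS2 => n /andP[_ h] h3; lra.
have s2 : expR (L n - lam n) / q n @[n --> \oo] --> alpha ^+ 2.
  have : expR (- o n) * (alpha ^+ 2 * (lam n / X n)^-1) @[n --> \oo] --> (1 * (alpha ^+ 2 * 1) : R).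
    apply: cvgM.
      by rewrite -[X in _ --> X]expR0; apply: cvg_expR; rewrite -oppr0; exact: cvgN.
    apply: cvgM; first exact: cvg_cst.
    by rewrite -[X in _ --> X]invr1; apply: cvgV => //; exact: oner_neq0.
  rewrite mul1r mulr1; apply: cvg_trans; apply: near_eq_cvg.
  near=> n.
  have Ln1 : 1 <= L n by near: n.
  have X0 : 0 < X n by apply: lt_le_trans (XL n); lra.
  have lgn : 2^-1 * L n <= lam n by near: n.
  have lam0 : 0 < lam n by lra.
  have lEn : lam n = ln (4 * b n / (alpha ^+ 2 * a n ^+ 2)) +
     (L n - ln (p n)) - ln (L n - ln (p n)) + o n by near: n.
  have -> : L n - lam n = - o n + (- ln (B n) + (ln (p n) + ln (X n))).
    by rewrite lEn -/(B n) -/(X n) /X; ring.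
  rewrite 3!expRD (expRN (ln (B n))) !lnK ?posrE// /B /q; field.
  by rewrite !gt_eqF// !mulr_gt0.
have q0 : q n @[n --> \oo] --> (0 : R).
  apply: (cvg_squeeze_near (f1 := fun=> 0) (f2 := fun n => 6 * (C ^+ 2 / (4 * eta)) * (p n * L n))).
  - near=> n.
    have Ln1 : 1 <= L n by near: n.
    have lgn : 2^-1 * L n <= lam n by near: n.
    have lam0 : 0 <= lam n by lra.
    by rewrite q_ge0//=; apply: q_le => //; near: n.
  - exact: cvg_cst.
  - by rewrite -(mulr0 (6 * (C ^+ 2 / (4 * eta)))); apply: cvgM => //; exact: cvg_cst.
have q_pos : \forall n \near \oo, 0 < q n.
  near=> n.
  have Ln1 : 1 <= L n by near: n.
  have lgn : 2^-1 * L n <= lam n by near: n.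
  have lam0 : 0 < lam n by lra.
  by rewrite /q divr_gt0 ?mulr_gt0 ?exprn_gt0.
have t1 : expR (L n - lam n) @[n --> \oo] --> (0 : R).
  have : expR (L n - lam n) / q n * q n @[n --> \oo] --> (alpha ^+ 2 * 0 : R) by exact: cvgM.
  rewrite mulr0; apply: cvg_trans; apply: near_eq_cvg.
  by move: q_pos; apply: filterS => n qn; rewrite /= mulrVK// unitfE gt_eqF.
have zV : (q n * expR (L n / 3))^-1 @[n --> \oo] --> (0 : R).
  apply: cvg_inv_pinfty; apply/cvgryPge => A.
  have h0 : 0 < (2^-1 : R) by rewrite invr_gt0.
  have K0 : 0 < 2^-1 * (eta ^+ 2 / (4 * C)) by rewrite mulr_gt0.
  move/cvgryPge : wy => /(_ (A / (2^-1 * (eta ^+ 2 / (4 * C))))) pA.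
  near=> n; apply: (@le_trans _ _ (2^-1 * (eta ^+ 2 / (4 * C)) * (p n * L n * expR (L n / 3)))).
    by rewrite mulrC -ler_pdivrMr//; near: n.
  rewrite mulrA ler_wpM2r ?expR_ge0//; apply: q_ge => //; last by near: n.
  by apply: (lt_le_trans ltr01); near: n.
split; [exact: lg|exact: ll|exact: t1|exact: s2|].
have t30 : \forall n \near \oo, 0 <= expR (- (lam n / 4)) / q n.
  by move: q_pos; apply: filterS => n qn; rewrite divr_ge0 ?expR_ge0// ltW.
(* Two square roots reduce to the fourth power, which is the squared edge term times (q
   e^(L/3))^(-3). *)
apply: cvg_of_sqr => //.
apply: (@cvg_of_sqr _ (fun n => (expR (- (lam n / 4)) / q n) ^+ 2)).
- by apply: nearW => n; exact: sqr_ge0.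
- exact: sqr_ge0.
pose z n := (q n * expR (L n / 3))^-1.
have : expR (L n - lam n) / q n * (z n * (z n * z n)) @[n --> \oo] -->
    (alpha ^+ 2 * (0 * (0 * 0)) : R).
  by apply: cvgM => //; apply: cvgM => //; exact: cvgM.
rewrite /z !mulr0 !expr0n/=; apply: cvg_trans; apply: near_eq_cvg.
move: q_pos; apply: filterS => n qn /=.
rewrite -[RHS]exprM.
have eL : expR (L n) = expR (L n / 3) ^+ 3 by rewrite -expRM_natl; congr expR; field.
have el : expR (- lam n) = expR (- (lam n / 4)) ^+ 4 by rewrite -expRM_natl; congr expR; field.
rewrite expRD eL el; field.
by rewrite !gt_eqF// expR_gt0.
Unshelve. all: by end_near. Qed.

(** With Y = - ln p, the corner term becomes e^(-o/4) alpha Y / (lam / 4), and lam / 4 is asymptotic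
    to Y. The squared edge term is its fourth power times (q e^(L/3))^3 -> 0, and the interior term
    carries one more factor q -> 0. *)
Lemma sparse_regime (o r : nat -> R) : p n * L n * expR (L n / 3) @[n --> \oo] --> (0 : R) ->
  (\forall n \near \oo, 0 < r n <= 1) ->
  (\forall n \near \oo, lam n = expR (L n) * (p n * r n ^+ 2 * b n)) ->
  (\forall n \near \oo, lam n = 4 * (- ln (p n) - ln (- ln (p n)) +
      ln (b n / (alpha * a n ^+ 2))) + o n) ->
  o n @[n --> \oo] --> (0 : R) ->
  [/\ \forall n \near \oo, 3^-1 * L n <= lam n, \forall n \near \oo, lam n <= 8 * L n,
      expR (L n - lam n) @[n --> \oo] --> (0 : R),
      expR (L n - lam n) / q n @[n --> \oo] --> (0 : R) &
      expR (- (lam n / 4)) / q n @[n --> \oo] --> alpha].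
Proof.
move=> w0 rP lamE' lamE o0.
pose B n := b n / (alpha * a n ^+ 2).
pose Y n := - ln (p n).
have B0 n : 0 < B n by rewrite divr_gt0 ?mulr_gt0 ?exprn_gt0.
have BE n : B n = (4 * alpha * (a n ^+ 2 / (4 * b n)))^-1.
  by rewrite /B; field; rewrite !gt_eqF.
have al2 : 0 < 4 * alpha by rewrite mulr_gt0.
have m10 : 0 < (4 * alpha * (C ^+ 2 / (4 * eta)))^-1.
  by rewrite invr_gt0 mulr_gt0// divr_gt0 ?exprn_gt0// mulr_gt0.
have BP n : (4 * alpha * (C ^+ 2 / (4 * eta)))^-1 <= B n <=
    (4 * alpha * (eta ^+ 2 / (4 * C)))^-1.
  have ab0 : 0 < a n ^+ 2 / (4 * b n) by exact: lt_le_trans (ab_ge n).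
  have C2 : 0 < C ^+ 2 / (4 * eta) by exact: lt_le_trans (ab_le n).
  rewrite BE; apply/andP; split.
  - by rewrite lef_pV2 ?posrE ?(mulr_gt0 al2)// ler_pM2l.
  - by rewrite lef_pV2 ?posrE ?(mulr_gt0 al2)// ler_pM2l.
have w1 : \forall n \near \oo, p n * L n * expR (L n / 3) <= 1.
  move/cvgr0_norm_le : w0 => /(_ _ ltr01); apply: filterS => n; exact: le_trans (ler_norm _).
(* From p L e^(L/3) <= 1, - ln p >= L / 3 + ln L >= L / 3. *)
have YL : \forall n \near \oo, 3^-1 * L n <= Y n.
  move: w1 L1; apply: filterS2 => n wn Ln1.
  have L0 : 0 < L n by lra.
  have := ln_le0 wn; rewrite lnM ?posrE ?expR_gt0 ?mulr_gt0// lnM ?posrE// expRK.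
  have := ln_ge0 Ln1; rewrite /Y; lra.
have Yy : Y n @[n --> \oo] --> +oo.
  apply/cvgryPge => A; move/cvgryPge : Ly => /(_ (3 * A)); move: YL.
  apply: filterS2 => n; lra.
have o1 : \forall n \near \oo, `|o n| <= 1 by move/cvgr0_norm_le : o0 => /(_ _ ltr01).
set D := `|ln (4 * alpha * (C ^+ 2 / (4 * eta)))^-1| + `|ln (4 * alpha * (eta ^+ 2 / (4 * C)))^-1|.
have vB : \forall n \near \oo, `|ln (B n) + o n / 4| <= D + 1.
  move: o1; apply: filterS => n on; apply: le_trans (ler_normD _ _) _.
  rewrite lerD ?ler_norm_ln// normrM (@ger0_norm _ 4^-1) ?invr_ge0//.
  by have := normr_ge0 (o n); lra.
have rat0 := cvg_sub_ln_ratio Yy vB.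
have rat : lam n / 4 / Y n @[n --> \oo] --> (1 : R).
  move: rat0; apply: cvg_trans; apply: near_eq_cvg; move: lamE; apply: filterS => n ->.
  by congr (_ / _); rewrite -/(Y n) -/(B n); field.
have rb : \forall n \near \oo, `|1 - lam n / 4 / Y n| <= 2^-1.
  by move/cvgrPdist_le : rat; apply; rewrite invr_gt0.
have lY : \forall n \near \oo, 2 * Y n <= lam n <= 8 * Y n.
  near=> n.
  have Ln1 : 1 <= L n by near: n.
  have YLn : 3^-1 * L n <= Y n by near: n.
  have Y0 : 0 < Y n by lra.
  have : `|1 - lam n / 4 / Y n| <= 2^-1 by near: n.
  rewrite ler_norml => /andP[h1 h2].
  have h3 : lam n / 4 / Y n <= 2 by lra.
  have h4 : 2^-1 <= lam n / 4 / Y n by lra.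
  move: h3 h4; rewrite ler_pdivrMr// ler_pdivlMr//; lra.
have lg : \forall n \near \oo, 3^-1 * L n <= lam n.
  near=> n.
  have Ln1 : 1 <= L n by near: n.
  have YLn : 3^-1 * L n <= Y n by near: n.
  have : 2 * Y n <= lam n <= 8 * Y n by near: n.
  move=> /andP[]; lra.
(* As r <= 1 and b <= C, lam <= n p C; once lam >= C this forces n p >= 1, that is - ln p <= L. *)
have YL1 : \forall n \near \oo, Y n <= L n.
  move/cvgryPge : (Ly) => /(_ (3 * C)) LC.
  near=> n.
  have lgn : 3^-1 * L n <= lam n by near: n.
  have LCn : 3 * C <= L n by near: n.
  have lamC : C <= lam n by lra.
  have lEn : lam n = expR (L n) * (p n * r n ^+ 2 * b n) by near: n.
  have : 0 < r n <= 1 by near: n.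
  move=> /andP[rn0 rn1].
  have r2 : r n ^+ 2 <= 1 by rewrite exprn_ile1// ltW.
  have bC : b n <= C by case/andP: (bP n).
  have h : C <= expR (L n) * p n * C.
    apply: le_trans lamC _; rewrite lEn.
    rewrite (_ : expR (L n) * _ = expR (L n) * p n * (r n ^+ 2 * b n)); last by ring.
    rewrite ler_wpM2l ?mulr_ge0 ?expR_ge0 ?(ltW (p0 n))//.
    apply: (@le_trans _ _ (1 * b n)); last by rewrite mul1r.
    by rewrite ler_wpM2r ?(ltW (b0 n)).
  have {}h : 1 <= expR (L n) * p n by rewrite -(ler_pM2r C0) mul1r.
  have := ln_ge0 h; rewrite lnM ?posrE ?expR_gt0// expRK /Y; lra.
have ll : \forall n \near \oo, lam n <= 8 * L n.
  move: lY YL1; apply: filterS2 => n /andP[_ h] h3; lra.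
have q_pos : \forall n \near \oo, 0 < q n.
  near=> n.
  have Ln1 : 1 <= L n by near: n.
  have lgn : 3^-1 * L n <= lam n by near: n.
  have lam0 : 0 < lam n by lra.
  by rewrite /q divr_gt0 ?mulr_gt0 ?exprn_gt0.
have t3 : expR (- (lam n / 4)) / q n @[n --> \oo] --> alpha.
  have : expR (- (o n / 4)) * (alpha * (lam n / 4 / Y n)^-1) @[n --> \oo] --> (1 * (alpha * 1) : R).
    apply: cvgM.
      rewrite -[X in _ --> X]expR0; apply: cvg_expR; rewrite -oppr0; apply: cvgN.
      by rewrite -(mul0r 4^-1); apply: cvgM => //; exact: cvg_cst.
    apply: cvgM; first exact: cvg_cst.
    by rewrite -[X in _ --> X]invr1; apply: cvgV => //; exact: oner_neq0.
  rewrite mul1r mulr1; apply: cvg_trans; apply: near_eq_cvg.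
  near=> n.
  have Ln1 : 1 <= L n by near: n.
  have YLn : 3^-1 * L n <= Y n by near: n.
  have Y0 : 0 < Y n by lra.
  have lgn : 3^-1 * L n <= lam n by near: n.
  have lam0 : 0 < lam n by lra.
  have lEn : lam n = 4 * (- ln (p n) - ln (- ln (p n)) +
      ln (b n / (alpha * a n ^+ 2))) + o n by near: n.
  have -> : expR (- (lam n / 4)) = expR (- (o n / 4) + (- ln (B n) + (ln (p n) + ln (Y n)))).
    congr expR; rewrite lEn -/(B n) -/(Y n) (_ : ln (p n) = - Y n); first by field.
    by rewrite /Y opprK.
  rewrite 3!expRD (expRN (ln (B n))) !lnK ?posrE// /B /q; field.
  by rewrite !gt_eqF// !mulr_gt0.
have z0 : q n * expR (L n / 3) @[n --> \oo] --> (0 : R).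
  apply: (cvg_squeeze_near (f1 := fun=> 0)
    (f2 := fun n => 8 * (C ^+ 2 / (4 * eta)) * (p n * L n * expR (L n / 3)))).
  - near=> n.
    have qn : 0 < q n by near: n.
    rewrite mulr_ge0 ?(ltW qn) ?expR_ge0//= mulrA ler_wpM2r ?expR_ge0//.
    have Ln1 : 1 <= L n by near: n.
    have lgn : 3^-1 * L n <= lam n by near: n.
    have lam0 : 0 <= lam n by lra.
    by apply: q_le => //; near: n.
  - exact: cvg_cst.
  - by rewrite -(mulr0 (8 * (C ^+ 2 / (4 * eta)))); apply: cvgM => //; exact: cvg_cst.
have q0 : q n @[n --> \oo] --> (0 : R).
  apply: (cvg_squeeze_near (f1 := fun=> 0) (f2 := fun n => q n * expR (L n / 3))) => //.
    move: q_pos L1; apply: filterS2 => n qn Ln1.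
    rewrite (ltW qn)/= ler_peMr ?(ltW qn)// -[leLHS]expR0 ler_expR; lra.
  exact: cvg_cst.
have s2 : expR (L n - lam n) / q n @[n --> \oo] --> (0 : R).
  pose t n := expR (- (lam n / 4)) / q n; pose z n := q n * expR (L n / 3).
  have : (t n * t n) * (t n * t n) * (z n * (z n * z n)) @[n --> \oo] -->
      ((alpha * alpha) * (alpha * alpha) * (0 * (0 * 0)) : R).
    apply: cvgM; first by apply: cvgM; exact: cvgM.
    by apply: cvgM => //; exact: cvgM.
  rewrite /t /z !mulr0; apply: cvg_trans; apply: near_eq_cvg.
  move: q_pos; apply: filterS => n qn /=.
  have eL : expR (L n) = expR (L n / 3) ^+ 3 by rewrite -expRM_natl; congr expR; field.
  have el : expR (- lam n) = expR (- (lam n / 4)) ^+ 4 by rewrite -expRM_natl; congr expR; field.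
  by rewrite expRD eL el; field; rewrite gt_eqF.
have t1 : expR (L n - lam n) @[n --> \oo] --> (0 : R).
  have : expR (L n - lam n) / q n * q n @[n --> \oo] --> (0 * 0 : R) by exact: cvgM.
  rewrite mulr0; apply: cvg_trans; apply: near_eq_cvg.
  by move: q_pos; apply: filterS => n qn; rewrite /= mulrVK// unitfE gt_eqF.
by split; [exact: lg|exact: ll|exact: t1|exact: s2|exact: t3].
Unshelve. all: by end_near. Qed.

(** This supplies the decay of r in the regimes with p L n^(1/3) -> oo. There n p r^2 b <= C1 L and
    p >= n^(-1/3) / L give r^2 <= (C1 / eta) L^2 n^(-2/3); a factor n^(1/3) absorbs (C1 / eta) L^2,
    leaving r <= n^(-1/6). *)
Lemma range_small (C1 : R) (r : nat -> R) : 0 < C1 ->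
  p n * L n * expR (L n / 3) @[n --> \oo] --> +oo ->
  (forall n, 0 < r n) ->
  (\forall n \near \oo, lam n <= C1 * L n) ->
  (\forall n \near \oo, lam n = expR (L n) * (p n * r n ^+ 2 * b n)) ->
  \forall n \near \oo, r n <= expR (- (6^-1 * L n)).
Proof.
move=> C10 wy r0 ll lE.
have h3 : 0 < (3^-1 : R) by rewrite invr_gt0.
have D0 : 0 < eta / C1 by rewrite divr_gt0.
have small := @cvg_pow_expN R L 3^-1 2 h3 Ly.
move/cvgr0_norm_le : small => /(_ _ D0) small.
move/cvgryPge : wy => /(_ 1) w1.
near=> n.
have Ln1 : 1 <= L n by near: n.
have L0 : 0 < L n by lra.
have w1n : 1 <= p n * L n * expR (L n / 3) by near: n.
have lln : lam n <= C1 * L n by near: n.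
have lEn : lam n = expR (L n) * (p n * r n ^+ 2 * b n) by near: n.
have sm : L n ^+ 2 * expR (- (3^-1 * L n)) <= eta / C1.
  by apply: le_trans (ler_norm _) _; near: n.
have eb : eta <= b n by case/andP: (bP n).
rewrite -(@ler_pXn2r _ 2) ?nnegrE ?expR_ge0 ?(ltW (r0 n))//.
rewrite -expRM_natl (_ : 2%:R * _ = - (3^-1 * L n)); last by field.
have pe : 1 <= p n * L n * expR (3^-1 * L n) by rewrite (mulrC 3^-1).
have r2 : 0 <= r n ^+ 2 by rewrite sqr_ge0.
(* [e^L p r^2 eta <= lam <= C1 L] and [p >= e^(- L / 3) / L] *)
have k1 : expR (L n) * (p n * r n ^+ 2 * eta) <= C1 * L n.
  apply: le_trans lln; rewrite lEn ler_wpM2l ?expR_ge0// ler_wpM2l//.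
  by rewrite mulr_ge0// ltW.
have k2 : expR (L n) * r n ^+ 2 * eta <= C1 * L n ^+ 2 * expR (3^-1 * L n).
  apply: (@le_trans _ _ (expR (L n) * r n ^+ 2 * eta * (p n * L n * expR (3^-1 * L n)))).
    by rewrite ler_peMr// !mulr_ge0 ?expR_ge0// ltW.
  have Le : 0 <= L n * expR (3^-1 * L n) by rewrite mulr_ge0 ?expR_ge0// ltW.
  have := ler_wpM2r Le k1; lra.
have k3 : C1 * (L n ^+ 2 * expR (- (3^-1 * L n))) <= eta.
  by rewrite mulrC -ler_pdivlMr.
have eL : expR (L n) = expR (3^-1 * L n) ^+ 3.
  by rewrite -expRM_natl; congr expR; field.
have eV : expR (- (3^-1 * L n)) * expR (3^-1 * L n) = 1 by rewrite mulrC expRxMexpNx_1.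
set e := expR (3^-1 * L n) in k2 eL eV *; set f := expR (- (3^-1 * L n)) in k3 eV *.
have e0 : 0 < e by exact: expR_gt0.
have f0 : 0 < f by exact: expR_gt0.
have k4 : C1 * L n ^+ 2 <= eta * e.
  have := ler_wpM2r (ltW e0) k3.
  by rewrite -!mulrA eV mulr1.
have k5 : eta * (e ^+ 3 * r n ^+ 2) <= eta * e ^+ 2.
  have := ler_wpM2r (ltW e0) k4; rewrite eL in k2; lra.
rewrite ler_pM2l// in k5.
have := ler_wpM2r (ltW (exprn_gt0 3 f0)) k5.
rewrite (_ : e ^+ 3 * r n ^+ 2 * f ^+ 3 = (f * e) ^+ 3 * r n ^+ 2); last by ring.
rewrite (_ : e ^+ 2 * f ^+ 3 = (f * e) ^+ 2 * f); last by ring.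
by rewrite eV !expr1n !mul1r.
Unshelve. all: by end_near. Qed.

End regimes.

(** * The theorem *)

(** The point x is carried as a parameter while the two coordinates of y are integrated out one at a
    time, so measurability of a parametric integral applies twice. *)
Lemma measurable_overlap (R : realType) (phi : R * R -> R) :
  measurable_fun setT phi -> (forall z, 0 <= phi z) ->
  measurable_fun setT (fun x : R * R => \int[lebesgue2]_(y in unit_square) phi (y - x)).
Proof.
move=> mphi phi0.
have mB (x : R * R) : measurable_fun setT (fun y : R * R => y - x).
  by apply: measurable_fun_pair => /=; apply: measurable_funB.
pose f (w : (R * R) * R * R) := (phi ((w.1.2, w.2) - w.1.1))%:E.
have f0 w : (0 <= f w)%E by rewrite lee_fin.
have mf : measurable_fun setT f.
  apply/measurable_EFinP; apply: measurableT_comp => //.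
  apply: measurable_fun_pair => /=; apply: measurable_funB => //=;
    by do 2 (apply: measurableT_comp => //).
have m01 : measurable (`[0, 1]%classic : set R) by [].
have mg := measurable_integral_section (@lebesgue_measure R) m01 mf f0.
have g0 z : (0 <= \int[@lebesgue_measure R]_(v in `[0%R, 1%R]) f (z, v))%E.
  by apply: integral_ge0 => v _; exact: f0.
have m := measurable_integral_section (@lebesgue_measure R) m01 mg g0.
have -> : (fun x : R * R => \int[lebesgue2]_(y in unit_square) phi (y - x)) =
  (fun x => fine (\int[@lebesgue_measure R]_(u in `[0%R, 1%R])
     \int[@lebesgue_measure R]_(v in `[0%R, 1%R]) f (x, u, v))%E).
  apply/funext => x; rewrite /Rintegral /unit_square.
  have mx : measurable_fun setT (fun y : R * R => (phi (y - x))%:E).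
    by apply/measurable_EFinP; exact: (measurableT_comp mphi (mB x)).
  have x0 (y : R * R) : (0 <= (phi (y - x))%:E)%E by rewrite lee_fin.
  by rewrite (integral_setX m01 m01 mx x0).
exact: (measurableT_comp (fine_measurable measurableT) m).
Qed.

(** * Landau symbols as limits of quotients *)

Section littleo_quotients.
Context {R : realType}.
Implicit Types f g : nat -> R.

Lemma littleo_cvg_pinfty f g : f =o_\oo g -> (\forall n \near \oo, 0 < f n) ->
  (forall n, 0 < g n) -> g n / f n @[n --> \oo] --> +oo.
Proof.
move=> /eqoP fg f0 g0; apply/cvgryPge => A.
have A1 : 0 < Num.max A 1 by rewrite lt_max ltr01 orbT.
have A1V : 0 < (Num.max A 1)^-1 by rewrite invr_gt0.
move: (fg _ A1V) f0; apply: filterS2 => n h fn.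
rewrite ler_pdivlMr//; move: h; rewrite !gtr0_norm// => h.
apply: (@le_trans _ _ (Num.max A 1 * f n)).
  by rewrite ler_wpM2r ?(ltW fn)// le_max lexx.
by rewrite -ler_pdivlMl// ltW.
Qed.

Lemma littleo_cvg0 f g : f =o_\oo g -> (\forall n \near \oo, 0 < g n) ->
  (forall n, 0 < f n) -> f n / g n @[n --> \oo] --> (0 : R).
Proof.
move=> /eqoP fg g0 f0; apply/cvgr0Pnorm_le => e e0.
move: (fg _ e0) g0; apply: filterS2 => n h gn.
by rewrite normrM normfV ler_pdivrMr ?normr_gt0 ?gt_eqF.
Qed.

Lemma littleo_add_cvg0 f g : f = g +o_\oo (fun=> 1 : R) ->
  f n - g n @[n --> \oo] --> (0 : R).
Proof.
move=> /eqaddoP fg; apply/cvgr0Pnorm_le => e e0.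
by move: (fg _ e0); apply: filterS => n; rewrite normr1 mulr1.
Qed.

End littleo_quotients.

Theorem theorem2p5 (R : realType) (eta alpha : R)
    (eta01 : 0 < eta <= 1) (alpha_gt0 : 0 < alpha)
    (phi : nat -> R * R -> R)
    (phiP : forall n, (Phi2 eta `&` Psi2) (phi n)) :
  let r n := rho eta (phi n) in
  let p n := mu (phi n) in
  [\/ (* (1) *)
      is_omega p (fun n => 1 / ln n%:R) /\
      n%:R * Iint (phi n) - ln n%:R @[n --> \oo] --> - ln alpha,
      (* (2) *)
      [/\ p =o_\oo (fun n => 1 / ln n%:R),
          is_omega p (fun n => n%:R `^ (- (1 / 3)) * (ln n%:R)^-1) &
          (fun n => n%:R * Iint (phi n)) =
          (fun n => ln (4 * J2 eta (phi n) /
                          (alpha ^+ 2 * J1 eta (phi n) ^+ 2))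
                    + ln (n%:R / p n) - ln (ln (n%:R / p n)))
          +o_\oo (fun _ => 1 : R)] |
      (* (3) *)
      [/\ p =o_\oo (fun n => n%:R `^ (- (1 / 3)) * (ln n%:R)^-1),
          is_polynomially_small r &
          (fun n => n%:R * Iint (phi n)) =
          (fun n => 4 * (ln (1 / p n) - ln (ln (1 / p n))
                         + ln (J2 eta (phi n) /
                                 (alpha * J1 eta (phi n) ^+ 2))))
          +o_\oo (fun _ => 1 : R)]] ->
  n%:R * \int[lebesgue2]_(x in unit_square)
      expR (- (n%:R * \int[lebesgue2]_(y in unit_square) phi n (y - x)))
    @[n --> \oo] --> alpha.
Proof.
move=> r p hyp.
have eta0 : 0 < eta by case/andP: eta01.
have [C C0 CP] := class_profile eta01.
pose a n := J1 eta (phi n); pose b n := J2 eta (phi n).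
have pP n : 0 < p n <= 1 by have [[]] := CP _ (phiP n).
have r0 n : 0 < r n by have [[]] := CP _ (phiP n).
have aP n : eta <= a n <= C by have [[]] := CP _ (phiP n).
have bP n : eta <= b n <= C by have [[]] := CP _ (phiP n).
have IE n : Iint (phi n) = p n * r n ^+ 2 * b n by have [[]] := CP _ (phiP n).
have p0 n : 0 < p n by case/andP: (pP n).
have /choice[h /choice[k hk]] : forall n, exists h k,
    profile (p n) (p n * r n * a n) (C * (p n * r n ^+ 3)) (p n * r n ^+ 2 * b n / 4) h k /\
    forall x1 x2, 0 <= x1 <= 1 -> 0 <= x2 <= 1 ->
      \int[lebesgue2]_(y in unit_square) phi n (y - (x1, x2)) = square_mass k x1 x2.
  by move=> n; rewrite -IE; have [_] := CP _ (phiP n).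
have P n := (hk n).1.
pose E n (x : R * R) := expR (- (n%:R * \int[lebesgue2]_(y in unit_square) phi n (y - x))).
have E0 n z : 0 <= E n z by exact: expR_ge0.
have mE n : measurable_fun setT (E n).
  apply: measurableT_comp => //; apply: measurableT_comp => //.
  have [[[mphi phi01 _] _ _] _] := phiP n.
  apply: measurable_funM => //; apply: measurable_overlap => // z.
  by case/andP: (phi01 z).
have EE n x y : 0 <= x <= 1 -> 0 <= y <= 1 ->
    E n (x, y) = expR (- (n%:R * square_mass (k n) x y)).
  by move=> xP yP; rewrite /E (hk n).2.
pose L n : R := ln n%:R.
have Ly : L n @[n --> \oo] --> +oo by exact: cvg_ln_nat.
pose lam n := n%:R * (p n * r n ^+ 2 * b n).
pose q n := p n * lam n * a n ^+ 2 / (4 * b n).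
have lamD n : lam n = n%:R * (p n * r n ^+ 2 * b n) by [].
have lamI n : n%:R * Iint (phi n) = lam n by rewrite IE.
have n_gt0 : \forall n \near \oo, (0 < n)%N by exact: nbhs_infty_gt.
have L_gt0 : \forall n \near \oo, 0 < L n by move/cvgryPgt : Ly => /(_ 0).
have lamE : \forall n \near \oo, lam n = expR (L n) * (p n * r n ^+ 2 * b n).
  by move: n_gt0; apply: filterS => n n0; rewrite /L -natr_expR_ln.
(* Common end of the three cases. The limit l2 appears squared because the regimes determine the
   square of the edge term. *)
have concl (c1 C1 c2 l1 l2 l3 : R) : 0 < c1 -> 0 < C1 -> 0 < c2 ->
    (\forall n \near \oo, c1 * L n <= lam n) ->
    (\forall n \near \oo, lam n <= C1 * L n) ->
    (\forall n \near \oo, r n <= expR (- (c2 * L n))) ->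
    expR (L n - lam n) @[n --> \oo] --> l1 ->
    expR (L n - lam n) / q n @[n --> \oo] --> l2 ^+ 2 ->
    expR (- (lam n / 4)) / q n @[n --> \oo] --> l3 ->
    0 <= l2 -> alpha = l1 + l2 + l3 -> [\/ alpha = l1, alpha = l2 | alpha = l3] ->
    n%:R * \int[lebesgue2]_(x in unit_square) E n x @[n --> \oo] --> alpha.
  move=> c10 C10 c20 lg ll rl t1 t2 t3 l20 al alP.
  apply: (target_cvg eta0 C0 P mE E0 EE p0 r0 aP bP lamD c10 C10 c20 lg ll rl _ _ _ al alP) => //.
  - move: t1; apply: cvg_trans; apply: near_eq_cvg.
    by move: (interior_termE lamD); apply: filterS => n ->.
  - apply: cvg_of_sqr => //.
      by apply: nearW => n; exact: (edge_term_ge0 b eta0 p0 r0 aP).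
    move: t2; apply: cvg_trans; apply: near_eq_cvg.
    by move: (edge_term_sqr eta0 p0 r0 aP bP lamD); apply: filterS => n ->.
  - move: t3; apply: cvg_trans; apply: near_eq_cvg.
    by move: (corner_termE eta0 p0 r0 aP bP lamD); apply: filterS => n ->.
have w_pinfty : p n * L n @[n --> \oo] --> +oo -> p n * L n * expR (L n / 3) @[n --> \oo] --> +oo.
  apply: ger_cvgy; move: L_gt0; apply: filterS => n Ln.
  rewrite ler_peMr ?mulr_ge0 ?(ltW Ln) ?(ltW (p0 n))// -[leLHS]expR0 ler_expR.
  by rewrite divr_ge0// ltW.
have f1_gt0 : \forall n \near \oo, 0 < 1 / L n.
  by move: L_gt0; apply: filterS => n Ln; rewrite divr_gt0.
(* The quotient of p by the second threshold is the quantity p L n^(1/3) in which the regimes are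
   stated. *)
have f2E : \forall n \near \oo, p n / (n%:R `^ (- (1 / 3)) * (L n)^-1) = p n * L n * expR (L n / 3).
  move: n_gt0 L_gt0; apply: filterS2 => n n0 Ln.
  rewrite /powR pnatr_eq0 gtn_eqF// -/(L n) (_ : - (1 / 3) * L n = - (L n / 3)); last by field.
  by rewrite expRN; field; rewrite !gt_eqF// expR_gt0.
have f2_gt0 : \forall n \near \oo, 0 < n%:R `^ (- (1 / 3)) * (L n)^-1.
  move: n_gt0 L_gt0; apply: filterS2 => n n0 Ln.
  by rewrite mulr_gt0 ?invr_gt0// powR_gt0// ltr0n.
case: hyp => [[om lamL]|[lo om asy]|[lo [c c0 rc] asy]].
- have pL : p n * L n @[n --> \oo] --> +oo.
    move: (littleo_cvg_pinfty om f1_gt0 p0); apply: cvg_trans; apply: near_eq_cvg.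
    by move: L_gt0; apply: filterS => n Ln; rewrite div1r invrK.
  have {}lamL : lam n - L n @[n --> \oo] --> - ln alpha.
    by move: lamL; under eq_fun do rewrite lamI.
  have [lg ll t1 t2 t3] := dense_regime eta0 C0 alpha_gt0 pP aP bP Ly pL lamL.
  have h2 : 0 < (2^-1 : R) by rewrite invr_gt0.
  have h6 : 0 < (6^-1 : R) by rewrite invr_gt0.
  have two : 0 < (2 : R) by [].
  (* Divergence of p log n implies that of p L n^(1/3), so r decays here too. *)
  have rl := range_small eta0 pP bP Ly two (w_pinfty pL) r0 ll lamE.
  apply: (concl _ _ _ _ 0 0 h2 two h6 lg ll rl t1 _ t3) => //.
  + by rewrite expr0n.
  + by rewrite !addr0.
  + by constructor 1.
- have pL : p n * L n @[n --> \oo] --> (0 : R).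
    move: (littleo_cvg0 lo f1_gt0 p0); apply: cvg_trans; apply: near_eq_cvg.
    by move: L_gt0; apply: filterS => n Ln; rewrite div1r invrK.
  have wy : p n * L n * expR (L n / 3) @[n --> \oo] --> +oo.
    by move: (littleo_cvg_pinfty om f2_gt0 p0); apply: cvg_trans; apply: near_eq_cvg.
  have o0 := littleo_add_cvg0 asy.
  (* The error is named as the difference of the two sides, which makes the formula for lam an
     algebraic identity. *)
  set o := (fun n => _ - _) in o0.
  have lamO : \forall n \near \oo, lam n = ln (4 * b n / (alpha ^+ 2 * a n ^+ 2)) +
     (L n - ln (p n)) - ln (L n - ln (p n)) + o n.
    move: n_gt0; apply: filterS => n n0.
    have lnX : ln (n%:R / p n) = L n - ln (p n) by rewrite ln_div ?posrE ?ltr0n.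
    rewrite /o lamI lnX -/(a n) -/(b n); ring.
  have [lg ll t1 t2 t3] :=
    intermediate_regime eta0 C0 alpha_gt0 pP aP bP Ly pL wy lamO o0.
  have h2 : 0 < (2^-1 : R) by rewrite invr_gt0.
  have h6 : 0 < (6^-1 : R) by rewrite invr_gt0.
  have six : 0 < (6 : R) by [].
  have rl := range_small eta0 pP bP Ly six wy r0 ll lamE.
  apply: (concl _ _ _ 0 _ 0 h2 six h6 lg ll rl t1 t2 t3) => //.
  + exact: ltW.
  + by rewrite add0r addr0.
  + by constructor 2.
- have w0 : p n * L n * expR (L n / 3) @[n --> \oo] --> (0 : R).
    by move: (littleo_cvg0 lo f2_gt0 p0); apply: cvg_trans; apply: near_eq_cvg.
  (* Here the exponent of the assumed decay n^(-c) is used as it stands. *)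
  have rl : \forall n \near \oo, r n <= expR (- (c * L n)).
    move: n_gt0 rc; apply: filterS2 => n n0.
    by rewrite /powR pnatr_eq0 gtn_eqF// mulNr.
  have rP : \forall n \near \oo, 0 < r n <= 1.
    move: rl L_gt0; apply: filterS2 => n rn Ln; rewrite r0/=; apply: le_trans rn _.
    by rewrite expR_le1 oppr_le0 mulr_ge0// ltW.
  have o0 := littleo_add_cvg0 asy.
  set o := (fun n => _ - _) in o0.
  have lamO : \forall n \near \oo, lam n = 4 * (- ln (p n) - ln (- ln (p n)) +
      ln (b n / (alpha * a n ^+ 2))) + o n.
    apply: nearW => n.
    rewrite /o lamI div1r lnV ?posrE// -/(a n) -/(b n); ring.
  have [lg ll t1 t2 t3] :=
    sparse_regime eta0 C0 alpha_gt0 pP aP bP Ly w0 rP lamE lamO o0.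
  have h3 : 0 < (3^-1 : R) by rewrite invr_gt0.
  have eight : 0 < (8 : R) by [].
  apply: (concl _ _ _ 0 0 _ h3 eight c0 lg ll rl t1 _ t3) => //.
  + by rewrite expr0n.
  + by rewrite !add0r.
  + by constructor 3.
Qed.
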